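(* Let $\alpha>-1$, $\beta_0\in(-1,0]$. For every $p,q\in\mathbb N$, consider the transform $G_{p,q}$ given by $$G_{p,q}f(z)=c_{p,q}\int_{\mathbb D}\frac{f(w)}{\overline w^pz^q}\ {}_3F_2\left(\left.\begin{array}{c}1,\ \frac{\alpha+\beta_0+2}{2},\ \frac{\alpha+\beta_0+3}{2}\\ \frac{\beta_0+1}{2},\ \frac{\beta_0+2}{2}\end{array}\right|(\overline wz)^2\right)d\mu_{\alpha,\beta_0+p}(w).$$ Then $G_{p,q}$ maps isometrically the Hilbert space $\mathcal E_p^2(\mathbb D)$ onto $\mathcal E_q^2(\mathbb D)$ and its inverse $G_{p,q}^{-1}:\mathcal E_q^2(\mathbb D)\to\mathcal E_p^2(\mathbb D)$ is given by $$G_{p,q}^{-1}f(w)=c_{p,q}\int_{\mathbb D}\frac{f(z)}{\overline z^qw^p}\ {}_3F_2\left(\left.\begin{array}{c}1,\ \frac{\alpha+\beta_0+2}{2},\ \frac{\alpha+\beta_0+3}{2}\\ \frac{\beta_0+1}{2},\ \frac{\beta_0+2}{2}\end{array}\right|(\overline zw)^2\right)d\mu_{\alpha,\beta_0+q}(z).$$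
   Context: $\mathbb N=\{0,1,2,\dots\}$, $\mathbb D$ is the unit disk, $\mathbb D^*=\mathbb D\setminus\{0\}$, $dA(z)=\frac1\pi\,dx\,dy$, $\mathscr B$ is the beta function. For $\alpha,\beta>-1$, $\mu_{\alpha,\beta}$ is the probability measure on $\mathbb D$ given by $d\mu_{\alpha,\beta}(z)=\frac{|z|^{2\beta}(1-|z|^2)^\alpha}{\mathscr B(\alpha+1,\beta+1)}dA(z)$. $\mathcal A^2(\mathbb D,\mu_{\alpha,\beta})$ is the Hilbert space of holomorphic functions on $\mathbb D^*$ that are square integrable with respect to $\mu_{\alpha,\beta}$, with the $L^2(\mathbb D,\mu_{\alpha,\beta})$ inner product. $(a)_n=a(a+1)\cdots(a+n-1)$ is the Pochhammer symbol, ${}_3F_2\left(\left.\begin{array}{c}a_1,a_2,a_3\\ b_1,b_2\end{array}\right|\xi\right)=\sum_{n=0}^{\infty}\frac{(a_1)_n(a_2)_n(a_3)_n}{(b_1)_n(b_2)_n}\frac{\xi^n}{n!}$. For $p,q,n\ge0$ set $$\gamma_n^p=\sqrt{\frac{(\beta_0+1)_p}{(\alpha+\beta_0+2)_p}\frac{(\alpha+\beta_0+2)_n}{(\beta_0+1)_n}},\qquad c_{p,q}=\sqrt{\frac{(\beta_0+1)_p\,(\beta_0+1)_q}{(\alpha+\beta_0+2)_p\,(\alpha+\beta_0+2)_q}},$$ and $e_n^p(z)=\gamma_n^p\,z^{n-p}$; $(e_n^p)_{n\ge0}$ is an orthonormal basis of $\mathcal A^2(\mathbb D,\mu_{\alpha,\beta_0+p})$.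 $\mathcal E_p^2(\mathbb D)$ is the (closed) Hilbert subspace of $\mathcal A^2(\mathbb D,\mu_{\alpha,\beta_0+p})$ generated by $(e_{2n}^p)_{n\ge0}$. (Output variables $z$, $w$ range over $\mathbb D^*$.) *)

(* Defs.v *)
(* MathComp-Analysis, over an arbitrary R : realType.  The complex plane is
   R[i], with the topology and normed-module structure of its regular module
   (R[i])^o, so that [derivable f z 1] on (R[i])^o is complex
   differentiability; integration is done on R * R through [cplx]. *)
From HB Require Import structures.
From mathcomp Require Import all_boot all_order all_algebra.
From mathcomp Require Import all_classical all_reals all_analysis.
From mathcomp Require Import measurable_realfun complex.

Set Implicit Arguments.
Unset Strict Implicit.
Unset Printing Implicit Defensive.

Import Order.TTheory GRing.Theory Num.Theory.
Import numFieldNormedType.Exports.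

Local Open Scope classical_set_scope.
Local Open Scope ring_scope.
Local Open Scope complex_scope.

(* R * R with its Borel sigma-algebra. *)
Definition plane (R : realType) : measurableType _ :=
  (measurableTypeR R * measurableTypeR R)%type.

Definition cplx {R : realType} (u : plane R) : R[i] := u.1 +i* u.2.

(* The real-valued modulus: `|z| is R[i]-valued. *)
Definition modulus {R : realType} (z : R[i]) : R := Normc.normc z.

Definition punctured_disk (R : realType) : set R[i] :=
  [set z | z != 0 /\ modulus z < 1].

Definition disk2 (R : realType) : set (plane R) :=
  [set u | modulus (cplx u) < 1].

(* dA = (1/pi) dx dy *)
Definition area (R : realType) : {measure set (plane R) -> \bar R} :=
  mscale ((PosNum (pi_gt0 R))%:num^-1)%:nng
    (@lebesgue_measure R \x @lebesgue_measure R)%E.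

Arguments punctured_disk R : clear implicits.
Arguments disk2 R : clear implicits.
Arguments area R : clear implicits.

Definition betaB {R : realType} (a b : R) : R :=
  \int[lebesgue_measure]_(t in `]0, 1[) (t `^ (a - 1) * (1 - t) `^ (b - 1)).

Definition mu_density {R : realType} (alpha beta : R) (u : plane R) : R :=
  let r := modulus (cplx u) in
  r `^ (2 * beta) * (1 - r ^+ 2) `^ alpha / betaB (alpha + 1) (beta + 1).

Definition mu {R : realType} (alpha beta : R) (A : set (plane R)) : \bar R :=
  (\int[area R]_(u in A `&` disk2 R) (mu_density alpha beta u)%:E)%E.

Section mu_measure.
Context {R : realType} (alpha beta : R).

Lemma measurable_modulus :
  measurable_fun [set: plane R] (fun u : plane R => modulus (cplx u)).
Proof.
apply: (@measurableT_comp _ _ _ _ _ _ (@Num.sqrt R)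
  _ (fun u : plane R => u.1 ^+ 2 + u.2 ^+ 2)) => //.
  apply: continuous_measurable_fun; exact: sqrt_continuous.
by apply: measurable_funD; apply: measurable_funX.
Qed.

Lemma measurable_disk2 : measurable (disk2 R).
Proof.
have -> : disk2 R = (fun u : plane R => modulus (cplx u)) @^-1` `]-oo, 1[%classic.
  by apply/seteqP; split=> u /=; rewrite in_itv.
by rewrite -[X in measurable X]setTI; exact: measurable_modulus.
Qed.

Lemma measurable_mu_density : measurable_fun [set: plane R] (mu_density alpha beta).
Proof.
rewrite /mu_density; apply: measurable_funM => //; apply: measurable_funM.
  by apply: (measurableT_comp (measurable_powR _)) => //; exact: measurable_modulus.
apply: (measurableT_comp (measurable_powR _)) => //.
apply: measurable_funB => //; apply: measurable_funX; exact: measurable_modulus.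
Qed.

Lemma betaB_ge0 (a b : R) : 0 <= betaB a b.
Proof. by apply: Rintegral_ge0 => t _; rewrite mulr_ge0// powR_ge0. Qed.

Lemma mu_density_ge0 u : 0 <= mu_density alpha beta u.
Proof.
by rewrite /mu_density !mulr_ge0 ?powR_ge0// invr_ge0 betaB_ge0.
Qed.

Let mu0 : mu alpha beta set0 = 0%E.
Proof. by rewrite /mu set0I integral_set0. Qed.

Let mu_ge0 A : (0 <= mu alpha beta A)%E.
Proof. by apply: integral_ge0 => u _; rewrite lee_fin mu_density_ge0. Qed.

Let mu_sigma_additive : semi_sigma_additive (mu alpha beta).
Proof.
move=> /= A mA tA mUA.
have mAD n : measurable (A n `&` disk2 R).
  by apply: measurableI => //; exact: measurable_disk2.
rewrite /mu setI_bigcupl ge0_integral_bigcup//=.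
- apply: is_cvg_ereal_nneg_natsum_cond => n _ _.
  by apply: integral_ge0 => u _; rewrite lee_fin mu_density_ge0.
- apply/measurable_EFinP.
  by apply: measurable_funTS; exact: measurable_mu_density.
- by move=> u _; rewrite lee_fin mu_density_ge0.
- exact: trivIset_setIr.
Qed.

HB.instance Definition _ := isMeasure.Build _ _ _ (mu alpha beta)
  mu0 mu_ge0 mu_sigma_additive.

End mu_measure.

Definition Cintegrable {R : realType} (m : {measure set (plane R) -> \bar R})
    (F : R[i] -> R[i]) : Prop :=
  m.-integrable (disk2 R) (fun u => (complex.Re (F (cplx u)))%:E) /\
  m.-integrable (disk2 R) (fun u => (complex.Im (F (cplx u)))%:E).

Definition Cintegral {R : realType} (m : {measure set (plane R) -> \bar R})
    (F : R[i] -> R[i]) : R[i] :=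
  (\int[m]_(u in disk2 R) complex.Re (F (cplx u))) +i*
  (\int[m]_(u in disk2 R) complex.Im (F (cplx u))).

(* Linear in the first argument. *)
Definition L2dot {R : realType} (m : {measure set (plane R) -> \bar R})
    (f g : R[i] -> R[i]) : R[i] :=
  Cintegral m (fun z => f z * (g z)^*).

(* The squared L2-norm; as an integral of a nonnegative function it is
   meaningful, possibly infinite, in \bar R. *)
Definition L2sqnorm {R : realType} (m : {measure set (plane R) -> \bar R})
    (f : R[i] -> R[i]) : \bar R :=
  (\int[m]_(u in disk2 R) ((modulus (f (cplx u))) ^+ 2)%:E)%E.

Definition holomorphic_on {R : realType} (U : set R[i]) (f : R[i] -> R[i]) :
    Prop :=
  forall z, U z -> derivable (f : (R[i])^o -> (R[i])^o) z 1.

(* Elements of the function spaces below are represented by total functions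
   of which only the values on the punctured disk are relevant: 0 is a null
   point of every [mu alpha beta]. *)
Definition eq_pdisk {R : realType} (f g : R[i] -> R[i]) : Prop :=
  forall z, punctured_disk R z -> f z = g z.

Definition A2 {R : realType} (m : {measure set (plane R) -> \bar R})
    (f : R[i] -> R[i]) : Prop :=
  holomorphic_on (punctured_disk R) f /\ (L2sqnorm m f < +oo)%E.

Definition pochhammer {K : pzSemiRingType} (a : K) (n : nat) : K :=
  \prod_(i < n) (a + i%:R).

Definition hyp3F2_term {R : realType} (a1 a2 a3 b1 b2 xi : R[i]) (n : nat) :
    (R[i])^o :=
  (pochhammer a1 n * pochhammer a2 n * pochhammer a3 n)
    / (pochhammer b1 n * pochhammer b2 n) * (xi ^+ n / n`!%:R).

Definition hyp3F2 {R : realType} (a1 a2 a3 b1 b2 xi : R[i]) : R[i] :=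
  limn (series (hyp3F2_term a1 a2 a3 b1 b2 xi)).

Section spaces_and_transforms.
Context {R : realType} (alpha beta0 : R).

Definition gamma_coef (p n : nat) : R :=
  Num.sqrt (pochhammer (beta0 + 1) p / pochhammer (alpha + beta0 + 2) p
            * (pochhammer (alpha + beta0 + 2) n / pochhammer (beta0 + 1) n)).

Definition c_coef (p q : nat) : R :=
  Num.sqrt (pochhammer (beta0 + 1) p * pochhammer (beta0 + 1) q
            / (pochhammer (alpha + beta0 + 2) p
               * pochhammer (alpha + beta0 + 2) q)).

Definition e_fun (p n : nat) (z : R[i]) : R[i] :=
  (gamma_coef p n)%:C * z ^ (n%:Z - p%:Z).

Definition mu_shift (p : nat) : {measure set (plane R) -> \bar R} :=
  mu alpha (beta0 + p%:R).

(* The closure, in A2, of the linear span of the e_(2 n). *)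
Definition E2 (p : nat) (f : R[i] -> R[i]) : Prop :=
  A2 (mu_shift p) f /\
  forall eps : R, 0 < eps -> exists (n : nat) (a : nat -> R[i]),
    (L2sqnorm (mu_shift p)
       (fun z => (f z - \sum_(k < n) a k * e_fun p k.*2 z)%R)
     < (eps ^+ 2)%:E)%E.

Definition F_term (xi : R[i]) : nat -> (R[i])^o :=
  hyp3F2_term 1 ((alpha + beta0 + 2) / 2)%:C ((alpha + beta0 + 3) / 2)%:C
    ((beta0 + 1) / 2)%:C ((beta0 + 2) / 2)%:C xi.

Definition F_fun (xi : R[i]) : R[i] :=
  hyp3F2 1 ((alpha + beta0 + 2) / 2)%:C ((alpha + beta0 + 3) / 2)%:C
    ((beta0 + 1) / 2)%:C ((beta0 + 2) / 2)%:C xi.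

Definition G_integrand (p q : nat) (f : R[i] -> R[i]) (z w : R[i]) : R[i] :=
  f w / (w^* ^+ p * z ^+ q) * F_fun ((w^* * z) ^+ 2).

Definition G (p q : nat) (f : R[i] -> R[i]) (z : R[i]) : R[i] :=
  (c_coef p q)%:C * Cintegral (mu_shift p) (G_integrand p q f z).

Definition Ginv_integrand (p q : nat) (f : R[i] -> R[i]) (w z : R[i]) : R[i] :=
  f z / (z^* ^+ q * w ^+ p) * F_fun ((z^* * w) ^+ 2).

Definition Ginv (p q : nat) (f : R[i] -> R[i]) (w : R[i]) : R[i] :=
  (c_coef p q)%:C * Cintegral (mu_shift q) (Ginv_integrand p q f w).

End spaces_and_transforms.

(* T is a linear, norm- and inner-product-preserving map of X (with the L2 m
   structure) onto Y (with the L2 m' structure). *)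
Definition isometry_onto {R : realType}
    (m m' : {measure set (plane R) -> \bar R}) (X Y : (R[i] -> R[i]) -> Prop)
    (T : (R[i] -> R[i]) -> R[i] -> R[i]) : Prop :=
  [/\ forall f, X f -> Y (T f),
      forall (a b : R[i]) f g, X f -> X g ->
        eq_pdisk (T (fun z => a * f z + b * g z))
                 (fun z => a * T f z + b * T g z),
      forall f, X f -> L2sqnorm m' (T f) = L2sqnorm m f,
      forall f g, X f -> X g -> L2dot m' (T f) (T g) = L2dot m f g
    & forall g, Y g -> exists2 f, X f & eq_pdisk (T f) g].

(* S, as a map from Y to X, is the inverse of T : X -> Y. *)
Definition inverse_map {R : realType} (X Y : (R[i] -> R[i]) -> Prop)
    (T S : (R[i] -> R[i]) -> R[i] -> R[i]) : Prop :=
  [/\ forall g, Y g -> X (S g),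
      forall f, X f -> eq_pdisk (S (T f)) f
    & forall g, Y g -> eq_pdisk (T (S g)) g].

(* Main.v *)
Require Import Defs.
From HB Require Import structures.
From mathcomp Require Import all_boot all_order all_algebra.
From mathcomp Require Import all_classical all_reals all_analysis.
From mathcomp Require Import measurable_realfun complex ring lra.

Import Order.TTheory GRing.Theory Num.Theory.
Import numFieldNormedType.Exports.

Local Open Scope classical_set_scope.
Local Open Scope ring_scope.
Local Open Scope complex_scope.

(** An element of [E2 alpha beta0 p] is the same thing as a square-summable
    sequence [a]: it is the sum of the [a k * e_(2 k)^p], where [e_n^p] is the
    normalized monomial [z ^ (n - p)].  The transform [G p q] replaces each
    [e_(2 k)^p] by [e_(2 k)^q] and keeps the coefficients ([G_expands]), so it
    preserves norms and inner products, and [G q p] undoes it; [Ginv p q] is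
    [G q p] because [c_coef] is symmetric ([Ginv_G]).

    Why [G p q] acts like that.  The duplication formula for Pochhammer symbols
    turns the hypergeometric kernel into [F xi = sum_n d_(2 n) xi ^ n] with
    [d_n = (alpha + beta0 + 2)_n / (beta0 + 1)_n] ([F_termE]), and
    [c_(p, q) * d_n = gamma_n^p * gamma_n^q] ([c_coef_dcoef]).  Hence the whole
    kernel of [G p q] is the sum over [n] of [e_(2 n)^q z] times the conjugate
    of [e_(2 n)^p w], and integrating [f] against it term by term gives
    [sum_n <f, e_(2 n)^p> e_(2 n)^q z].  Term by term integration is legitimate
    because, for fixed [z], the argument [(w^* z) ^ 2] stays in the disk of
    radius [|z| ^ 2 < 1], on which the partial sums of [F] converge uniformly,
    while [f w / w^* ^ p] is integrable as a product of two square-integrable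
    functions ([G_Ccvg]).

    Orthonormality.  Planar Lebesgue measure is invariant under rotations, a
    rotation being a product of three shears, hence so is [mu], and a function
    which a rotation multiplies by a constant other than 1 has integral 0; this
    gives orthogonality ([L2dot_e]).  Norms are integrals of radial functions:
    under [area] the variable [|z| ^ 2] has the law of Lebesgue measure on the
    half-line ([area_annulus]), so they are quotients of beta integrals, which
    the recurrence of the beta function identifies with Pochhammer quotients
    ([gamma_sqr]).

    From closures to series.  Let [f] be in the closed span of the [e_(2 k)^p]
    and [a] its coefficients.  Bessel's inequality makes [a] square-summable,
    so its series converges on the punctured disk to a holomorphic [g]
    ([e_sum_exists]); Fatou's lemma bounds the distance from [g] to the partial
    sums [S n] by the tail of the series of squares ([L2sqnorm_tail]).  By
    Pythagoras' theorem [S n] approximates [f] at least as well as any other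
    combination of the first [n] vectors, so [f = g] almost everywhere, and
    everywhere on the punctured disk, both functions being continuous and [mu]
    charging every nonempty open set ([E2_expands]).  The converse
    ([expands_E2]) rests on the same tail bound. *)

(** * Rotation invariance of planar Lebesgue measure *)

Section plane_lebesgue.
Context {R : realType}.
Local Notation leb := (@lebesgue_measure R).
Local Notation leb2 := (leb \x leb)%E.

Lemma lebesgue_measure_translation (a : R) (A : set (measurableTypeR R)) :
  measurable A -> leb [set x | A (x + a)] = leb A.
Proof.
move=> mA; pose phi := fun x : measurableTypeR R => (x + a) : measurableTypeR R.
have mphi : measurable_fun [set: measurableTypeR R] phi.
  exact: measurable_funD.
suff : leb A = pushforward leb phi A by move=> ->.
apply: lebesgue_measure_unique => //= _ [[x y]] _ <-.
rewrite /pushforward (_ : phi @^-1` _ = `]x - a, y - a]%classic); last first.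
  by apply/seteqP; split=> t; rewrite /phi /= !in_itv /=; lra.
by rewrite !lebesgue_measure_itv/= !lte_fin ltrD2r -!EFinB; congr (if _ then _%:E else _); lra.
Qed.

Definition shear1 (a : R) (u : plane R) : plane R := (u.1 + a * u.2, u.2).
Definition shear2 (a : R) (u : plane R) : plane R := (u.1, u.2 + a * u.1).

Lemma measurable_shear1 a : measurable_fun [set: plane R] (shear1 a).
Proof.
apply/measurable_fun_pairP; split => /=.
  by apply: measurable_funD => //; apply: measurable_funM.
exact: measurable_snd.
Qed.

Lemma measurable_shear2 a : measurable_fun [set: plane R] (shear2 a).
Proof.
apply/measurable_fun_pairP; split => /=; first exact: measurable_fst.
by apply: measurable_funD => //; apply: measurable_funM.
Qed.

(** The product measure integrates vertical sections; [shear1] acts by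
    translations on the horizontal ones. *)
Lemma lebesgue2_sectionsE (X : set (plane R)) : measurable X ->
  leb2 X = (leb \x^ leb)%E X.
Proof.
move=> mX; apply: product_measure_unique => // *; exact: product_measure2E.
Qed.

Lemma lebesgue2_shear1 a (X : set (plane R)) : measurable X ->
  leb2 (shear1 a @^-1` X) = leb2 X.
Proof.
move=> mX; rewrite !lebesgue2_sectionsE //; last first.
  by rewrite -[X in measurable X]setTI; exact: measurable_shear1.
apply: eq_integral => y _ /=.
rewrite -(lebesgue_measure_translation (a * y) (ysection X y)); last first.
  exact: measurable_ysection.
by congr (leb _); apply/seteqP; split => x; rewrite /ysection /= !inE.
Qed.

Lemma lebesgue2_shear2 a (X : set (plane R)) : measurable X ->
  leb2 (shear2 a @^-1` X) = leb2 X.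
Proof.
move=> mX; apply: eq_integral => x _ /=.
rewrite -(lebesgue_measure_translation (a * x) (xsection X x)); last first.
  exact: measurable_xsection.
by congr (leb _); apply/seteqP; split => y; rewrite /xsection /= !inE.
Qed.

Definition rotation (c s : R) (u : plane R) : plane R :=
  (c * u.1 - s * u.2, s * u.1 + c * u.2).

Lemma measurable_rotation c s : measurable_fun [set: plane R] (rotation c s).
Proof.
by apply/measurable_fun_pairP; split => /=;
  [apply: measurable_funB|apply: measurable_funD]; apply: measurable_funM.
Qed.

(** A rotation of angle [theta] is the product of three shears, of coefficients
    [t], [sin theta] and [t], where [t = - tan (theta / 2)] is rationally
    [(cos theta - 1) / sin theta]. *)
Lemma lebesgue2_rotation c s (X : set (plane R)) : c ^+ 2 + s ^+ 2 = 1 ->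
  s != 0 -> measurable X -> leb2 (rotation c s @^-1` X) = leb2 X.
Proof.
move=> cs1 s0 mX; set t := (c - 1) / s.
have mX1 : measurable (shear1 t @^-1` X).
  by rewrite -[X in measurable X]setTI; exact: measurable_shear1.
have mX2 : measurable (shear2 s @^-1` (shear1 t @^-1` X)).
  by rewrite -[X in measurable X]setTI; exact: measurable_shear2.
rewrite -(lebesgue2_shear1 t X mX) -(lebesgue2_shear2 s _ mX1).
rewrite -(lebesgue2_shear1 t _ mX2).
suff -> : rotation c s = shear1 t \o (shear2 s \o shear1 t) by [].
apply/funext => -[x y]; rewrite /rotation /shear1 /shear2 /=.
have ts : t * s = c - 1 by rewrite /t divfK.
congr (_, _); last first.
  by transitivity (s * x + (1 + t * s) * y); [rewrite ts; ring|ring].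
have tc : t * (1 + c) = - s.
  by apply: (mulfI s0); rewrite mulrA [s * t]mulrC ts; move: cs1; rewrite !expr2; lra.
transitivity ((1 + t * s) * x + (t * (1 + (1 + t * s))) * y); last by ring.
by rewrite ts [1 + (c - 1)]addrC subrK tc; ring.
Qed.

Lemma area_rotation c s (X : set (plane R)) : c ^+ 2 + s ^+ 2 = 1 ->
  s != 0 -> measurable X -> area R (rotation c s @^-1` X) = area R X.
Proof.
move=> cs1 s0 mX; rewrite /area /= /mscale /=.
by congr (_ * _)%E; exact: lebesgue2_rotation.
Qed.

End plane_lebesgue.

(** * The area of a disk *)

Section radial.
Context {R : realType}.
Local Notation leb := (@lebesgue_measure R).
Local Notation leb2 := (leb \x leb)%E.

Definition sqmod (u : plane R) : R := u.1 ^+ 2 + u.2 ^+ 2.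

Lemma measurable_sqmod : measurable_fun [set: plane R] sqmod.
Proof. by apply: measurable_funD; apply: measurable_funX. Qed.

Lemma modulus_cplx (u : plane R) : modulus (cplx u) = Num.sqrt (sqmod u).
Proof. by []. Qed.

Lemma modulus_sqr (u : plane R) : modulus (cplx u) ^+ 2 = sqmod u.
Proof. by rewrite modulus_cplx sqr_sqrtr // addr_ge0 // sqr_ge0. Qed.

(** The substitution [x = r sin t] turns the integrand into [2 r^2 cos^2 t],
    a primitive of which is [r^2 (t + sin t cos t)]. *)
Lemma integral_half_disk (r : R) : 0 <= r ->
  (\int[leb]_(x in `[(- r)%R, r]) (2 * Num.sqrt (r ^+ 2 - x ^+ 2))%R%:E =
   (pi * r ^+ 2)%R%:E)%E.
Proof.
rewrite le_eqVlt => /predU1P[<-|r0].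
  by rewrite oppr0 set_itv1 integral_set1 expr0n mulr0.
pose F x : R := r * sin x.
have dF (x : R) : is_derive x 1 F (r * cos x).
  by rewrite /F; apply: is_derive_eq; rewrite /GRing.scale /=; ring.
have F'E : (F^`())%classic = (fun x => r * cos x).
  by apply/funext => x; rewrite derive1E; exact: derive_val.
have cF' : continuous (F^`())%classic.
  move=> x; rewrite F'E; apply: cvgM; first exact: cvg_cst.
  exact: continuous_cos.
have cF : continuous F.
  move=> x; apply: cvgM; first exact: cvg_cst.
  exact: continuous_sin.
pose a : R := - (pi / 2); pose b : R := pi / 2.
have Fa : F a = - r by rewrite /F /a sinN sin_pihalf mulrN1.
have Fb : F b = r by rewrite /F /b sin_pihalf mulr1.
have pi0 := pi_gt0 R.
rewrite -{1}Fa -{1}Fb integration_by_substitution_increasing //; last first.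
- apply: continuous_subspaceT => x.
  apply: cvgM; first exact: cvg_cst.
  apply: continuous_comp; last exact: sqrt_continuous.
  by apply: cvgB; [exact: cvg_cst|exact: exprn_continuous].
- split; [by move=> x _; apply: ex_derive|..].
  + exact/cvg_at_right_filter/cF.
  + exact/cvg_at_left_filter/cF.
- by apply/cvg_ex; exists ((F^`())%classic b); exact/cvg_at_left_filter/cF'.
- by apply/cvg_ex; exists ((F^`())%classic a); exact/cvg_at_right_filter/cF'.
- move=> x y; rewrite !in_itv /= => xab yab xy; rewrite /F ltr_pM2l //.
  by rewrite ltr_sin // in_itv.
- by rewrite /a /b; lra.
pose H x : R := r ^+ 2 * (x + sin x * cos x).
have dH (x : R) : is_derive x 1 H (r ^+ 2 * (2 * cos x ^+ 2)).
  rewrite /H; apply: is_derive_eq; rewrite /GRing.scale /=.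
  have := cos2Dsin2 x; set c := cos x; set d := sin x => cd.
  have dd : d * d = 1 - c * c by move: cd; rewrite !expr2; lra.
  by rewrite mulrN dd; ring.
have HE : {in `]a, b[, (H^`())%classic =1 (fun x => r ^+ 2 * (2 * cos x ^+ 2))}.
  by move=> x _; rewrite derive1E; exact: derive_val.
transitivity (\int[leb]_(x in `[a, b]) (r ^+ 2 * (2 * cos x ^+ 2))%R%:E)%E.
  apply: eq_integral => x; rewrite inE /= in_itv /= => xab; congr (_%:E).
  transitivity (2 * Num.sqrt (r ^+ 2 - (r * sin x) ^+ 2) * (r * cos x)).
    by rewrite F'E.
  have -> : r ^+ 2 - (r * sin x) ^+ 2 = (r * cos x) ^+ 2.
    have sx : sin x ^+ 2 = 1 - cos x ^+ 2 by have := cos2Dsin2 x; lra.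
    by rewrite !exprMn sx; ring.
  rewrite sqrtr_sqr ger0_norm; first by ring.
  by apply: mulr_ge0; [exact: ltW|exact: cos_ge0_pihalf].
rewrite (@continuous_FTC2 _ _ H) //.
- rewrite -EFinB /H /a /b sinN cosN cos_pihalf; congr (_%:E); lra.
- by rewrite /a /b; lra.
- apply: continuous_subspaceT => x; apply: cvgM; first exact: cvg_cst.
  apply: cvgM; first exact: cvg_cst.
  apply: (continuous_comp (f := @cos R) (g := fun y => y ^+ 2)).
    exact: continuous_cos.
  exact: exprn_continuous.
- have cH x : {for x, continuous H}.
    by apply/differentiable_continuous/derivable1_diffP; apply: ex_derive.
  split; [by move=> x _; apply: ex_derive|..].
  + exact/cvg_at_right_filter/cH.
  + exact/cvg_at_left_filter/cH.
Qed.

(** The vertical section at [x] is the segment of half-length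
    [sqrt (t - x ^ 2)]. *)
Lemma lebesgue2_disk (t : R) : 0 <= t ->
  leb2 [set u | sqmod u <= t] = (pi * t)%:E.
Proof.
move=> t0.
have mD : measurable [set u | sqmod u <= t].
  have -> : [set u | sqmod u <= t] = sqmod @^-1` `]-oo, t]%classic.
    by apply/seteqP; split=> u /=; rewrite in_itv.
  by rewrite -[X in measurable X]setTI; exact: measurable_sqmod.
pose r : R := Num.sqrt t; have r0 : 0 <= r by exact: sqrtr_ge0.
have rt : r ^+ 2 = t by rewrite sqr_sqrtr.
rewrite -{2}rt -integral_half_disk // [RHS]integral_mkcond.
apply: eq_integral => x _ /=; rewrite patchE.
case: ifPn => [xr|].
  have xr2 : 0 <= r ^+ 2 - x ^+ 2.
    by move: xr; rewrite inE /= in_itv /= => /andP[? ?]; nra.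
  pose s : R := Num.sqrt (r ^+ 2 - x ^+ 2); rewrite -/s; have s0 : 0 <= s by exact: sqrtr_ge0.
  have ss : s ^+ 2 = r ^+ 2 - x ^+ 2 by rewrite sqr_sqrtr.
  rewrite (_ : xsection _ _ = `[- s, s]%classic); last first.
    apply/seteqP; split => y; rewrite /xsection /= inE /sqmod /= in_itv /=.
      move=> xyt; rewrite -ler_norml -(@ler_pXn2r _ 2) ?nnegrE //.
      by rewrite real_normK ?num_real // ss; lra.
    rewrite -ler_norml -(@ler_pXn2r _ 2) ?nnegrE //.
    by rewrite real_normK ?num_real // ss; lra.
  rewrite lebesgue_measure_itv /= lte_fin -EFinB opprK.
  case: ltP => [_|]; first by congr (_%:E); ring.
  move=> sNs; have s_le0 : s <= 0 by rewrite (le_trans sNs) // oppr_le0.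
  by rewrite (le_anti (introT andP (conj s_le0 s0))) mulr0.
rewrite notin_setE /= in_itv /= => /negP.
rewrite -ler_norml -(@ler_pXn2r _ 2) ?nnegrE // real_normK ?num_real // -ltNge => xr.
rewrite (_ : xsection _ _ = set0) ?measure0 //.
apply/seteqP; split => y //; rewrite /xsection /= inE /sqmod /=.
by have := sqr_ge0 y; lra.
Qed.

End radial.

(** * Integrals of radial functions *)

Section radial_integral.
Context {R : realType}.
Local Notation leb := (@lebesgue_measure R).

Lemma area_disk (t : R) : area R [set u | sqmod u <= t] = (Num.max t 0)%:E.
Proof.
have [t0|t0] := ltP t 0.
  rewrite (_ : [set u | _] = set0) ?measure0 //.
  by apply/seteqP; split => // u /=; rewrite /sqmod => ut;
    have := addr_ge0 (sqr_ge0 u.1) (sqr_ge0 u.2); lra.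
rewrite /area /= /mscale /=; have := lebesgue2_disk t t0 => /= ->.
by rewrite -EFinM mulrA mulVf ?mul1r // gt_eqF // pi_gt0.
Qed.

(** Both sides are measures in [A], and they agree on the intervals [`]a, b]],
    because the disk of squared radius [t] has area [t]. *)
Lemma area_annulus (A : set (measurableTypeR R)) : measurable A ->
  area R (sqmod @^-1` A) = leb (A `&` `[0, +oo[%classic).
Proof.
move=> mA.
have m0y : measurable (`[0, +oo[%classic : set (measurableTypeR R)) by [].
pose m1 := pushforward (area R) (sqmod : plane R -> measurableTypeR R).
have m1_le (t : R) : m1 `]-oo, t]%classic = (Num.max t 0)%:E.
  rewrite /m1 /pushforward -area_disk.
  rewrite (_ : _ @^-1` _ = [set u | sqmod u <= t]) //.
pose phi : plane R -> measurableTypeR R := sqmod.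
suff : pushforward (area R) phi A = mrestr leb m0y A by [].
have mphi : measurable_fun setT phi by exact: measurable_sqmod.
apply: (@measure_unique _ R (measurableTypeR R) (@ocitv R)
  (fun k : nat => `](- k%:R)%R, k%:R]%classic)) => //.
- exact: ocitvI.
- by move=> k; exact: is_ocitv.
- apply/seteqP; split => // x _; exists (Num.truncn `|x|).+1 => //=.
  rewrite in_itv /=; have := truncnS_gt `|x|.
  by rewrite ltr_norml => /andP[-> /ltW ->].
- move=> _ /ocitvP[->|[[a b] /= ab ->]]; first by rewrite !measure0.
  change (m1 `]a, b]%classic = leb (`]a, b]%classic `&` `[0, +oo[%classic)).
  have -> : m1 `]a, b]%classic = (Num.max b 0 - Num.max a 0)%:E.
    have : m1 `]-oo, b]%classic = (m1 `]-oo, a]%classic + m1 `]a, b]%classic)%E.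
      have U : `]-oo, b]%classic = `]-oo, a]%classic `|` `]a, b]%classic :> set R.
        apply/seteqP; split => x /=; rewrite !in_itv /=.
          by move=> xb; case: (leP x a) => xa; [left|right].
        by case=> [xa|/andP[_ ->]//]; rewrite (le_trans xa)// ltW.
      rewrite U; apply: (@measureU _ _ _ (pushforward (area R) phi)) => //.
      apply/seteqP; split => // x /=; rewrite !in_itv /= => -[xa].
      by rewrite ltNge xa.
    rewrite !m1_le EFinB => ->.
    by rewrite [X in (X - _)%E]addeC addeK.
  have -> : `]a, b]%classic `&` `[0, +oo[%classic =
      [set` Interval (if a < 0 then BLeft 0 else BRight a) (BRight b)] :> set R.
    apply/seteqP; split => x /=; case: ltP => a0; rewrite !in_itv /= ?andbT;
      lra.
  case: (ltP a 0) => a0; rewrite lebesgue_measure_itv /= lte_fin -EFinB.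
    by rewrite subr0; case: ltP => b0; rewrite ?subr0.
  by rewrite ab max_l // (le_trans a0) // ltW.
- move=> k; change (m1 `](- k%:R)%R, k%:R%R]%classic < +oo)%E.
  apply: (@le_lt_trans _ _ (m1 `]-oo, k%:R]%classic)); last by rewrite m1_le ltry.
  apply: (@le_measure _ _ _ (pushforward (area R) phi)); rewrite ?inE //.
  by move=> x /=; rewrite !in_itv /= => /andP[].
Qed.

Lemma disk2_sqmod : disk2 R = sqmod @^-1` `[0, 1[%classic.
Proof.
have E u : (modulus (cplx u) < 1) = (sqmod u \in `[0, 1[).
  rewrite modulus_cplx -[X in _ < X]sqrtr1 ltr_sqrt // in_itv /=.
  by rewrite addr_ge0 // sqr_ge0.
by apply/seteqP; split => u; rewrite /disk2 /preimage /mkset E.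
Qed.

(** Polar coordinates, with the squared radius as variable: the Jacobian is
    then constant, and the normalization of [area] makes it 1. *)
Lemma radial_integral (phi : R -> \bar R) :
  measurable_fun [set: measurableTypeR R] phi -> (forall t, 0 <= phi t)%E ->
  (\int[area R]_(u in disk2 R) phi (sqmod u) =
   \int[leb]_(t in `[0%R, 1%R[) phi t)%E.
Proof.
move=> mphi phi0; pose psi : plane R -> measurableTypeR R := sqmod.
have mpsi : measurable_fun setT psi by exact: measurable_sqmod.
have m01 : measurable (`[0, 1[%classic : set (measurableTypeR R)) by [].
rewrite disk2_sqmod -(ge0_integral_pushforward mpsi (area R) m01) //; last first.
  exact: measurable_funS mphi.
apply: eq_measure_integral => // A mA A01.
rewrite /= /pushforward /= area_annulus // setIidl //.
by move=> x /A01 /=; rewrite !in_itv /= => /andP[-> _].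
Qed.

End radial_integral.

(** * An improper fundamental theorem of calculus *)

Section improper_FTC.
Context {R : realType}.
Local Notation leb := (@lebesgue_measure R).

(** The derivative is given as a difference of two nonnegative functions, whose
    integrals make sense in [[0, +oo]] before either is known to be finite; this
    is what allows finiteness of one to be deduced from that of the other. *)
Lemma FTC_oo01 (F P N : R -> R) (l0 l1 : R) :
  {in `]0, 1[, continuous P} -> {in `]0, 1[, continuous N} ->
  (forall x : R, x \in `]0, 1[ -> is_derive x 1 F (P x - N x)) ->
  (forall x : R, x \in `]0, 1[ -> 0 <= P x) ->
  (forall x : R, x \in `]0, 1[ -> 0 <= N x) ->
  F x @[x --> 0^'+] --> l0 -> F x @[x --> 1^'-] --> l1 ->
  (\int[leb]_(x in `]0%R, 1%R[) (P x)%:E + l0%:E =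
   \int[leb]_(x in `]0%R, 1%R[) (N x)%:E + l1%:E)%E.
Proof.
move=> cP cN dF P0 N0 F0 F1.
(* with n + 3 in the denominator, e n < 1 / 2 and [e n, 1 - e n] is nonempty *)
pose e (n : nat) : R := n.+3%:R^-1.
have e0 n : 0 < e n by rewrite invr_gt0.
have e_half n : e n < 1 - e n.
  suff : e n < 2^-1 by lra.
  by rewrite /e ltf_pV2 ?posrE // ltr_nat.
have ecvg : e n @[n --> \oo] --> (0 : R).
  have -> : e = (fun n => harmonic (n + 2)%N).
    by apply/funext => n; rewrite /e /harmonic /= addn2.
  by rewrite (cvg_shiftn 2); exact: cvg_harmonic.
pose I n := `[e n, 1 - e n]%classic.
have I01 n (x : R) : I n x -> x \in `]0, 1[.
  rewrite /I /= !in_itv /= => /andP[h1 h2]; rewrite (lt_le_trans (e0 n)) //=.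
  by rewrite (le_lt_trans h2) // ltrBlDr ltrDl.
have mI n : measurable (I n : set (measurableTypeR R)) by exact: measurable_itv.
have ndI : nondecreasing_seq I.
  apply/nondecreasing_seqP => n; apply/subsetPset => x.
  rewrite /I /= !in_itv /= => /andP[h1 h2].
  have en : e n.+1 <= e n by rewrite /e lef_pV2 ?posrE // ler_nat.
  by rewrite (le_trans en h1) (le_trans h2) // lerB.
have UI : \bigcup_n I n = `]0, 1[%classic.
  apply/seteqP; split => [x [n _]|x]; first exact: I01.
  rewrite /= in_itv /= => /andP[x0 x1].
  pose d := Num.min x (1 - x).
  have d0 : 0 < d by rewrite lt_min x0 /= subr_gt0.
  move/cvgrPdist_lt : (ecvg) => /(_ d d0) [n _ H].
  exists n => //; rewrite /I /= in_itv /=.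
  have := H n (leqnn n); rewrite /= sub0r normrN gtr0_norm ?e0 // lt_min.
  by move=> /andP[? ?]; apply/andP; split; lra.
have step n : (\int[leb]_(x in I n) (P x)%:E + (F (e n))%:E =
    \int[leb]_(x in I n) (N x)%:E + (F (1 - e n))%:E)%E.
  have cI (f : R -> R) : {in `]0, 1[, continuous f} -> {within I n, continuous f}.
    move=> cf; apply: continuous_in_subspaceT => x; rewrite inE => /I01.
    exact: cf.
  have iI (f : R -> R) : {in `]0, 1[, continuous f} ->
      leb.-integrable (I n) (EFin \o f).
    by move=> cf; apply: continuous_compact_integrable; [exact: segment_compact|exact: cI].
  have dFI x : x \in `]0, 1[ -> derivable F x 1 by move=> /dF[].
  have cFI : {in `]0, 1[, continuous F}.
    by move=> x /dFI ?; apply/differentiable_continuous/derivable1_diffP.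
  have : (\int[leb]_(x in I n) (P x - N x)%R%:E =
      (F (1 - e n))%:E - (F (e n))%:E)%E.
  apply: continuous_FTC2 => //.
  - by apply: cI => x x01; apply: cvgB; [exact: cP|exact: cN].
  - split.
    + move=> x xI; apply: dFI; apply: (I01 n).
      by move: xI; rewrite /I /= !in_itv /= => /andP[/ltW -> /ltW ->].
    + apply: cvg_at_right_filter; apply: cFI; apply: (I01 n).
      by rewrite /I /= in_itv /= lexx ltW.
    + apply: cvg_at_left_filter; apply: cFI; apply: (I01 n).
      by rewrite /I /= in_itv /= lexx ltW.
  - move=> x xI; rewrite derive1E; have [|_ ->//] := dF x; apply: (I01 n).
    by move: xI; rewrite /I /= !in_itv /= => /andP[/ltW -> /ltW ->].
  under eq_integral do rewrite EFinB.
  rewrite (@integralB _ _ _ leb (I n)) //; [|exact: iI|exact: iI].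
  have fP : (\int[leb]_(x in I n) (P x)%:E)%E \is a fin_num.
    by apply: integrable_fin_num => //; exact: iI.
  have fN : (\int[leb]_(x in I n) (N x)%:E)%E \is a fin_num.
    by apply: integrable_fin_num => //; exact: iI.
  rewrite -(fineK fP) -(fineK fN) -!EFinB => -[H].
  by rewrite -!EFinD; congr (_%:E); lra.
have cvgI (f : R -> R) : {in `]0, 1[, continuous f} ->
    (forall x : R, x \in `]0, 1[ -> 0 <= f x) ->
    (\int[leb]_(x in I n) (f x)%:E)%E @[n --> \oo] -->
    (\int[leb]_(x in `]0%R, 1%R[) (f x)%:E)%E.
  move=> cf f0; rewrite -UI.
  apply: ge0_nondecreasing_set_cvg_integral => //.
  - move=> n; apply/measurable_EFinP.
    have mf : measurable_fun (`]0, 1[%classic : set R) f.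
      by apply: open_continuous_measurable_fun => // x; rewrite inE; exact: cf.
    by apply: measurable_funS mf => // x; exact: I01.
  - by move=> n x Ix; rewrite lee_fin f0 // (I01 n).
have Fe0 : F (e n) @[n --> \oo] --> l0.
  by move/cvg_at_rightP : F0; apply; split.
have Fe1 : F (1 - e n) @[n --> \oo] --> l1.
  move/cvg_at_leftP : F1; apply; split.
    by move=> n; have := e0 n; lra.
  by rewrite -[X in _ --> X]subr0; apply: cvgB => //; exact: cvg_cst.
have H1 : (\int[leb]_(x in I n) (P x)%:E + (F (e n))%:E)%E @[n --> \oo] -->
    (\int[leb]_(x in `]0%R, 1%R[) (P x)%:E + l0%:E)%E.
  apply: cvgeD; [exact: fin_num_adde_defl|exact: cvgI|].
  exact: cvg_comp Fe0 _.
have H2 : (\int[leb]_(x in I n) (N x)%:E + (F (1 - e n))%:E)%E @[n --> \oo] -->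
    (\int[leb]_(x in `]0%R, 1%R[) (N x)%:E + l1%:E)%E.
  apply: cvgeD; [exact: fin_num_adde_defl|exact: cvgI|].
  exact: cvg_comp Fe1 _.
rewrite -(cvg_lim _ H1) // -(cvg_lim _ H2) //.
by congr (limn _); apply/funext => n; exact: step.
Qed.

End improper_FTC.

(** * Beta integrals *)

Section beta_integrals.
Context {R : realType}.
Local Notation leb := (@lebesgue_measure R).

Definition beta_kernel (c d t : R) : R := t `^ c * (1 - t) `^ d.

Definition beta_integral (c d : R) : \bar R :=
  (\int[leb]_(t in `]0%R, 1%R[) (beta_kernel c d t)%:E)%E.
Local Notation J := beta_integral.

Lemma beta_kernel_ge0 c d t : 0 <= beta_kernel c d t.
Proof. by rewrite mulr_ge0 // powR_ge0. Qed.

Lemma measurable_beta_kernel c d :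
  measurable_fun [set: R] (beta_kernel c d).
Proof.
apply: measurable_funM; first exact: measurable_powR.
apply: (measurableT_comp (measurable_powR _)) => //.
exact: measurable_funB.
Qed.

Lemma is_derive_beta_kernel c d (t : R) : t \in `]0, 1[ ->
  is_derive t 1 (beta_kernel (c + 1) (d + 1))
    ((c + 1) * beta_kernel c (d + 1) t - (d + 1) * beta_kernel (c + 1) d t).
Proof.
rewrite in_itv /= => /andP[t0 t1].
have t1' : 0 < 1 - t by lra.
have d1 : is_derive t 1 (fun u : R => u `^ (c + 1)) ((c + 1) * t `^ c).
  by have := is_derive1_powR (c + 1) t0; rewrite addrK.
have dB : is_derive t 1 (fun u : R => 1 - u) (- 1).
  by apply: is_derive_eq; rewrite add0r mul1r.
have d2 : is_derive t 1 (fun u : R => (1 - u) `^ (d + 1)) (- ((d + 1) * (1 - t) `^ d)).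
  have := is_derive1_powR (d + 1) t1'; rewrite addrK => dp.
  have := @is_derive1_comp R (fun v : R => v `^ (d + 1)) (fun u : R => 1 - u) t _ _ dp dB.
  by rewrite mulrN1.
apply: is_derive_eq; rewrite /beta_kernel /GRing.scale /=; ring.
Qed.

Lemma continuous_beta_kernel c d : {in `]0, 1[, continuous (beta_kernel c d)}.
Proof.
move=> t t01; apply/differentiable_continuous/derivable1_diffP.
by have := is_derive_beta_kernel (c - 1) (d - 1) t t01; rewrite !subrK => -[].
Qed.

Lemma beta_integral_ge0 c d : (0 <= J c d)%E.
Proof. by apply: integral_ge0 => t _; rewrite lee_fin beta_kernel_ge0. Qed.

Lemma beta_integralZ k c d : 0 <= k ->
  (\int[leb]_(t in `]0%R, 1%R[) (k * beta_kernel c d t)%R%:E = k%:E * J c d)%E.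
Proof.
move=> k0; under eq_integral do rewrite EFinM.
rewrite ge0_integralZl_EFin //.
  by move=> t _; rewrite lee_fin beta_kernel_ge0.
apply/measurable_EFinP; apply: measurable_funS (measurable_beta_kernel c d) => //.
Qed.

Lemma beta_kernel_cvg0 c d : -1 < c -> 
  beta_kernel (c + 1) d t @[t --> 0^'+] --> 0.
Proof.
move=> c1; rewrite -[X in _ --> X](mul0r ((1 - 0) `^ d)) /beta_kernel; apply: cvgM.
  by apply: powR_cvg0; lra.
apply: cvg_at_right_filter.
have : {for (1 - 0 : R), continuous (fun v : R => v `^ d)}.
  apply/differentiable_continuous/derivable1_diffP.
  have h : 0 < 1 - 0 :> R by rewrite subr0.
  by have [] := is_derive1_powR d h.
move=> cp; apply: (continuous_comp (f := fun t : R => 1 - t)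
  (g := fun v : R => v `^ d)) => //.
by apply: cvgB; [exact: cvg_cst|exact: cvg_id].
Qed.

Lemma beta_kernelC c d t : beta_kernel c d (1 - t) = beta_kernel d c t.
Proof. by rewrite /beta_kernel mulrC; congr (_ * _); rewrite subKr. Qed.

Lemma beta_kernel_cvg1 c d : -1 < d ->
  beta_kernel c (d + 1) t @[t --> 1^'-] --> 0.
Proof.
move=> d1; apply/cvg_at_leftP => u [u1 uc].
have /cvg_at_rightP H := beta_kernel_cvg0 d c d1.
suff /H : (forall n, 0 < 1 - u n) /\ 1 - u n @[n --> \oo] --> 0.
  by under eq_fun do rewrite beta_kernelC.
split; first by move=> n; rewrite subr_gt0.
by rewrite -[X in _ --> X](subrr 1); apply: cvgB => //; exact: cvg_cst.
Qed.

(** Integration by parts: [t ^ (c + 1) * (1 - t) ^ (d + 1)] vanishes at both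
    ends. *)
Lemma beta_integral_rec c d : -1 < c -> -1 < d ->
  ((c + 1)%:E * J c (d + 1) = (d + 1)%:E * J (c + 1) d)%E.
Proof.
move=> c1 d1; rewrite -!beta_integralZ; [|lra|lra].
rewrite -[LHS]adde0 -[RHS]adde0.
apply: (@FTC_oo01 R (beta_kernel (c + 1) (d + 1))).
- by move=> t t01; apply: cvgM; [exact: cvg_cst|exact: continuous_beta_kernel].
- by move=> t t01; apply: cvgM; [exact: cvg_cst|exact: continuous_beta_kernel].
- by move=> t t01; exact: is_derive_beta_kernel.
- by move=> t _; rewrite mulr_ge0 ?beta_kernel_ge0 //; lra.
- by move=> t _; rewrite mulr_ge0 ?beta_kernel_ge0 //; lra.
- exact: beta_kernel_cvg0.
- exact: beta_kernel_cvg1.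
Qed.

(** [1 = t + (1 - t)] *)
Lemma beta_integral_split c d : (J c d = J (c + 1) d + J c (d + 1))%E.
Proof.
rewrite /J -ge0_integralD //; last 4 first.
- by move=> t _; rewrite lee_fin beta_kernel_ge0.
- by apply/measurable_EFinP; apply: measurable_funS (measurable_beta_kernel _ _).
- by move=> t _; rewrite lee_fin beta_kernel_ge0.
- by apply/measurable_EFinP; apply: measurable_funS (measurable_beta_kernel _ _).
apply: eq_integral => t; rewrite inE /= in_itv /= => /andP[t0 t1].
have t1' : 0 < 1 - t by lra.
have powS (x e : R) : 0 < x -> x `^ (e + 1) = x `^ e * x.
  move=> x0; rewrite powRD; first by rewrite powRr1 // ltW.
  by rewrite (gt_eqF x0) implybT.
by rewrite -EFinD /beta_kernel !powS //; congr (_%:E); ring.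
Qed.

Lemma beta_integral_c0 c : -1 < c -> J c 0 = ((c + 1)^-1)%:E.
Proof.
move=> c1; have c1' : 0 < c + 1 by lra.
have : ((c + 1)%:E * J c 0 = 1)%E.
  rewrite -beta_integralZ ?ltW // -[LHS]adde0.
  transitivity (\int[leb]_(t in `]0%R, 1%R[) (0%R)%:E + 1%:E)%E; last first.
    by rewrite integral0 add0e.
  apply: (@FTC_oo01 R (fun t => t `^ (c + 1))).
  - by move=> t t01; apply: cvgM; [exact: cvg_cst|exact: continuous_beta_kernel].
  - by move=> t _; exact: cvg_cst.
  - move=> t; rewrite in_itv /= => /andP[t0 t1].
    have := is_derive1_powR (c + 1) t0.
    by rewrite addrK /beta_kernel powRr0 mulr1 subr0.
  - by move=> t _; rewrite mulr_ge0 ?beta_kernel_ge0 // ltW.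
  - by [].
  - exact: powR_cvg0.
  - apply: cvg_at_left_filter.
    have : {for (1 : R), continuous (fun v : R => v `^ (c + 1))}.
      apply/differentiable_continuous/derivable1_diffP.
      by have [] := is_derive1_powR (c + 1) (@ltr01 R).
    have one : (1 : R) `^ (c + 1) = 1 by rewrite powR1.
    by move=> h; rewrite -[X in _ --> X]one; exact: h.
move=> H; have : ((c + 1)^-1%:E * ((c + 1)%:E * J c 0) = (c + 1)^-1%:E)%E.
  by rewrite H mule1.
by rewrite muleA -EFinM mulVf ?gt_eqF // mul1e.
Qed.

(** The integrand may be unbounded at both ends.  Splitting raises one of the
    exponents; [J c (d + 1)] is at most [J c 0], which is computed by a primitive,
    and the recurrence carries finiteness over to [J (c + 1) d]. *)
Lemma beta_integral_lty c d : -1 < c -> -1 < d -> (J c d < +oo)%E.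
Proof.
move=> c1 d1.
have fin_c_pos b : -1 < b -> (J c (b + 1) < +oo)%E.
  move=> b1; apply: (@le_lt_trans _ _ (J c 0)); last first.
    by rewrite beta_integral_c0 // ltry.
  apply: ge0_le_integral => //.
  - by move=> t _; rewrite lee_fin beta_kernel_ge0.
  - by apply/measurable_EFinP; apply: measurable_funS (measurable_beta_kernel _ _).
  - by apply/measurable_EFinP; apply: measurable_funS (measurable_beta_kernel _ _).
  - move=> t; rewrite /= in_itv /= => /andP[t0 t1].
    rewrite lee_fin /beta_kernel ler_wpM2l ?powR_ge0 // powRr0.
    have one : (1 : R) `^ (b + 1) = 1 by rewrite powR1.
    rewrite -[X in _ <= X]one ge0_ler_powR ?nnegrE //; lra.
rewrite beta_integral_split; apply: lte_add_pinfty; last exact: fin_c_pos.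
have : ((d + 1)%:E * J (c + 1) d < +oo)%E.
  by rewrite -beta_integral_rec // lte_mul_pinfty ?fin_c_pos // lee_fin; lra.
move: (beta_integral_ge0 (c + 1) d); case: (J (c + 1) d) => [r _ _|_|]; rewrite ?ltry //.
by rewrite gt0_muley // lte_fin; lra.
Qed.

Lemma beta_integralC c d : J c d = J d c.
Proof.
pose phi : measurableTypeR R -> measurableTypeR R := fun t => 1 - t.
have mphi : measurable_fun setT phi by exact: measurable_funB.
have mI : measurable (`]0, 1[%classic : set (measurableTypeR R)) by [].
have phiI : phi @^-1` `]0, 1[%classic = `]0, 1[%classic.
  by apply/seteqP; split => t; rewrite /phi /= !in_itv /=; lra.
transitivity (\int[pushforward leb phi]_(t in `]0%R, 1%R[)
   (beta_kernel c d t)%:E)%E.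
  apply: eq_measure_integral => X mX _.
  apply: lebesgue_measure_unique => //= _ [[a b]] _ <-.
  rewrite /pushforward (_ : phi @^-1` _ = `[1 - b, 1 - a[%classic); last first.
    by apply/seteqP; split=> t; rewrite /phi /= !in_itv /=; lra.
  rewrite !lebesgue_measure_itv/= !lte_fin ltrD2l ltrN2 -!EFinB.
  by congr (if _ then _%:E else _); lra.
rewrite (ge0_integral_pushforward mphi leb mI); last 2 first.
- by apply/measurable_EFinP; apply: measurable_funS (measurable_beta_kernel _ _).
- by move=> t _ /=; rewrite lee_fin beta_kernel_ge0.
by rewrite phiI; apply: eq_integral => t _ /=; rewrite beta_kernelC.
Qed.

End beta_integrals.

(** * Integration against a density *)

Section density.
Local Open Scope ereal_scope.
Context d (T : measurableType d) (R : realType).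
Variables (m nu : {measure set T -> \bar R}) (D : set T) (g : T -> R).
Hypotheses (mD : measurable D) (mg : measurable_fun D g)
  (g0 : forall x, (0 <= g x)%R)
  (nuE : forall A, measurable A -> A `<=` D ->
     nu A = \int[m]_(x in A) (g x)%:E).

Import HBNNSimple.

Let mgE : measurable_fun D (EFin \o g).
Proof. exact/measurable_EFinP. Qed.

Let integral_density_nnsfun (h : {nnsfun T >-> R}) :
  \int[nu]_(x in D) (h x)%:E = \int[m]_(x in D) ((h x)%:E * (g x)%:E).
Proof.
have mind r : measurable_fun D (fun x => (r * \1_(h @^-1` [set r]) x)%:E).
  by apply/measurable_EFinP; apply: measurable_funTS; exact: measurable_funM.
transitivity (\int[nu]_(x in D)
    (\sum_(y \in range h) (y * \1_(h @^-1` [set y]) x)%:E)).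
  by apply: eq_integral => x _; rewrite fimfunE -fsumEFin.
rewrite ge0_integral_fsum //; last by move=> r x _; exact: nnfun_muleindic_ge0.
transitivity (\int[m]_(x in D)
    (\sum_(y \in range h) (y * \1_(h @^-1` [set y]) x)%:E * (g x)%:E)); last first.
  apply: eq_integral => x _.
  rewrite -ge0_mule_fsuml; last by move=> y; exact: nnfun_muleindic_ge0.
  by rewrite fsumEFin // -fimfunE.
rewrite ge0_integral_fsum //; last 2 first.
- by move=> y; apply: emeasurable_funM.
- move=> y x _; apply: mule_ge0; first exact: nnfun_muleindic_ge0.
  by rewrite lee_fin.
apply: eq_fsbigr => r; rewrite inE => -[t _ rE].
have r0 : (0 <= r)%R by rewrite -rE.
have mr : measurable (h @^-1` [set r]) by [].
under eq_integral do rewrite EFinM.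
rewrite integralZl_indic_nnsfun // integral_indic // nuE; last 2 first.
- exact: measurableI.
- by move=> x [].
under [RHS]eq_integral do rewrite EFinM -muleA.
rewrite ge0_integralZl_EFin //; last 2 first.
- by move=> x _; rewrite mule_ge0 ?lee_fin ?g0.
- apply: emeasurable_funM => //; apply/measurable_EFinP.
  exact: measurable_funTS.
rewrite setIC integral_mkcondr; congr (_ * _).
apply: eq_integral => x _; rewrite patchE indicE.
by case: (x \in _); rewrite ?mul1e ?mul0e.
Qed.

(** The hypothesis is the case of an indicator function; simple functions
    follow by linearity and the others by monotone convergence. *)
Lemma ge0_integral_density (f : T -> \bar R) :
  measurable_fun D f -> (forall x, D x -> 0 <= f x) ->
  \int[nu]_(x in D) f x = \int[m]_(x in D) (f x * (g x)%:E).
Proof.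
move=> mf f0; pose h := nnsfun_approx mD mf.
have hf x : D x -> (h n x)%:E @[n --> \oo] --> f x.
  by move=> Dx; exact: cvg_nnsfun_approx.
transitivity (limn (fun n => \int[nu]_(x in D) (h n x)%:E)).
  rewrite -monotone_convergence //.
  - by apply: eq_integral => x /[!inE] Dx; apply/esym/cvg_lim => //; exact: hf.
  - by move=> n; apply/measurable_EFinP; exact: measurable_funTS.
  - by move=> n x _; rewrite lee_fin.
  - by move=> x _ a b ab; rewrite lee_fin; exact/lefP/nd_nnsfun_approx.
under eq_fun do rewrite integral_density_nnsfun.
rewrite -monotone_convergence //.
- apply: eq_integral => x /[!inE] Dx; apply/cvg_lim => //.
  by apply: cvgeZr => //; exact: hf.
- move=> n; apply: emeasurable_funM => //; apply/measurable_EFinP.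
  exact: measurable_funTS.
- by move=> n x _; rewrite mule_ge0 ?lee_fin.
- move=> x _ a b ab; rewrite lee_wpmul2r ?lee_fin //.
  exact/lefP/nd_nnsfun_approx.
Qed.

End density.

Section mu_facts.
Context {R : realType}.
Local Notation leb := (@lebesgue_measure R).

Lemma mu_integral (alpha beta : R) (f : plane R -> \bar R) :
  measurable_fun (disk2 R) f -> (forall u, disk2 R u -> 0 <= f u)%E ->
  (\int[mu alpha beta]_(u in disk2 R) f u =
   \int[area R]_(u in disk2 R) (f u * (mu_density alpha beta u)%:E))%E.
Proof.
move=> mf f0; have mD := @measurable_disk2 R.
apply: ge0_integral_density => //.
- by apply: measurable_funTS; exact: measurable_mu_density.
- exact: mu_density_ge0.
- by move=> A mA AD; rewrite /= /mu setIidl.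
Qed.

Lemma betaBE (alpha beta : R) :
  betaB (alpha + 1) (beta + 1) = fine (beta_integral beta alpha).
Proof. by rewrite beta_integralC /betaB !addrK. Qed.

Lemma mu_densityE (alpha beta : R) (u : plane R) :
  mu_density alpha beta u =
  (fine (beta_integral beta alpha))^-1 * beta_kernel beta alpha (sqmod u).
Proof.
rewrite /mu_density -betaBE [RHS]mulrC; congr (_ / _).
rewrite /beta_kernel modulus_sqr; congr (_ * _).
rewrite powRrM; congr (_ `^ _).
by rewrite powR_mulrn ?modulus_sqr // sqrtr_ge0.
Qed.

(** Since [1 - |z| ^ 2] and [|z|] are functions of [|z| ^ 2], the density of
    [mu] becomes the kernel of a beta integral. *)
Lemma mu_radial (alpha beta : R) (phi : R -> R) :
  -1 < alpha -> -1 < beta ->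
  measurable_fun [set: R] phi -> (forall t, 0 <= phi t) ->
  (\int[mu alpha beta]_(u in disk2 R) (phi (sqmod u))%:E =
   ((fine (beta_integral beta alpha))^-1)%:E *
   \int[leb]_(t in `]0%R, 1%R[) (phi t * beta_kernel beta alpha t)%R%:E)%E.
Proof.
move=> a1 b1 mphi phi0.
rewrite mu_integral; last 2 first.
- apply/measurable_EFinP; apply: measurable_funTS.
  exact: (measurableT_comp mphi (@measurable_sqmod R)).
- by move=> u _; rewrite lee_fin.
set C := (fine _)^-1.
have C0 : 0 <= C by rewrite invr_ge0 fine_ge0 // beta_integral_ge0.
transitivity (\int[area R]_(u in disk2 R)
  ((fun t => (C * (phi t * beta_kernel beta alpha t))%R%:E) (sqmod u)))%E.
  apply: eq_integral => u _; rewrite -EFinM mu_densityE; congr (_%:E).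
  by rewrite -/C; ring.
have mk : measurable_fun [set: R] (fun t => phi t * beta_kernel beta alpha t).
  by apply: measurable_funM => //; exact: measurable_beta_kernel.
rewrite (radial_integral (fun t => (C * (phi t * beta_kernel beta alpha t))%:E));
  last 2 first.
- by apply/measurable_EFinP; apply: measurable_funM.
- by move=> t; rewrite lee_fin mulr_ge0 // mulr_ge0 // beta_kernel_ge0.
under eq_integral do rewrite EFinM.
rewrite ge0_integralZl_EFin //; last 2 first.
- by move=> t _; rewrite lee_fin mulr_ge0 // beta_kernel_ge0.
- by apply/measurable_EFinP; apply: measurable_funS mk.
congr (_ * _)%E; rewrite -integral_itv_obnd_cbnd //.
by apply/measurable_EFinP; apply: measurable_funS mk.
Qed.

End mu_facts.

(** * The modulus of a complex number *)

Section complex_modulus.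
Context {R : realType}.
Implicit Types z w : R[i].
Local Notation Re := complex.Re.
Local Notation Im := complex.Im.

Lemma modulusE2 z : modulus z ^+ 2 = Re z ^+ 2 + Im z ^+ 2.
Proof.
by case: z => a b; rewrite /modulus /= sqr_sqrtr // addr_ge0 // sqr_ge0.
Qed.

Lemma modulus_ge0 z : 0 <= modulus z.
Proof. by case: z => a b; rewrite sqrtr_ge0. Qed.

Lemma modulusM z w : modulus (z * w) = modulus z * modulus w.
Proof. exact: Normc.normcM. Qed.

Lemma modulus_eq0 z : (modulus z == 0) = (z == 0).
Proof.
apply/eqP/eqP => [/Normc.eq0_normc //|->]; exact: Normc.normc0.
Qed.

Lemma modulusV z : modulus z^-1 = (modulus z)^-1.
Proof. exact: Normc.normcV. Qed.

Lemma modulusD z w : modulus (z + w) <= modulus z + modulus w.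
Proof. exact: le_normcD. Qed.

Lemma modulusN z : modulus (- z) = modulus z.
Proof. exact: normcN. Qed.

Lemma modulus0 : modulus (0 : R[i]) = 0.
Proof. exact: Normc.normc0. Qed.

Lemma modulus1 : modulus (1 : R[i]) = 1.
Proof. exact: Normc.normc1. Qed.

Lemma modulusX z n : modulus (z ^+ n) = modulus z ^+ n.
Proof.
by elim: n => [|n IH]; rewrite ?expr0 ?modulus1 // !exprS modulusM IH.
Qed.

Lemma modulusXz z (k : int) : modulus (z ^ k) = modulus z ^ k.
Proof. by case: k => n; rewrite ?NegzE ?exprnN ?modulusV modulusX. Qed.

Lemma modulus_conj z : modulus z^* = modulus z.
Proof. by case: z => a b; rewrite /modulus /= sqrrN. Qed.

Lemma modulus_real (a : R) : modulus a%:C = `|a|.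
Proof. by rewrite /modulus /= expr0n /= addr0 sqrtr_sqr. Qed.

Lemma normC_modulus z : `|z| = (modulus z)%:C.
Proof. by []. Qed.

Lemma abs_Re z : `|Re z| <= modulus z.
Proof.
rewrite -(@ler_pXn2r _ 2) ?nnegrE ?modulus_ge0 // modulusE2.
by rewrite real_normK ?num_real // lerDl sqr_ge0.
Qed.

Lemma abs_Im z : `|Im z| <= modulus z.
Proof.
rewrite -(@ler_pXn2r _ 2) ?nnegrE ?modulus_ge0 // modulusE2.
by rewrite real_normK ?num_real // lerDr sqr_ge0.
Qed.

Lemma modulus_le_Re_Im z : modulus z <= `|Re z| + `|Im z|.
Proof.
rewrite -(@ler_pXn2r _ 2) ?nnegrE ?modulus_ge0 ?addr_ge0 // modulusE2 sqrrD.
rewrite !real_normK ?num_real // -addrA lerD2l lerDr.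
by rewrite mulrn_wge0 // mulr_ge0.
Qed.

Lemma mul_conj z : z * z^* = (modulus z ^+ 2)%:C.
Proof. by rewrite -sqr_normc normC_modulus -rmorphXn. Qed.

Lemma Re_mul z w : Re (z * w) = Re z * Re w - Im z * Im w.
Proof. by case: z => a b; case: w. Qed.

Lemma Im_mul z w : Im (z * w) = Re z * Im w + Im z * Re w.
Proof. by case: z => a b; case: w. Qed.

Lemma Re_add z w : Re (z + w) = Re z + Re w.
Proof. by case: z => a b; case: w. Qed.

Lemma Im_add z w : Im (z + w) = Im z + Im w.
Proof. by case: z => a b; case: w. Qed.

Lemma Re_conj z : Re z^* = Re z. Proof. by case: z. Qed.
Lemma Im_conj z : Im z^* = - Im z. Proof. by case: z. Qed.

Lemma complex_eq z w : Re z = Re w -> Im z = Im w -> z = w.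
Proof. by case: z => a b; case: w => c d /= -> ->. Qed.

Lemma modulus_sqrD z w : modulus (z + w) ^+ 2 <=
  2 * modulus z ^+ 2 + 2 * modulus w ^+ 2.
Proof.
rewrite !modulusE2 Re_add Im_add.
move: (Re z) (Im z) (Re w) (Im w) => a b c d.
have := sqr_ge0 (a - c); have := sqr_ge0 (b - d); nra.
Qed.

Lemma modulus_mul_le z w : modulus (z * w) <=
  modulus z ^+ 2 + modulus w ^+ 2.
Proof.
rewrite modulusM; have := modulus_ge0 z; have := modulus_ge0 w.
by have := sqr_ge0 (modulus z - modulus w); nra.
Qed.

End complex_modulus.

(** * Square-integrable functions *)

Section L2.
Context {R : realType} (m : {measure set (plane R) -> \bar R}).
Implicit Types (f g h : R[i] -> R[i]) (a b c : R[i]).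
Local Notation Re := complex.Re.
Local Notation Im := complex.Im.
Local Notation D := (disk2 R).

Definition Cmeas f : Prop :=
  measurable_fun D (fun u => Re (f (cplx u))) /\
  measurable_fun D (fun u => Im (f (cplx u))).

Definition L2 f : Prop := Cmeas f /\ (L2sqnorm m f < +oo)%E.

Let mD : measurable D := @measurable_disk2 R.

Lemma Cmeas_cst c : Cmeas (fun=> c).
Proof. by split; exact: measurable_cst. Qed.

Lemma CmeasD f g : Cmeas f -> Cmeas g -> Cmeas (fun z => f z + g z).
Proof.
move=> [f1 f2] [g1 g2]; split.
- by under eq_fun do rewrite Re_add; exact: measurable_funD.
- by under eq_fun do rewrite Im_add; exact: measurable_funD.
Qed.

Lemma CmeasM f g : Cmeas f -> Cmeas g -> Cmeas (fun z => f z * g z).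
Proof.
move=> [f1 f2] [g1 g2]; split.
- by under eq_fun do rewrite Re_mul; apply: measurable_funB; exact: measurable_funM.
- by under eq_fun do rewrite Im_mul; apply: measurable_funD; exact: measurable_funM.
Qed.

Lemma Cmeas_conj f : Cmeas f -> Cmeas (fun z => (f z)^*).
Proof.
move=> [f1 f2]; split.
- by under eq_fun do rewrite Re_conj.
- by under eq_fun do rewrite Im_conj; exact: measurable_funN.
Qed.

Lemma Cmeas_modulus2 f : Cmeas f ->
  measurable_fun D (fun u => modulus (f (cplx u)) ^+ 2).
Proof.
move=> [f1 f2]; under eq_fun do rewrite modulusE2.
by apply: measurable_funD; exact: measurable_funX.
Qed.

Lemma L2sqnorm_ge0 f : (0 <= L2sqnorm m f)%E.
Proof. by apply: integral_ge0 => u _; rewrite lee_fin sqr_ge0. Qed.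

Lemma L2sqnormZ c f : Cmeas f ->
  L2sqnorm m (fun z => c * f z) = ((modulus c ^+ 2)%:E * L2sqnorm m f)%E.
Proof.
move=> mf; rewrite /L2sqnorm -ge0_integralZl_EFin ?sqr_ge0 //; last 2 first.
- by move=> u _; rewrite lee_fin sqr_ge0.
- by apply/measurable_EFinP; exact: Cmeas_modulus2.
by apply: eq_integral => u _; rewrite modulusM exprMn EFinM.
Qed.

Lemma L2sqnormD_le f g : Cmeas f -> Cmeas g ->
  (L2sqnorm m (fun z => f z + g z)%R <=
   2%:E * L2sqnorm m f + 2%:E * L2sqnorm m g)%E.
Proof.
move=> mf mg; have mf2 := Cmeas_modulus2 f mf; have mg2 := Cmeas_modulus2 g mg.
have m2 (v : plane R -> R) : measurable_fun D v ->
    measurable_fun D (fun u => 2%:E * (v u)%:E)%E.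
  move=> mv; apply: emeasurable_funM; first exact: measurable_cst.
  exact/measurable_EFinP.
rewrite /L2sqnorm -!ge0_integralZl_EFin //; last 4 first.
- by move=> u _; rewrite lee_fin sqr_ge0.
- exact/measurable_EFinP.
- by move=> u _; rewrite lee_fin sqr_ge0.
- exact/measurable_EFinP.
rewrite -ge0_integralD //; last 4 first.
- by move=> u _; rewrite mule_ge0 ?lee_fin ?sqr_ge0.
- exact: m2.
- by move=> u _; rewrite mule_ge0 ?lee_fin ?sqr_ge0.
- exact: m2.
apply: ge0_le_integral => //.
- by move=> u _; rewrite lee_fin sqr_ge0.
- by apply/measurable_EFinP; exact: Cmeas_modulus2 (CmeasD f g mf mg).
- by apply: emeasurable_funD; exact: m2.
- by move=> u _; rewrite -!EFinM -EFinD lee_fin modulus_sqrD.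
Qed.

Lemma L2D f g : L2 f -> L2 g -> L2 (fun z => f z + g z).
Proof.
move=> [mf nf] [mg ng]; split; first exact: CmeasD.
apply: le_lt_trans (L2sqnormD_le f g mf mg) _.
by rewrite lte_add_pinfty // lte_mul_pinfty // ?lee_fin.
Qed.

Lemma L2Z c f : L2 f -> L2 (fun z => c * f z).
Proof.
move=> [mf nf]; split; first by apply: CmeasM => //; exact: Cmeas_cst.
by rewrite L2sqnormZ // lte_mul_pinfty // lee_fin sqr_ge0.
Qed.

Lemma L2_0 : L2 (fun=> 0).
Proof.
split; first exact: Cmeas_cst.
rewrite /L2sqnorm; under eq_integral do rewrite modulus0 expr0n /=.
by rewrite integral0.
Qed.

Lemma L2B f g : L2 f -> L2 g -> L2 (fun z => f z - g z).
Proof.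
move=> Lf Lg; under eq_fun do rewrite -mulN1r.
by apply: L2D => //; exact: L2Z.
Qed.

Lemma L2_sum n (F : nat -> R[i] -> R[i]) : (forall k, L2 (F k)) ->
  L2 (fun z => \sum_(k < n) F k z).
Proof.
move=> LF; elim: n => [|n IH].
  by under eq_fun do rewrite big_ord0; exact: L2_0.
by under eq_fun do rewrite big_ord_recr /=; exact: L2D.
Qed.

Lemma Cintegrable_le F (G : plane R -> R) : Cmeas F ->
  m.-integrable D (EFin \o G) ->
  (forall u, D u -> modulus (F (cplx u)) <= G u) -> Cintegrable m F.
Proof.
move=> [F1 F2] iG FG; split; apply: (le_integrable mD _ _ iG).
- exact/measurable_EFinP.
- move=> u Du /=; rewrite lee_fin (le_trans (abs_Re _)) // (le_trans (FG _ Du)) //.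
  exact: ler_norm.
- exact/measurable_EFinP.
- move=> u Du /=; rewrite lee_fin (le_trans (abs_Im _)) // (le_trans (FG _ Du)) //.
  exact: ler_norm.
Qed.

Lemma integrable_modulus2 f : L2 f ->
  m.-integrable D (fun u => (modulus (f (cplx u)) ^+ 2)%:E).
Proof.
move=> [mf nf]; apply/integrableP; split.
  by apply/measurable_EFinP; exact: Cmeas_modulus2.
apply: le_lt_trans nf; rewrite le_eqVlt; apply/orP; left; apply/eqP.
by apply: eq_integral => u _; rewrite gee0_abs // lee_fin sqr_ge0.
Qed.

Lemma Cintegrable_mul f g : L2 f -> L2 g -> Cintegrable m (fun z => f z * g z).
Proof.
move=> Lf Lg; apply: (@Cintegrable_le _ (fun u =>
  modulus (f (cplx u)) ^+ 2 + modulus (g (cplx u)) ^+ 2)).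
- by apply: CmeasM; [case: Lf|case: Lg].
- by apply: (integrableD mD (integrable_modulus2 f Lf) (integrable_modulus2 g Lg)).
- by move=> u _; exact: modulus_mul_le.
Qed.

Lemma L2_conj f : L2 f -> L2 (fun z => (f z)^*).
Proof.
move=> [mf nf]; split; first exact: Cmeas_conj.
by rewrite /L2sqnorm; under eq_integral do rewrite modulus_conj.
Qed.

Lemma CintegralD f g : Cintegrable m f -> Cintegrable m g ->
  Cintegral m (fun z => f z + g z) = Cintegral m f + Cintegral m g.
Proof.
move=> [f1 f2] [g1 g2]; apply: complex_eq; rewrite ?Re_add ?Im_add /=.
- rewrite -RintegralD //; apply: eq_Rintegral => u _; exact: Re_add.
- rewrite -RintegralD //; apply: eq_Rintegral => u _; exact: Im_add.
Qed.

Lemma CintegrableZ c f : Cintegrable m f -> Cintegrable m (fun z => c * f z).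
Proof.
move=> [f1 f2].
have Z (k : R) (v : plane R -> R) : m.-integrable D (EFin \o v) ->
    m.-integrable D (EFin \o (fun u => k * v u)).
  by move=> iv; exact: (integrableZl mD k iv).
split.
- under eq_fun do rewrite Re_mul EFinB.
  by apply: integrableB => //; exact: Z.
- under eq_fun do rewrite Im_mul EFinD.
  by apply: integrableD => //; exact: Z.
Qed.

Lemma CintegralZ c f : Cintegrable m f ->
  Cintegral m (fun z => c * f z) = c * Cintegral m f.
Proof.
move=> [f1 f2].
have Z (k : R) (v : plane R -> R) : m.-integrable D (EFin \o v) ->
    m.-integrable D (EFin \o (fun u => k * v u)).
  by move=> iv; exact: (integrableZl mD k iv).
apply: complex_eq; rewrite ?Re_mul ?Im_mul /=.
- rewrite -!RintegralZl // -RintegralB //; [|exact: Z|exact: Z].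
  by apply: eq_Rintegral => u _; exact: Re_mul.
- rewrite -!RintegralZl // -RintegralD //; [|exact: Z|exact: Z].
  by apply: eq_Rintegral => u _; exact: Im_mul.
Qed.

Lemma L2dotDl f g h : L2 f -> L2 g -> L2 h ->
  L2dot m (fun z => f z + g z) h = L2dot m f h + L2dot m g h.
Proof.
move=> Lf Lg Lh; rewrite /L2dot; under eq_fun do rewrite mulrDl.
by rewrite CintegralD //; apply: Cintegrable_mul => //; exact: L2_conj.
Qed.

Lemma L2dotZl c f h : L2 f -> L2 h ->
  L2dot m (fun z => c * f z) h = c * L2dot m f h.
Proof.
move=> Lf Lh; rewrite /L2dot; under eq_fun do rewrite -mulrA.
by rewrite CintegralZ //; apply: Cintegrable_mul => //; exact: L2_conj.
Qed.

Lemma Cintegral_conj f : Cintegrable m f ->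
  Cintegral m (fun z => (f z)^*) = (Cintegral m f)^*.
Proof.
move=> [f1 f2]; apply: complex_eq; rewrite ?Re_conj ?Im_conj /=.
  by apply: eq_Rintegral => u _; rewrite Re_conj.
rewrite -mulN1r -RintegralZl //.
by apply: eq_Rintegral => u _; rewrite Im_conj mulN1r.
Qed.

Lemma L2dotC f g : L2 f -> L2 g -> L2dot m g f = (L2dot m f g)^*.
Proof.
move=> Lf Lg; rewrite /L2dot -Cintegral_conj; last first.
  by apply: Cintegrable_mul => //; exact: L2_conj.
congr (Cintegral m _); apply/funext => z.
by rewrite rmorphM /= conjcK mulrC.
Qed.

Lemma L2dotDr f g h : L2 f -> L2 g -> L2 h ->
  L2dot m h (fun z => f z + g z) = L2dot m h f + L2dot m h g.
Proof.
move=> Lf Lg Lh; rewrite (L2dotC _ h) //; last exact: L2D.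
by rewrite L2dotDl // rmorphD /= (L2dotC f h) // (L2dotC g h).
Qed.

Lemma L2dotZr c f h : L2 f -> L2 h ->
  L2dot m h (fun z => c * f z) = c^* * L2dot m h f.
Proof.
move=> Lf Lh; rewrite (L2dotC _ h) //; last exact: L2Z.
by rewrite L2dotZl // rmorphM /= (L2dotC f h).
Qed.

Definition normsq f : R := fine (L2sqnorm m f).

Lemma normsqE f : L2 f -> L2sqnorm m f = (normsq f)%:E.
Proof. by move=> [_ nf]; rewrite fineK // ge0_fin_numE // L2sqnorm_ge0. Qed.

Lemma normsq_ge0 f : 0 <= normsq f.
Proof. by rewrite fine_ge0 // L2sqnorm_ge0. Qed.

Lemma L2dot_self f : L2dot m f f = (normsq f)%:C.
Proof.
apply: complex_eq => /=.
  by apply: eq_Rintegral => u _; rewrite mul_conj.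
rewrite -[RHS](_ : \int[m]_(u in D) 0 = 0); last first.
  by rewrite /Rintegral integral0.
by apply: eq_Rintegral => u _; rewrite mul_conj.
Qed.

Lemma normsqD f g : L2 f -> L2 g ->
  normsq (fun z => f z + g z) = normsq f + 2 * Re (L2dot m f g) + normsq g.
Proof.
have nE h : normsq h = Re (L2dot m h h) by rewrite L2dot_self.
move=> Lf Lg; rewrite !nE L2dotDl //; last exact: L2D.
rewrite !L2dotDr // !Re_add (L2dotC f g) // Re_conj; ring.
Qed.

Lemma normsqZ c f : L2 f -> normsq (fun z => c * f z) = modulus c ^+ 2 * normsq f.
Proof.
by move=> Lf; rewrite {1}/normsq L2sqnormZ ?normsqE //; case: Lf.
Qed.

Section orthonormal.
Arguments L2dot : simpl never.
Arguments modulus : simpl never.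
Variable e : nat -> R[i] -> R[i].
Hypotheses (Le : forall k, L2 (e k))
  (eo : forall j k, L2dot m (e j) (e k) = (j == k)%:R).

Definition partial_sum (b : nat -> R[i]) n (z : R[i]) :=
  \sum_(k < n) b k * e k z.

Lemma L2_partial_sum (b : nat -> R[i]) n : L2 (partial_sum b n).
Proof. by apply: (L2_sum n (fun k z => b k * e k z)) => k; exact: L2Z. Qed.

Lemma L2dot_partial_sum (b : nat -> R[i]) n j :
  L2dot m (partial_sum b n) (e j) = if (j < n)%N then b j else 0.
Proof.
elim: n => [|n IH].
  rewrite /partial_sum; under eq_fun do rewrite big_ord0.
  by rewrite -(mul0r 0) L2dotZl ?mul0r //; exact: L2_0.
rewrite /partial_sum; under eq_fun do rewrite big_ord_recr /=.
rewrite L2dotDl //; [|exact: L2_partial_sum|exact: L2Z].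
rewrite IH L2dotZl // eo [in RHS]ltnS [in RHS]leq_eqVlt.
have [->|jn] := eqVneq j n; first by rewrite ltnn mulr1 add0r.
by rewrite mulr0 addr0.
Qed.

(** The coefficients [b] are arbitrary: for those of [h] the last sum vanishes,
    which gives Bessel's inequality, and since that sum is nonnegative no other
    choice brings the partial sum closer to [h]. *)
Lemma pythagoras h (b : nat -> R[i]) n : L2 h ->
  normsq (fun z => h z - partial_sum b n z) =
  normsq h - \sum_(k < n) modulus (L2dot m h (e k)) ^+ 2
  + \sum_(k < n) modulus (L2dot m h (e k) - b k) ^+ 2.
Proof.
move=> Lh; elim: n => [|n IH].
  rewrite !big_ord0 subr0 addr0; congr normsq; apply/funext => z.
  by rewrite /partial_sum big_ord0 subr0.
have LS := L2_partial_sum b n.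
have LhS : L2 (fun z => h z - partial_sum b n z) by exact: L2B.
have -> : (fun z => h z - partial_sum b n.+1 z) =
    (fun z => (h z - partial_sum b n z) + (- b n) * e n z).
  apply/funext => z; rewrite /partial_sum big_ord_recr /=; ring.
rewrite normsqD //; last exact: L2Z.
rewrite L2dotZr // normsqZ // modulusN.
have -> : L2dot m (fun z => h z - partial_sum b n z) (e n) = L2dot m h (e n).
  rewrite (_ : (fun z => _) = (fun z => h z + (-1) * partial_sum b n z)).
    rewrite L2dotDl //; last exact: L2Z.
    by rewrite L2dotZl // L2dot_partial_sum ltnn mulr0 addr0.
  by apply/funext => z; rewrite mulN1r.
have -> : normsq (e n) = 1.
  by apply: (@complexI R); rewrite -L2dot_self eo eqxx.
rewrite IH !big_ord_recr /=.
move: (\sum_(k < n) modulus (L2dot m h (e k)) ^+ 2) => S.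
move: (\sum_(k < n) modulus (L2dot m h (e k) - b k) ^+ 2) => T.
rewrite !modulusE2; case: (L2dot m h (e n)) => x y; case: (b n) => u v /=; ring.
Qed.

End orthonormal.

End L2.

(** * Measurability of functions continuous on the punctured disk *)

Section plane_topology.
Context {R : realType}.
Implicit Types z w : R[i].
Local Notation Re := complex.Re.
Local Notation Im := complex.Im.

(** An open set is the union of the boxes with rational corners that it
    contains; [plane] carries the product sigma-algebra. *)
Lemma measurable_open_plane (A : set (R * R)) : open A ->
  measurable (A : set (plane R)).
Proof.
move=> oA.
pose box (t : rat * rat * rat * rat) : set (plane R) :=
  `]ratr t.1.1.1, ratr t.1.1.2[%classic `*` `]ratr t.1.2, ratr t.2[%classic.
pose F t := if `[< box t `<=` A >] then box t else set0.
have -> : A = \bigcup_t F t.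
  apply/seteqP; split => [[x y] Axy|u [t _]]; last first.
    by rewrite /F; case: asboolP => // tA; exact: tA.
  have : nbhs (x, y) A by apply: open_nbhs_nbhs.
  move=> /nbhs_ballP[e /= e0 eA].
  have lt_l t : t - e < t by rewrite ltrBlDr ltrDl.
  have lt_r t : t < t + e by rewrite ltrDl.
  have [a] := rat_in_itvoo (lt_l x); have [b] := rat_in_itvoo (lt_r x).
  have [c] := rat_in_itvoo (lt_l y); have [d] := rat_in_itvoo (lt_r y).
  rewrite !in_itv /= => /andP[d1 d2] /andP[c1 c2] /andP[b1 b2] /andP[a1 a2].
  exists (a, b, c, d) => //; rewrite /F; case: asboolP.
    by rewrite /box /= !in_itv /= a2 b1 c2 d1.
  case; move=> [x' y']; rewrite /box /= !in_itv /= => -[].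
  move=> /andP[h1 h2] /andP[h3 h4]; apply: eA.
  by split; rewrite /ball /= ltr_distl; apply/andP; split; lra.
apply: countable_bigcupT_measurable; first exact: countableP.
move=> t; rewrite /F; case: asboolP => // _.
exact: measurableX.
Qed.

(** The norm of [R[i]] takes its values in [R[i]]; with the real-valued modulus
    limits can be compared by means of the order of [R]. *)
Lemma Ccvg_modulusP {T : Type} {F : set_system T} {FF : Filter F}
    (f : T -> R[i]) (l : R[i]) :
  modulus (f x - l) @[x --> F] --> (0 : R) <->
  ((f : T -> (R[i])^o) @ F --> (l : (R[i])^o)).
Proof.
split=> [/cvgrPdist_lt fl|/cvgrPdist_lt fl]; apply/cvgrPdist_lt => e e0.
  have e_real : e = (Re e)%:C by rewrite RRe_real // gtr0_real.
  have r0 : 0 < Re e by rewrite -ltcR -e_real.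
  apply: filterS (fl _ r0) => x; rewrite sub0r normrN ger0_norm ?modulus_ge0 //.
  by move=> h; rewrite distrC normC_modulus e_real ltcR.
have e0' : 0 < e%:C :> R[i] by rewrite ltcR.
apply: filterS (fl _ e0') => x; rewrite distrC normC_modulus ltcR.
by rewrite sub0r normrN ger0_norm ?modulus_ge0.
Qed.

Lemma cvg_Re {T : Type} {F : set_system T} {FF : Filter F}
    (f : T -> R[i]) (l : R[i]) :
  modulus (f x - l) @[x --> F] --> (0 : R) -> Re (f x) @[x --> F] --> Re l.
Proof.
move=> /cvgrPdist_lt fl; apply/cvgrPdist_lt => e e0.
apply: filterS (fl _ e0) => x; rewrite sub0r normrN ger0_norm ?modulus_ge0 //.
apply: le_lt_trans; rewrite distrC; have := abs_Re (f x - l).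
by rewrite Re_add; case: l {fl} => a b.
Qed.

Lemma cvg_Im {T : Type} {F : set_system T} {FF : Filter F}
    (f : T -> R[i]) (l : R[i]) :
  modulus (f x - l) @[x --> F] --> (0 : R) -> Im (f x) @[x --> F] --> Im l.
Proof.
move=> /cvgrPdist_lt fl; apply/cvgrPdist_lt => e e0.
apply: filterS (fl _ e0) => x; rewrite sub0r normrN ger0_norm ?modulus_ge0 //.
apply: le_lt_trans; rewrite distrC; have := abs_Im (f x - l).
by rewrite Im_add; case: l {fl} => a b.
Qed.

Lemma cplx_continuous : continuous (cplx : R * R -> (R[i])^o).
Proof.
move=> u; apply/Ccvg_modulusP/cvgrPdist_lt => e e0.
have h1 : `|v.1 - u.1| @[v --> u] --> (0 : R).
  rewrite -(normr0 R) -(subrr u.1); apply: cvg_norm; apply: cvgB; last exact: cvg_cst.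
  exact: cvg_fst.
have h2 : `|v.2 - u.2| @[v --> u] --> (0 : R).
  rewrite -(normr0 R) -(subrr u.2); apply: cvg_norm; apply: cvgB; last exact: cvg_cst.
  exact: cvg_snd.
have : `|v.1 - u.1| + `|v.2 - u.2| @[v --> u] --> (0 : R).
  by rewrite -[X in _ --> X](addr0 0); exact: cvgD.
move=> /cvgrPdist_lt h.
apply: filterS (h _ e0) => v; rewrite !sub0r !normrN (ger0_norm (modulus_ge0 _)).
rewrite (ger0_norm (addr_ge0 (normr_ge0 _) (normr_ge0 _))).
apply: le_lt_trans; apply: le_trans (modulus_le_Re_Im _) _.
exact: lexx.
Qed.

Definition pdisk2 : set (R * R) := [set u | punctured_disk R (cplx u)].

Lemma pdisk2E : pdisk2 = sqmod @^-1` `]0, 1[%classic.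
Proof.
have E u : (cplx u != 0) && (modulus (cplx u) < 1) = (sqmod u \in `]0, 1[).
  rewrite -modulus_eq0 modulus_cplx -[X in _ < X]sqrtr1 ltr_sqrt // in_itv /=.
  by rewrite sqrtr_eq0 -ltNge.
apply/seteqP; split => u; rewrite /pdisk2 /punctured_disk /=.
  by move=> [h1 h2]; rewrite -E h1 h2.
by rewrite -E => /andP[].
Qed.

Lemma pdisk2_disk2 (u : plane R) : pdisk2 u -> disk2 R u.
Proof. by case. Qed.

Lemma disk2_pdisk2 (u : plane R) : disk2 R u -> u != (0, 0) -> pdisk2 u.
Proof.
move=> Du u0; split => //; apply: contra u0 => /eqP u0.
by case: u u0 {Du} => x y /= [-> ->].
Qed.

Lemma open_pdisk2 : open pdisk2.
Proof.
rewrite pdisk2E; apply: open_comp; last exact: interval_open.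
move=> u _; apply: cvgD.
  apply: (continuous_comp (f := @fst R R) (g := fun x => x ^+ 2)).
    exact: cvg_fst.
  exact: exprn_continuous.
apply: (continuous_comp (f := @snd R R) (g := fun x => x ^+ 2)).
  exact: cvg_snd.
exact: exprn_continuous.
Qed.

Lemma measurable_pdisk2 : measurable (pdisk2 : set (plane R)).
Proof. exact: measurable_open_plane open_pdisk2. Qed.

Lemma continuous_measurable_pdisk2 (g : R * R -> R) :
  {in pdisk2, continuous g} -> measurable_fun (pdisk2 : set (plane R)) g.
Proof.
move=> cg; apply: (measurability _ (RGenOpens.measurableE R)).
move=> _ [_ [a [b ->] <-]].
apply: (measurable_open_plane (pdisk2 `&` g @^-1` `]a, b[%classic)).
rewrite openE => u [Pu gu].
apply: filterI; first by apply: open_nbhs_nbhs; split => //; exact: open_pdisk2.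
apply: (cg u); first by rewrite inE.
by apply: open_nbhs_nbhs; split => //; exact: interval_open.
Qed.

Lemma measurable_origin : measurable ([set (0, 0)] : set (plane R)).
Proof.
have -> : [set (0, 0)] = [set 0] `*` [set 0] :> set (plane R).
  by apply/seteqP; split => -[x y] /=; [case=> -> ->|case=> /= -> ->].
by apply: measurableX; exact: measurable_set1.
Qed.

(** The disk has only the origin in addition. *)
Lemma measurable_disk2_pdisk2 (g : plane R -> R) :
  measurable_fun (pdisk2 : set (plane R)) g -> measurable_fun (disk2 R) g.
Proof.
move=> mg.
have -> : disk2 R = pdisk2 `|` [set (0, 0)].
  apply/seteqP; split => u.
    by move=> Du; case: (eqVneq u (0, 0)) => [->|u0]; [right|left; exact: disk2_pdisk2].
  by move=> [/pdisk2_disk2 //|/= ->]; rewrite /disk2 /= expr0n /= addr0 sqrtr0.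
apply/measurable_funU; [exact: measurable_pdisk2|exact: measurable_origin|].
split => //; exact: measurable_fun_set1.
Qed.

Lemma Cmeas_eq (f g : R[i] -> R[i]) : eq_pdisk f g -> Cmeas f -> Cmeas g.
Proof.
move=> fg [f1 f2].
have S : (pdisk2 : set (plane R)) `<=` disk2 R by exact: pdisk2_disk2.
split; apply: measurable_disk2_pdisk2.
- apply: (eq_measurable_fun (fun u => Re (f (cplx u)))).
    by move=> u; rewrite inE => Pu; rewrite fg.
  exact: (measurable_funS (@measurable_disk2 R) S f1).
- apply: (eq_measurable_fun (fun u => Im (f (cplx u)))).
    by move=> u; rewrite inE => Pu; rewrite fg.
  exact: (measurable_funS (@measurable_disk2 R) S f2).
Qed.

Definition Ccontinuous (f : R[i] -> R[i]) : Prop :=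
  forall z, punctured_disk R z -> {for (z : (R[i])^o), continuous (f : (R[i])^o -> (R[i])^o)}.

Lemma holomorphic_Ccontinuous (f : R[i] -> R[i]) :
  holomorphic_on (punctured_disk R) f -> Ccontinuous f.
Proof.
by move=> hf z /hf dz; apply/differentiable_continuous/derivable1_diffP.
Qed.

Lemma Ccontinuous_plane (f : R[i] -> R[i]) (u : R * R) : Ccontinuous f ->
  pdisk2 u -> modulus (f (cplx v) - f (cplx u)) @[v --> u] --> (0 : R).
Proof.
move=> cf Pu; apply/Ccvg_modulusP.
exact: (continuous_comp (@cplx_continuous u) (cf _ Pu)).
Qed.

Lemma Ccontinuous_Cmeas (f : R[i] -> R[i]) : Ccontinuous f -> Cmeas f.
Proof.
move=> cf; split; apply: measurable_disk2_pdisk2;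
  apply: continuous_measurable_pdisk2 => u; rewrite inE => Pu.
- exact: cvg_Re (Ccontinuous_plane f u cf Pu).
- exact: cvg_Im (Ccontinuous_plane f u cf Pu).
Qed.

End plane_topology.

(** * Functions identified on the punctured disk *)

Section null_origin.
Context {R : realType} (m : {measure set (plane R) -> \bar R}).
Hypothesis m0 : m [set (0, 0)] = 0%E.
Implicit Types f g : R[i] -> R[i].
Local Notation Re := complex.Re.
Local Notation Im := complex.Im.
Local Notation D := (disk2 R).

Let mD : measurable D := @measurable_disk2 R.

Lemma ae_pdisk2 (P : plane R -> Prop) :
  (forall u, pdisk2 u -> P u) -> {ae m, forall u, D u -> P u}.
Proof.
move=> PP; exists [set (0, 0)]; split; [exact: measurable_origin|exact: m0|].
move=> u /= nP; apply: contrapT => u0; apply: nP => Du.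
by apply/PP/disk2_pdisk2 => //; apply/eqP.
Qed.

Lemma Cintegral_eq f g : Cmeas f -> eq_pdisk f g -> Cintegral m f = Cintegral m g.
Proof.
move=> mf fg; have mg := Cmeas_eq f g fg mf.
case: mf mg => [f1 f2] [g1 g2].
apply: complex_eq; rewrite /= /Rintegral; congr fine; apply: ae_eq_integral => //.
- exact/measurable_EFinP.
- exact/measurable_EFinP.
- by apply: ae_pdisk2 => u Pu; rewrite fg.
- exact/measurable_EFinP.
- exact/measurable_EFinP.
- by apply: ae_pdisk2 => u Pu; rewrite fg.
Qed.

(** Fatou's lemma, in the form that a bound on the norms of the terms of a
    pointwise convergent sequence passes to the limit. *)
Lemma L2_fatou (F : nat -> R[i] -> R[i]) f (M : \bar R) :
  (forall n, Cmeas (F n)) -> Cmeas f ->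
  (forall z, punctured_disk R z ->
     modulus (F n z - f z) @[n --> \oo] --> (0 : R)) ->
  (\forall n \near \oo, (L2sqnorm m (F n) <= M)%E) ->
  (L2sqnorm m f <= M)%E.
Proof.
move=> mF mf Ff FM.
pose h n u := (modulus (F n (cplx u)) ^+ 2)%:E.
have mh n : measurable_fun D (h n).
  by apply/measurable_EFinP; exact: Cmeas_modulus2.
have hf u : pdisk2 u -> h n u @[n --> \oo] --> (modulus (f (cplx u)) ^+ 2)%:E.
  move=> Pu.
  have c1 : Re (F n (cplx u)) @[n --> \oo] --> Re (f (cplx u)).
    exact: cvg_Re (Ff _ Pu).
  have c2 : Im (F n (cplx u)) @[n --> \oo] --> Im (f (cplx u)).
    exact: cvg_Im (Ff _ Pu).
  have sq (v : nat -> R) (l : R) : v n @[n --> \oo] --> l ->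
      v n ^+ 2 @[n --> \oo] --> l ^+ 2.
    by move=> vl; apply: (cvg_comp _ (fun x : R => x ^+ 2) vl); exact: exprn_continuous.
  have := cvgD (sq _ _ c1) (sq _ _ c2); rewrite -modulusE2.
  rewrite (_ : _ + _ = (fun n => modulus (F n (cplx u)) ^+ 2)); last first.
    by apply/funext => n; rewrite modulusE2.
  by move=> c3; apply: cvg_EFin; [exact: nearW|exact: c3].
have -> : L2sqnorm m f = (\int[m]_(u in D) limn_einf (h^~ u))%E.
  apply: ge0_ae_eq_integral => //.
  - by apply/measurable_EFinP; exact: Cmeas_modulus2.
  - apply: (emeasurable_fun_cvg (fun n u => einfs (h^~ u) n)).
      exact: measurable_fun_einfs.
    by move=> u _; rewrite limn_einf_lim; exact: is_cvg_einfs.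
  - by move=> u _; rewrite lee_fin sqr_ge0.
  - move=> u _; rewrite limn_einf_lim; apply: lime_ge; first exact: is_cvg_einfs.
    by apply: nearW => n; apply: le_ereal_inf_tmp => _ [k _ <-]; rewrite lee_fin sqr_ge0.
  - apply: ae_pdisk2 => u Pu.
    by apply/esym; have := cvg_limn_einf_sup (hf u Pu) => -[].
apply: (le_trans (fatou m mD mh _)).
  by move=> n u _; rewrite lee_fin sqr_ge0.
rewrite limn_einf_lim; apply: lime_le; first exact: is_cvg_einfs.
case: FM => N _ FM; apply: nearW => n.
apply: le_trans (FM (maxn n N) (leq_maxr _ _)).
by apply: ereal_inf_lbound; exists (maxn n N) => //=; exact: leq_maxl.
Qed.

(** The set where [f <> 0] is open by continuity and null because the norm of
    [f] is 0; so it is empty. *)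
Lemma L2sqnorm0_eq0 f : Ccontinuous f ->
  (forall U : set (R * R), open U -> U `<=` pdisk2 -> U !=set0 -> m U != 0%E) ->
  L2sqnorm m f = 0%E -> eq_pdisk f (fun=> 0).
Proof.
move=> cf mpos nf z Pz; apply/eqP/negPn/negP => fz.
have mf := Ccontinuous_Cmeas f cf.
pose g (u : plane R) := (modulus (f (cplx u)) ^+ 2)%:E.
have : (\int[m]_(u in D) `|g u| = 0)%E.
  rewrite -[RHS]nf; apply: eq_integral => u _.
  by rewrite gee0_abs // lee_fin sqr_ge0.
have mg : measurable_fun D g by apply/measurable_EFinP; exact: Cmeas_modulus2.
move=> /(ae_eq_integral_abs m mD mg)[N [mN N0 gN]].
pose U : set (R * R) := pdisk2 `&` [set u | 0 < modulus (f (cplx u))].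
have oU : open U.
  rewrite openE => u [Pu fu].
  apply: filterI; first by apply: open_nbhs_nbhs; split => //; exact: open_pdisk2.
  have /cvgrPdist_lt /(_ _ fu) := Ccontinuous_plane f u cf Pu.
  apply: filterS => v; rewrite sub0r normrN ger0_norm ?modulus_ge0 // => h.
  have := modulusD (f (cplx u) - f (cplx v)) (f (cplx v)).
  rewrite subrK -[modulus (_ - _)]modulusN opprB => le_f /=.
  by move: h le_f; lra.
have UN : U `<=` N.
  move=> u [Pu fu]; apply: gN => /= /(_ (pdisk2_disk2 u Pu)) [].
  by move/eqP; rewrite expf_eq0 /= gt_eqF.
have U_neq0 : U !=set0.
  case: z Pz fz => a b Pz fz; exists (a, b); split => //=.
  by rewrite lt_neqAle modulus_ge0 andbT eq_sym modulus_eq0.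
have /eqP := mpos U oU (fun u h => h.1) U_neq0; apply; apply/eqP.
rewrite -measure_le0 -N0; apply: le_measure => //; rewrite inE //.
exact: measurable_open_plane.
Qed.

End null_origin.

(** * Null sets, positive sets and rotation invariance of mu *)

Section mu_null_positive.
Context {R : realType}.
Local Notation leb := (@lebesgue_measure R).
Local Notation J := (@beta_integral R).

(** The recurrence gives positivity for natural second exponents, and
    [(1 - t) ^ d] decreases when [d] increases. *)
Lemma beta_integral_gt0 c d : -1 < c -> -1 < d -> (0 < J c d)%E.
Proof.
move=> c1 d1.
have Jnat k : forall c, -1 < c -> (0 < J c k%:R)%E.
  elim: k => [|k IH] b b1.
    by rewrite beta_integral_c0 // lte_fin invr_gt0; lra.
  have k1 : -1 < k%:R :> R by have := ler0n R k; lra.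
  have : ((b + 1)%:E * J b (k%:R + 1) = (k%:R + 1)%:E * J (b + 1) k%:R)%E.
    exact: beta_integral_rec.
  rewrite natr1 => H; have : (0 < (b + 1)%:E * J b k.+1%:R)%E.
    rewrite H mule_gt0 ?lte_fin //; apply: IH; lra.
  by rewrite pmule_rgt0 // lte_fin; lra.
pose k := (Num.truncn `|d|).+1.
have dk : d <= k%:R by rewrite (le_trans (ler_norm d)) // ltW // truncnS_gt.
apply: lt_le_trans (Jnat k c c1) _; apply: ge0_le_integral => //.
- by move=> t _; rewrite lee_fin beta_kernel_ge0.
- by apply/measurable_EFinP; apply: measurable_funS (measurable_beta_kernel _ _).
- by apply/measurable_EFinP; apply: measurable_funS (measurable_beta_kernel _ _).
- move=> t; rewrite /= in_itv /= => /andP[t0 t1].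
  rewrite lee_fin /beta_kernel ler_wpM2l ?powR_ge0 // ger_powR //.
  by rewrite subr_gt0 t1 /= lerBlDr lerDl ltW.
Qed.

Lemma beta_integral_fin c d : -1 < c -> -1 < d -> J c d \is a fin_num.
Proof.
by move=> c1 d1; rewrite ge0_fin_numE ?beta_integral_ge0 // beta_integral_lty.
Qed.

Lemma fine_beta_gt0 c d : -1 < c -> -1 < d -> 0 < fine (J c d).
Proof.
by move=> c1 d1; rewrite fine_gt0 // beta_integral_gt0 // beta_integral_lty.
Qed.

Lemma area_origin : area R [set (0, 0)] = 0%E.
Proof.
transitivity (area R [set u | sqmod u <= 0]); last by rewrite area_disk maxxx.
congr (area R _).
apply/seteqP; split => [u -> /=|[x y] /=]; rewrite /sqmod /= ?expr0n /= ?addr0 //.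
move=> xy; have x0 := sqr_ge0 x; have y0 := sqr_ge0 y.
have /eqP : x ^+ 2 = 0 by lra.
have /eqP : y ^+ 2 = 0 by lra.
by rewrite !expf_eq0 /= => /eqP -> /eqP ->.
Qed.

Lemma mu_origin (alpha beta : R) : mu alpha beta [set (0, 0)] = 0%E.
Proof.
have mO := @measurable_origin R.
rewrite /mu; apply: null_set_integral.
- by apply: measurableI => //; exact: measurable_disk2.
- by apply/measurable_EFinP; apply: measurable_funTS; exact: measurable_mu_density.
- apply/eqP; rewrite -measure_le0 -area_origin; apply: le_measure; rewrite ?inE //.
  by apply: measurableI => //; exact: measurable_disk2.
Qed.

Lemma mu_density_gt0 (alpha beta : R) (u : plane R) : -1 < alpha -> -1 < beta ->
  pdisk2 u -> 0 < mu_density alpha beta u.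
Proof.
move=> a1 b1; rewrite pdisk2E /= in_itv /= => /andP[u0 u1].
rewrite mu_densityE mulr_gt0 // ?invr_gt0 ?fine_beta_gt0 //.
by rewrite mulr_gt0 // powR_gt0 // subr_gt0.
Qed.

Lemma area_open_gt0 (U : set (R * R)) : open U -> U !=set0 -> area R U != 0%E.
Proof.
move=> oU [[x y] Uxy]; have : nbhs (x, y) U by apply: open_nbhs_nbhs.
move=> /nbhs_ballP[e /= e0 eU].
pose B : set (plane R) := `]x - e, x + e[%classic `*` `]y - e, y + e[%classic.
have mB : measurable B by apply: measurableX.
have BU : B `<=` U.
  move=> [a b] [] /=; rewrite !in_itv /= => /andP[a1 a2] /andP[b1 b2]; apply: eU.
  by split; rewrite /ball /= ltr_distl; apply/andP; split; lra.
apply/eqP => U0; have : area R B = 0%E.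
  apply/eqP; rewrite -measure_le0 -U0; apply: le_measure => //; rewrite inE //.
  exact: measurable_open_plane.
have xe : x - e < x + e by lra.
have ye : y - e < y + e by lra.
have -> : area R B = ((pi^-1)%:E *
    (leb `](x - e)%R, (x + e)%R[%classic * leb `](y - e)%R, (y + e)%R[%classic))%E.
  by rewrite /area /= /mscale /=; congr (_ * _)%E; exact: product_measure1E.
rewrite !lebesgue_measure_itv /=.
rewrite !lte_fin xe ye -!EFinB -!EFinM => -[] /eqP; apply/negP.
rewrite gt_eqF // mulr_gt0 ?invr_gt0 ?pi_gt0 // mulr_gt0 //; lra.
Qed.

Lemma mu_open_gt0 (alpha beta : R) (U : set (R * R)) :
  -1 < alpha -> -1 < beta -> open U -> U `<=` pdisk2 -> U !=set0 ->
  mu alpha beta U != 0%E.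
Proof.
move=> a1 b1 oU UP U0; apply/eqP => muU.
have mU : measurable (U : set (plane R)) by exact: measurable_open_plane.
have mg : measurable_fun (U : set (plane R)) (EFin \o mu_density alpha beta).
  by apply/measurable_EFinP; apply: measurable_funTS; exact: measurable_mu_density.
have : (\int[area R]_(u in U) `|(EFin \o mu_density alpha beta) u| = 0)%E.
  rewrite -[RHS]muU /mu setIidl; last by move=> u /UP /pdisk2_disk2.
  by apply: eq_integral => u _; rewrite gee0_abs // lee_fin mu_density_ge0.
move=> /(ae_eq_integral_abs (area R) mU mg)[N [mN N0 UN]].
have /eqP := area_open_gt0 U oU U0; apply.
apply/eqP; rewrite -measure_le0 -N0; apply: le_measure => //; rewrite ?inE //.
move=> u Uu; apply: UN => /= /(_ Uu) [] /eqP.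
by rewrite gt_eqF // mu_density_gt0 //; exact: UP.
Qed.

End mu_null_positive.

Section rotation_invariance.
Context {R : realType} (alpha beta c s : R).
Hypotheses (cs1 : c ^+ 2 + s ^+ 2 = 1) (s0 : s != 0).
Local Notation D := (disk2 R).
Local Notation Re := complex.Re.
Local Notation Im := complex.Im.

Lemma sqmod_rotation u : sqmod (rotation c s u) = sqmod u.
Proof.
rewrite /sqmod /rotation /=.
transitivity ((c ^+ 2 + s ^+ 2) * (u.1 ^+ 2 + u.2 ^+ 2)); first by ring.
by rewrite cs1 mul1r.
Qed.

Lemma disk2_rotation : rotation c s @^-1` D = D.
Proof.
rewrite disk2_sqmod; apply/seteqP; split => u /=;
  by rewrite sqmod_rotation.
Qed.

Lemma mu_rotation (A : set (plane R)) : measurable A ->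
  pushforward (mu alpha beta) (rotation c s) A = mu alpha beta A.
Proof.
move=> mA; have mD := @measurable_disk2 R.
have mrot := @measurable_rotation R c s.
have mAD : measurable (A `&` D) by exact: measurableI.
rewrite /pushforward /mu -[in LHS]disk2_rotation -preimage_setI.
transitivity (\int[pushforward (area R) (rotation c s)]_(u in A `&` D)
    (mu_density alpha beta u)%:E)%E.
  rewrite (ge0_integral_pushforward mrot (area R) mAD); last 2 first.
  - by apply/measurable_EFinP; apply: measurable_funTS; exact: measurable_mu_density.
  - by move=> u _; rewrite lee_fin mu_density_ge0.
  by apply: eq_integral => u _; rewrite /= !mu_densityE sqmod_rotation.
apply: eq_measure_integral => B mB _.
exact: area_rotation.
Qed.

Lemma mu_rotation_integral (f : plane R -> R) :
  (mu alpha beta).-integrable D (EFin \o f) ->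
  (mu alpha beta).-integrable D (EFin \o (f \o rotation c s)) ->
  \int[mu alpha beta]_(u in D) f (rotation c s u) = \int[mu alpha beta]_(u in D) f u.
Proof.
move=> if1 if2; have mD := @measurable_disk2 R.
have mrot := @measurable_rotation R c s.
pose g : plane R -> \bar R := (EFin \o f) \_ D.
have mg : measurable_fun [set: plane R] g.
  by apply/(measurable_restrictT _ _).1 => //; exact: measurable_int if1.
have gE : g \o rotation c s = (EFin \o (f \o rotation c s)) \_ D.
  apply/funext => u; rewrite /g /= !patchE.
  suff -> : (rotation c s u \in D) = (u \in D) by [].
  have E : D (rotation c s u) = D u by rewrite -[in RHS]disk2_rotation.
  by apply/idP/idP => /set_mem Du; apply/mem_set; move: Du; rewrite E.
rewrite /Rintegral; congr fine; apply/esym.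
rewrite integral_mkcond.
transitivity (\int[pushforward (mu alpha beta) (rotation c s)]_(u in setT) g u)%E.
  by apply: eq_measure_integral => A mA _; apply/esym; exact: mu_rotation.
rewrite (integral_pushforward mrot mg) //; last first.
  by rewrite preimage_setT gE; apply/(integrable_mkcond _ mD).
by rewrite preimage_setT gE [RHS]integral_mkcond.
Qed.

Lemma cplx_rotation u : cplx (rotation c s u) = (c +i* s) * cplx u.
Proof. by case: u => x y; rewrite /cplx /rotation /=; congr (_ +i* _); ring. Qed.

(** The integral [I] of [F] is unchanged by the rotation, so [I = w * I]. *)
Lemma Cintegral_rotation_eq0 (F : R[i] -> R[i]) (w : R[i]) :
  Cintegrable (mu alpha beta) F -> w != 1 ->
  (forall z, F ((c +i* s) * z) = w * F z) -> Cintegral (mu alpha beta) F = 0.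
Proof.
move=> iF w1 Fw; have := CintegrableZ _ w _ iF => -[i1 i2].
have H : Cintegral (mu alpha beta) (fun z => F ((c +i* s) * z)) =
    Cintegral (mu alpha beta) F.
  have Frot u : F (cplx (rotation c s u)) = w * F (cplx u).
    by rewrite cplx_rotation Fw.
  case: iF => [f1 f2]; apply: complex_eq => /=.
    rewrite -[RHS](mu_rotation_integral (fun u => Re (F (cplx u)))) //.
      by apply: eq_Rintegral => u _; rewrite cplx_rotation.
    rewrite (_ : _ \o _ = fun u => Re (w * F (cplx u))) //.
    by apply/funext => u; rewrite -Frot.
  rewrite -[RHS](mu_rotation_integral (fun u => Im (F (cplx u)))) //.
    by apply: eq_Rintegral => u _; rewrite cplx_rotation.
  rewrite (_ : _ \o _ = fun u => Im (w * F (cplx u))) //.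
  by apply/funext => u; rewrite -Frot.
move: H; under eq_fun do rewrite Fw.
rewrite CintegralZ // => /eqP; rewrite -subr_eq0 -{2}(mul1r (Cintegral _ _)).
by rewrite -mulrBl mulf_eq0 subr_eq0 (negbTE w1) /= => /eqP.
Qed.

End rotation_invariance.

(** * The coefficients gamma as ratios of beta integrals *)

Section pochhammer.
Context {R : realType} (alpha beta0 : R).
Hypotheses (ha : -1 < alpha) (hb : -1 < beta0).
Local Notation J := (@beta_integral R).

Lemma pochhammerS {K : pzSemiRingType} (x : K) n :
  pochhammer x n.+1 = pochhammer x n * (x + n%:R).
Proof. by rewrite /pochhammer big_ord_recr. Qed.

Lemma pochhammer_gt0 (x : R) n : 0 < x -> 0 < pochhammer x n.
Proof.
move=> x0; rewrite /pochhammer; apply: prodr_gt0 => i _.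
by rewrite ltr_wpDr.
Qed.

(** [B(b + 1, a + 1) = B(b + 2, a + 1) + B(b + 1, a + 2)], and the last term is a
    multiple of the previous one by the recurrence. *)
Lemma beta_integral_shift b : -1 < b ->
  (b + 1) * fine (J b alpha) = (alpha + b + 2) * fine (J (b + 1) alpha).
Proof.
have ha' := ha; have hb' := hb.
move=> hb1.
have hb2 : -1 < b + 1 by lra.
have ha2 : -1 < alpha + 1 by lra.
have f1 := beta_integral_fin (b + 1) alpha hb2 ha.
have f2 := beta_integral_fin b (alpha + 1) hb1 ha2.
have := beta_integral_rec b alpha hb1 ha.
rewrite -(fineK f1) -(fineK f2) -!EFinM => -[rec].
have := beta_integral_split b alpha; rewrite -(fineK f1) -(fineK f2) -EFinD => ->.
rewrite /= mulrDr rec; ring.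
Qed.

Lemma beta_integral_pochhammer n :
  fine (J (beta0 + n%:R) alpha) =
  pochhammer (beta0 + 1) n / pochhammer (alpha + beta0 + 2) n * fine (J beta0 alpha).
Proof.
have ha' := ha; have hb' := hb.
elim: n => [|n IH]; first by rewrite addr0 /pochhammer !big_ord0 divr1 mul1r.
have n0 : 0 <= n%:R :> R by [].
have hbn : -1 < beta0 + n%:R by lra.
have H := beta_integral_shift (beta0 + n%:R) hbn.
have a0 : 0 < alpha + beta0 + 2 + n%:R by lra.
have p0 : 0 < pochhammer (alpha + beta0 + 2) n by apply: pochhammer_gt0; lra.
rewrite -natr1 addrA !pochhammerS.
apply: (mulfI (lt0r_neq0 a0)).
transitivity ((beta0 + n%:R + 1) * fine (J (beta0 + n%:R) alpha)).
  by rewrite H; congr (_ * _); ring.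
rewrite IH; field; by rewrite !gt_eqF.
Qed.

(** The inverse of the squared norm of [z ^ (n - p)] in the space of index
    [p]. *)
Lemma gamma_sqr p n : gamma_coef alpha beta0 p n ^+ 2 =
  fine (J (beta0 + p%:R) alpha) / fine (J (beta0 + n%:R) alpha).
Proof.
have ha' := ha; have hb' := hb.
have a0 k : 0 < pochhammer (alpha + beta0 + 2) k by apply: pochhammer_gt0; lra.
have b0 k : 0 < pochhammer (beta0 + 1) k by apply: pochhammer_gt0; lra.
have J0 := fine_beta_gt0 beta0 alpha hb ha.
rewrite sqr_sqrtr; last by rewrite !mulr_ge0 ?invr_ge0 ?ltW.
rewrite (beta_integral_pochhammer p) (beta_integral_pochhammer n).
by field; rewrite !gt_eqF.
Qed.

Lemma gamma_gt0 p n : 0 < gamma_coef alpha beta0 p n.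
Proof.
have ha' := ha; have hb' := hb.
have a0 k : 0 < pochhammer (alpha + beta0 + 2) k by apply: pochhammer_gt0; lra.
have b0 k : 0 < pochhammer (beta0 + 1) k by apply: pochhammer_gt0; lra.
by rewrite sqrtr_gt0 !mulr_gt0 ?invr_gt0.
Qed.

End pochhammer.

Section monomials.
Context {R : realType}.
Local Notation Re := complex.Re.
Local Notation Im := complex.Im.

Lemma holomorphic_exprz (k : int) :
  holomorphic_on (punctured_disk R) (fun z : R[i] => z ^ k).
Proof.
move=> z [z0 _]; case: k => n; first exact: exprn_derivable.
by apply: derivableV; [rewrite expf_neq0|exact: exprn_derivable].
Qed.

Lemma holomorphicM (f g : R[i] -> R[i]) :
  holomorphic_on (punctured_disk R) f -> holomorphic_on (punctured_disk R) g ->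
  holomorphic_on (punctured_disk R) (fun z => f z * g z).
Proof. by move=> hf hg z Pz; apply: derivableM; [exact: hf|exact: hg]. Qed.

Lemma holomorphicZ (c : R[i]) (f : R[i] -> R[i]) :
  holomorphic_on (punctured_disk R) f ->
  holomorphic_on (punctured_disk R) (fun z => c * f z).
Proof. by move=> hf z Pz; apply: derivableZ; exact: hf. Qed.

(** The angle [pi / (2 |k|)] will do: its [k]-th power is [i] or [- i], and its
    sine is positive. *)
Lemma rotation_power_neq1 (k : int) : k != 0 ->
  exists c s : R, [/\ c ^+ 2 + s ^+ 2 = 1, s != 0 & (c +i* s) ^ k != 1].
Proof.
move=> k0; pose m := `|k|%N; have m0 : (0 < m)%N by rewrite absz_gt0.
pose t : R := pi / 2 / m%:R.
have mt : t * m%:R = pi / 2 by rewrite divfK // pnatr_eq0 -lt0n.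
exists (cos t), (sin t); split; first exact: cos2Dsin2.
  rewrite gt_eqF // sin_gt0_pi //.
  have pi0 := pi_gt0 R; have m1 : 1 <= m%:R :> R by rewrite ler1n.
  rewrite divr_gt0 ?divr_gt0 ?ltr0n //=.
  by rewrite ltr_pdivrMr ?ltr0n //; nra.
have deM n : (cos t +i* sin t) ^+ n = cos (t * n%:R) +i* sin (t * n%:R).
  elim: n => [|n IH]; first by rewrite mulr0 cos0 sin0.
  rewrite exprS IH -natr1 mulrDr mulr1 addrC cosD sinD.
  by apply: complex_eq; rewrite /=; ring.
have uk : (cos t +i* sin t) ^+ m = 'i.
  by rewrite deM mt cos_pihalf sin_pihalf.
have i1 : 'i != 1 :> R[i].
  by apply/eqP => -[/eqP]; rewrite eq_sym oner_eq0.
have [->|->] : k = m%:Z \/ k = - m%:Z.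
- by rewrite /m; case: (k) => n; [left|right; rewrite NegzE].
- by rewrite -exprnP uk.
- by rewrite -exprnN uk invr_eq1.
Qed.

End monomials.

(** * Orthonormality of the monomials *)

Section orthonormal_monomials.
Context {R : realType} (alpha beta0 : R).
Hypotheses (ha : -1 < alpha) (hb : -1 < beta0).
Local Notation mup := (mu_shift alpha beta0).
Local Notation e := (e_fun alpha beta0).
Local Notation J := (@beta_integral R).

Lemma shift_gtN1 p : -1 < beta0 + p%:R.
Proof. by apply: lt_le_trans hb _; rewrite lerDl. Qed.

Lemma mup_origin p : mup p [set (0, 0)] = 0%E.
Proof. exact: mu_origin. Qed.

Lemma mup_open_gt0 p (U : set (R * R)) :
  open U -> U `<=` pdisk2 -> U !=set0 -> mup p U != 0%E.
Proof. exact: mu_open_gt0 ha (shift_gtN1 p). Qed.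

Lemma holomorphic_e p n : holomorphic_on (punctured_disk R) (e p n).
Proof. exact/holomorphicZ/holomorphic_exprz. Qed.

Lemma Cmeas_e p n : Cmeas (e p n).
Proof. exact/Ccontinuous_Cmeas/holomorphic_Ccontinuous/holomorphic_e. Qed.

(** The factor [|z| ^ (2 (n - p))] of the integrand replaces [beta0 + p] by
    [beta0 + n] in the weight. *)
Lemma L2sqnorm_e p n : L2sqnorm (mup p) (e p n) = 1%E.
Proof.
have bp := shift_gtN1 p; have bn := shift_gtN1 n.
pose k : int := n%:Z - p%:Z; pose g2 := gamma_coef alpha beta0 p n ^+ 2.
pose phi (t : R) := g2 * t `^ (k%:~R).
have g20 : 0 <= g2 by exact: sqr_ge0.
transitivity (\int[mup p]_(u in disk2 R) (phi (sqmod u))%:E)%E.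
  apply: eq_integral => u _; congr (_%:E).
  rewrite /e_fun -/k modulusM modulus_real exprMn real_normK ?num_real //.
  rewrite /phi; congr (_ * _); rewrite modulusXz -modulus_sqr.
  by rewrite powR_intmul ?sqr_ge0 // !exprnP exprzAC.
rewrite (mu_radial _ _ phi ha bp); last 2 first.
- by apply: measurable_funM => //; exact: measurable_powR.
- by move=> t; rewrite mulr_ge0 // powR_ge0.
transitivity ((fine (J (beta0 + p%:R) alpha))^-1%:E * (g2%:E * J (beta0 + n%:R) alpha))%E.
  congr (_ * _)%E; rewrite -beta_integralZ //; apply: eq_integral => t.
  rewrite inE /= in_itv /= => /andP[t0 t1]; congr (_%:E).
  rewrite /phi /beta_kernel -mulrA; congr (_ * _); rewrite mulrA; congr (_ * _).
  rewrite -powRD; last by rewrite (gt_eqF t0) implybT.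
  by congr (_ `^ _); rewrite /k intrB -!pmulrn; ring.
rewrite -(fineK (beta_integral_fin _ _ bn ha)) -!EFinM; congr (_%:E).
rewrite /g2 gamma_sqr //.
have := fine_beta_gt0 _ _ bn ha; have := fine_beta_gt0 _ _ bp ha => j1 j2.
by field; rewrite !gt_eqF.
Qed.

Lemma L2_e p n : L2 (mup p) (e p n).
Proof. by split; [exact: Cmeas_e|rewrite L2sqnorm_e ltry]. Qed.

(** A rotation by [u] multiplies the integrand by [u ^ (j - k)], and for
    [j <> k] some [u] makes this factor differ from 1. *)
Lemma L2dot_e p j k : L2dot (mup p) (e p j) (e p k) = (j == k)%:R.
Proof.
have [<-|jk] := eqVneq j k.
  by rewrite L2dot_self /normsq L2sqnorm_e.
have kj0 : j%:Z - k%:Z != 0 by rewrite subr_eq0 eqz_nat.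
have [c [s [cs1 s0 u1]]] := @rotation_power_neq1 R _ kj0.
set u := c +i* s in u1.
have uu : u * u^* = 1 by rewrite mul_conj modulusE2 /= cs1.
have u0 : u != 0.
  by apply/eqP => u0; move: uu; rewrite u0 mul0r => /esym/eqP; rewrite oner_eq0.
have conju : u^* = u^-1 by apply: (mulfI u0); rewrite uu divff.
apply: (Cintegral_rotation_eq0 _ _ c s cs1 s0 _ (u ^ (j%:Z - k%:Z))) => //.
  by apply: Cintegrable_mul; [exact: L2_e|apply: L2_conj; exact: L2_e].
have eu n z : e p n (u * z) = u ^ (n%:Z - p%:Z) * e p n z.
  by rewrite /e_fun expfzMl mulrCA.
have conjM (x y : R[i]) : Num.conj (x * y) = Num.conj x * Num.conj y.
  by rewrite rmorphM.
have conj_u (n : int) : Num.conj (u ^ n) = u ^ (- n).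
  by rewrite -exprz_inv -conju; exact: rmorphXz.
move=> z; rewrite -/u !eu conjM conj_u.
have -> : u ^ (j%:Z - k%:Z) = u ^ (j%:Z - p%:Z) * u ^ (- (k%:Z - p%:Z)).
  by rewrite -expfzDr //; congr (u ^ _); ring.
by rewrite mulrACA.
Qed.

End orthonormal_monomials.

(** * Complex sequences and geometric bounds *)

Section complex_series.
Context {R : realType}.
Implicit Types (z w : R[i]) (u t : nat -> R[i]).
Local Notation Re := complex.Re.
Local Notation Im := complex.Im.

Definition Ccvg u (l : R[i]) : Prop :=
  modulus (u n - l) @[n --> \oo] --> (0 : R).

Lemma Ccvg_unique u l l' : Ccvg u l -> Ccvg u l' -> l = l'.
Proof.
move=> ul ul'; apply: complex_eq.
  have c1 : Re (u n) @[n --> \oo] --> Re l by exact: cvg_Re ul.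
  have c2 : Re (u n) @[n --> \oo] --> Re l' by exact: cvg_Re ul'.
  exact: (cvg_unique _ c1 c2).
have c1 : Im (u n) @[n --> \oo] --> Im l by exact: cvg_Im ul.
have c2 : Im (u n) @[n --> \oo] --> Im l' by exact: cvg_Im ul'.
exact: (cvg_unique _ c1 c2).
Qed.

Lemma modulusB z w : modulus (z - w) = modulus (w - z).
Proof. by rewrite -modulusN opprB. Qed.

Lemma modulus_sum n (F : nat -> R[i]) :
  modulus (\sum_(k < n) F k) <= \sum_(k < n) modulus (F k).
Proof.
elim: n => [|n IH]; first by rewrite !big_ord0 modulus0.
by rewrite !big_ord_recr /= (le_trans (modulusD _ _)) // lerD2r.
Qed.

Lemma squeeze0 (v e : nat -> R) : (forall n, 0 <= v n <= e n) ->
  e n @[n --> \oo] --> (0 : R) -> v n @[n --> \oo] --> (0 : R).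
Proof.
move=> ve e0; apply: (squeeze_cvgr _ (cvg_cst 0) e0).
by apply: nearW.
Qed.

Lemma CcvgD u t l l' : Ccvg u l -> Ccvg t l' -> Ccvg (fun n => u n + t n) (l + l').
Proof.
move=> ul tl; apply: (squeeze0 _ (fun n => modulus (u n - l) + modulus (t n - l'))).
  by move=> n; rewrite modulus_ge0 opprD addrACA modulusD.
by rewrite -[X in _ --> X](addr0 0); exact: cvgD.
Qed.

Lemma CcvgZ c u l : Ccvg u l -> Ccvg (fun n => c * u n) (c * l).
Proof.
move=> ul; rewrite /Ccvg.
have -> : (fun n => modulus (c * u n - c * l)) = (fun n => modulus c * modulus (u n - l)).
  by apply/funext => n; rewrite -mulrBr modulusM.
by rewrite -[X in _ --> X](mulr0 (modulus c)); apply: cvgM => //; exact: cvg_cst.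
Qed.

Lemma Ccvg_Re_Im u (a b : R) : Re (u n) @[n --> \oo] --> a ->
  Im (u n) @[n --> \oo] --> b -> Ccvg u (a +i* b).
Proof.
move=> ua ub.
apply: (squeeze0 _ (fun n => `|Re (u n) - a| + `|Im (u n) - b|)).
  move=> n; rewrite modulus_ge0; apply: le_trans (modulus_le_Re_Im _) _.
  by case: (u n).
rewrite -[X in _ --> X](addr0 0); apply: cvgD.
  rewrite -(normr0 R) -(subrr a); apply: cvg_norm.
  by apply: cvgB => //; exact: cvg_cst.
rewrite -(normr0 R) -(subrr b); apply: cvg_norm.
by apply: cvgB => //; exact: cvg_cst.
Qed.

Lemma Ccvg_le u l (b : R) : Ccvg u l -> (\forall n \near \oo, modulus (u n) <= b) ->
  modulus l <= b.
Proof.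
move=> ul ub; apply/ler_addgt0Pr => e e0.
move/cvgrPdist_lt : ul => /(_ e e0) ul.
have [n [h1 h2]] : exists n, modulus (u n) <= b /\ modulus (u n - l) < e.
  have [N _ HN] := filterI ul ub; exists N.
  have [h1 h2] := HN N (leqnn N); split => //.
  by move: h1; rewrite sub0r normrN ger0_norm ?modulus_ge0.
have := modulusD (l - u n) (u n); rewrite subrK modulusB; lra.
Qed.

(** A series with terms bounded by [C * s ^ k] converges, with the tail of the
    geometric series as an explicit bound on the remainder. *)
Section geometric.
Variables (C s : R).
Hypotheses (C0 : 0 <= C) (s01 : 0 <= s < 1).

Let tail n := C * s ^+ n / (1 - s).

Let tailS n : tail n - tail n.+1 = C * s ^+ n.
Proof.
have s1 : 1 - s != 0 by rewrite gt_eqF // subr_gt0; case/andP: s01.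
by rewrite /tail exprS; field.
Qed.

Let tail_ge0 n : 0 <= tail n.
Proof.
case/andP: s01 => s0 s1.
by apply: divr_ge0; [rewrite mulr_ge0 // exprn_ge0|rewrite subr_ge0 ltW].
Qed.

Lemma sum_geometric_le n : \sum_(k < n) C * s ^+ k <= C / (1 - s).
Proof.
have -> : \sum_(k < n) C * s ^+ k = C / (1 - s) - tail n; last first.
  by rewrite lerBlDr lerDl.
elim: n => [|n IH]; first by rewrite big_ord0 /tail expr0 mulr1 subrr.
by rewrite big_ord_recr /= IH -tailS; ring.
Qed.

Lemma geometric_tail_cvg : C * s ^+ n / (1 - s) @[n --> \oo] --> (0 : R).
Proof.
rewrite -[X in _ --> X](mul0r ((1 - s)^-1)); apply: cvgM; last exact: cvg_cst.
rewrite -[X in _ --> X](mulr0 C); apply: cvgM; first exact: cvg_cst.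
by apply: cvg_expr; case/andP: s01 => s0 s1; rewrite ger0_norm.
Qed.

Variable u : nat -> R[i].
Hypothesis uC : forall k, modulus (u k) <= C * s ^+ k.

Lemma geometric_partial n m : (n <= m)%N ->
  modulus (\sum_(k < m) u k - \sum_(k < n) u k) <= C * s ^+ n / (1 - s).
Proof.
move=> nm; rewrite -/(tail n); apply: (@le_trans _ _ (tail n - tail m)); last first.
  by rewrite lerBlDr lerDl.
rewrite -(subnKC nm); elim: (m - n)%N => [|d IH].
  by rewrite addn0 !subrr modulus0.
rewrite addnS big_ord_recr /= addrAC.
apply: le_trans (modulusD _ _) _.
have -> : tail n - tail (n + d).+1 = (tail n - tail (n + d)%N) + (tail (n + d)%N - tail (n + d).+1).
  by ring.
by rewrite tailS lerD.
Qed.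

Lemma geometric_Ccvg : exists l, Ccvg (fun n => \sum_(k < n) u k) l.
Proof.
have rcvg (v : nat -> R) : (forall k, `|v k| <= C * s ^+ k) -> cvgn (series v).
  move=> vC; apply: normed_cvg; apply: (series_le_cvg _ _ vC) => //.
    by move=> n; rewrite mulr_ge0 // exprn_ge0 //; case/andP: s01.
  apply: is_cvg_geometric_series; case/andP: s01 => s0 s1.
  by rewrite ger0_norm.
have c1 := rcvg (fun k => Re (u k)) (fun k => le_trans (abs_Re _) (uC k)).
have c2 := rcvg (fun k => Im (u k)) (fun k => le_trans (abs_Im _) (uC k)).
exists (limn (series (fun k => Re (u k))) +i* limn (series (fun k => Im (u k)))).
apply: Ccvg_Re_Im.
  have -> : (fun n => Re (\sum_(k < n) u k)) = series (fun k => Re (u k)) => //.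
  apply/funext => n; rewrite /series /= big_mkord.
  by elim: n => [|n IH]; rewrite ?big_ord0 // !big_ord_recr /= Re_add IH.
have -> : (fun n => Im (\sum_(k < n) u k)) = series (fun k => Im (u k)) => //.
apply/funext => n; rewrite /series /= big_mkord.
by elim: n => [|n IH]; rewrite ?big_ord0 // !big_ord_recr /= Im_add IH.
Qed.

Lemma geometric_tail l n : Ccvg (fun n => \sum_(k < n) u k) l ->
  modulus (l - \sum_(k < n) u k) <= C * s ^+ n / (1 - s).
Proof.
move=> ul.
apply: (Ccvg_le (fun m => \sum_(k < m) u k - \sum_(k < n) u k)).
  rewrite /Ccvg; have -> // : (fun m => modulus (\sum_(k < m) u k -
      \sum_(k < n) u k - (l - \sum_(k < n) u k))) =
    (fun m => modulus (\sum_(k < m) u k - l)).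
  by apply/funext => m; congr modulus; ring.
by exists n => // m /= nm; exact: geometric_partial.
Qed.

End geometric.

End complex_series.

(** * Power series on the unit disk *)

Section power_series.
Context {R : realType}.
Implicit Types (z w : R[i]) (u t : nat -> R[i]).

(** By Cauchy and Hadamard, this says that the power series with coefficients
    [t] has radius of convergence at least 1.  Bounds on the coefficients are
    easier to combine than convergence statements. *)
Definition subgeometric t : Prop :=
  forall r : R, 0 <= r < 1 -> exists C, forall k, modulus (t k) * r ^+ k <= C.

Lemma subgeometric_le t u : subgeometric u ->
  (forall k, modulus (t k) <= modulus (u k)) -> subgeometric t.
Proof.
move=> su tu r /[dup] /su [C uC] /andP[r0 _]; exists C => k.
by apply: le_trans (uC k); rewrite ler_wpM2r // exprn_ge0.
Qed.

(** [r ^ k] is shared out as [sqrt r ^ k] for each factor. *)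
Lemma subgeometricM t u : subgeometric t -> subgeometric u ->
  subgeometric (fun k => t k * u k).
Proof.
move=> st su r /andP[r0 r1].
have q01 : 0 <= Num.sqrt r < 1.
  by rewrite sqrtr_ge0 -[X in _ < X]sqrtr1 ltr_sqrt.
have [C tC] := st _ q01; have [C' uC] := su _ q01.
exists (C * C') => k; rewrite modulusM.
have -> : r ^+ k = Num.sqrt r ^+ k * Num.sqrt r ^+ k.
  by rewrite -exprMn -expr2 sqr_sqrtr.
rewrite mulrACA; apply: ler_pM => //; rewrite mulr_ge0 ?modulus_ge0 ?exprn_ge0 ?sqrtr_ge0 //.
Qed.

Lemma subgeometricD t u : subgeometric t -> subgeometric u ->
  subgeometric (fun k => t k + u k).
Proof.
move=> st su r r01; have [C tC] := st _ r01; have [C' uC] := su _ r01.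
exists (C + C') => k; apply: le_trans (lerD (tC k) (uC k)).
rewrite -mulrDl ler_wpM2r ?modulusD // exprn_ge0 //; by case/andP: r01.
Qed.

Lemma subgeometric_bounded t (C : R) : (forall k, modulus (t k) <= C) ->
  subgeometric t.
Proof.
move=> tC r /andP[r0 r1]; exists C => k; rewrite -[X in _ <= X]mulr1.
by apply: ler_pM; rewrite ?modulus_ge0 ?exprn_ge0 // exprn_ile1 // ltW.
Qed.

(** The ratio test: [(a + k) / (b + k)] tends to 1, so [d k * r ^ k] decreases
    from some index on. *)
Lemma subgeometric_ratio (d : nat -> R) (a b : R) : 0 < b -> (forall k, 0 <= d k) ->
  (forall k, d k.+1 * (b + k%:R) = d k * (a + k%:R)) ->
  subgeometric (fun k => (d k)%:C).
Proof.
move=> b0 d0 dS r /andP[r0 r1].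
(* (a + k) r <= b + k as soon as k >= (a r - b) / (1 - r) *)
pose N := (Num.truncn `|(a * r - b) / (1 - r)|).+1.
have r1' : 0 < 1 - r by lra.
have NP k : (N <= k)%N -> (a + k%:R) * r <= b + k%:R.
  move=> Nk; have : a * r - b <= k%:R * (1 - r).
    rewrite -ler_pdivrMr //; apply: le_trans (ler_norm _) _.
    apply: (@le_trans _ _ N%:R); last by rewrite ler_nat.
    by rewrite ltW // truncnS_gt.
  by lra.
have decr k : (N <= k)%N -> d k.+1 * r ^+ k.+1 <= d k * r ^+ k.
  move=> Nk; have bk : 0 < b + k%:R by rewrite ltr_wpDr.
  rewrite -(ler_pM2r bk); have -> : d k.+1 * r ^+ k.+1 * (b + k%:R) =
      (d k * r ^+ k) * ((a + k%:R) * r) by rewrite exprS mulrAC dS; ring.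
  by rewrite ler_wpM2l ?NP // mulr_ge0 // exprn_ge0.
exists (\sum_(i < N.+1) d i * r ^+ i) => k; rewrite modulus_real ger0_norm //.
have term_ge0 i : 0 <= d i * r ^+ i by rewrite mulr_ge0 // exprn_ge0.
have small i : (i <= N)%N -> d i * r ^+ i <= \sum_(i < N.+1) d i * r ^+ i.
  move=> iN; have iN' : (i < N.+1)%N by [].
  rewrite (bigD1 (Ordinal iN')) //= lerDl; exact: sumr_ge0.
have [kN|/ltnW Nk] := leqP k N; first exact: small.
rewrite -(subnKC Nk); elim: (k - N)%N => [|j IH]; first by rewrite addn0 small.
by rewrite addnS (le_trans _ IH) // decr // leq_addr.
Qed.

Lemma subgeometric_nat : subgeometric (fun k => k%:R).
Proof.
apply: (subgeometric_le _ (fun k => (k.+1%:R : R)%:C)).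
  apply: (subgeometric_ratio (fun k => k.+1%:R) 2 1) => //.
  by move=> k; rewrite -!natr1; ring.
move=> k; rewrite modulus_real -[k%:R](rmorph_nat (real_complex R)).
by rewrite modulus_real !ger0_norm // ler_nat.
Qed.

(** With [r] strictly between [rho] and 1, take [s = rho / r]. *)
Lemma subgeometric_geometric t (rho : R) : subgeometric t -> 0 <= rho < 1 ->
  exists C s, [/\ 0 <= C, 0 <= s < 1 & forall k z, modulus z <= rho ->
    modulus (t k * z ^+ k) <= C * s ^+ k].
Proof.
move=> st /andP[rho0 rho1]; pose r := (rho + 1) / 2.
have r01 : 0 <= r < 1 by apply/andP; rewrite /r; split; lra.
have r0 : 0 < r by rewrite /r; lra.
have [C tC] := st r r01.
have C0 : 0 <= C by apply: le_trans (tC 0%N); rewrite mulr_ge0 ?modulus_ge0.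
exists C, (rho / r); split => //.
  rewrite divr_ge0 ?(ltW r0) //= ltr_pdivrMr // mul1r /r; lra.
move=> k z zr; rewrite modulusM modulusX.
apply: (@le_trans _ _ (modulus (t k) * rho ^+ k)).
  rewrite ler_wpM2l ?modulus_ge0 // lerXn2r ?nnegrE ?modulus_ge0 //.
have rhoE : rho ^+ k = r ^+ k * (rho / r) ^+ k.
  by rewrite -exprMn mulrCA divff ?mulr1 // gt_eqF.
by rewrite rhoE mulrA ler_wpM2r ?tC // exprn_ge0 // divr_ge0 // ltW.
Qed.

Definition psum t n z : R[i] := \sum_(k < n) t k * z ^+ k.

Lemma psum_Ccvg t z : subgeometric t -> modulus z < 1 ->
  exists l, Ccvg (fun n => psum t n z) l.
Proof.
move=> st z1; have z01 : 0 <= modulus z < 1 by rewrite modulus_ge0.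
have [C [s [C0 s01 tC]]] := subgeometric_geometric t _ st z01.
by apply: (geometric_Ccvg C s C0 s01 (fun k => t k * z ^+ k)) => k; exact: tC.
Qed.

Lemma psum_uniform t (rho : R) : subgeometric t -> 0 <= rho < 1 ->
  exists2 eps : nat -> R, eps n @[n --> \oo] --> (0 : R) &
    forall n z l, modulus z <= rho -> Ccvg (fun n => psum t n z) l ->
      modulus (l - psum t n z) <= eps n.
Proof.
move=> st rho01.
have [C [s [C0 s01 tC]]] := subgeometric_geometric t _ st rho01.
exists (fun n => C * s ^+ n / (1 - s)); first exact: geometric_tail_cvg.
move=> n z l zr zl; apply: (geometric_tail C s C0 s01 (fun k => t k * z ^+ k)) => // k.
exact: tC.
Qed.

(** Taylor's inequality at order 2 for a monomial.  Multiplying by [rho ^ 2]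
    avoids the exponent [k - 2], which would be truncated for small [k]. *)
Lemma exprn_quadratic (rho : R) z w k : 0 < rho -> modulus z <= rho ->
  modulus w <= rho ->
  rho ^+ 2 * modulus (w ^+ k - z ^+ k - k%:R * z ^+ k.-1 * (w - z)) <=
  (k%:R ^+ 2 * rho ^+ k) * modulus (w - z) ^+ 2.
Proof.
move=> rho0 zr wr; have rho_ge0 := ltW rho0.
elim: k => [|k IH].
  by rewrite !expr0 subrr mul0r mul0r subrr modulus0 mulr0 expr0n /= !mul0r.
set E := w ^+ k - _ - _ in IH.
have -> : w ^+ k.+1 - z ^+ k.+1 - k.+1%:R * z ^+ k.+1.-1 * (w - z) =
    w * E + k%:R * z ^+ k.-1 * (w - z) ^+ 2.
  rewrite /E; case: k {IH E} => [|k] /=; rewrite -?natr1 !exprS; ring.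
have D0 := sqr_ge0 (modulus (w - z)).
apply: (@le_trans _ _ (rho ^+ 2 * (modulus w * modulus E +
    k%:R * rho ^+ k.-1 * modulus (w - z) ^+ 2))).
  rewrite ler_wpM2l ?sqr_ge0 //; apply: le_trans (modulusD _ _) _.
  have kE : modulus (k%:R : R[i]) = k%:R.
    by rewrite -[k%:R](rmorph_nat (real_complex R)) modulus_real ger0_norm.
  rewrite !modulusM !modulusX kE lerD2l ler_wpM2r // ler_wpM2l //.
  by rewrite lerXn2r ?nnegrE ?modulus_ge0.
rewrite mulrDr.
have h1 : rho ^+ 2 * (modulus w * modulus E) <=
    k%:R ^+ 2 * rho ^+ k.+1 * modulus (w - z) ^+ 2.
  apply: (@le_trans _ _ (rho * (rho ^+ 2 * modulus E))).
    rewrite mulrCA ler_wpM2r // mulr_ge0 ?modulus_ge0 ?sqr_ge0 //.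
  rewrite [X in _ <= X](_ : _ = rho * (k%:R ^+ 2 * rho ^+ k * modulus (w - z) ^+ 2)).
    exact: ler_wpM2l.
  by rewrite [rho ^+ k.+1]exprS; ring.
have h2 : rho ^+ 2 * (k%:R * rho ^+ k.-1 * modulus (w - z) ^+ 2) =
    k%:R * rho ^+ k.+1 * modulus (w - z) ^+ 2.
  by case: k {IH E h1} => [|k]; rewrite ?mul0r ?mulr0 //= !exprS; ring.
rewrite h2; apply: (le_trans (lerD h1 (lexx _))).
rewrite -!mulrDl ler_wpM2r // ler_wpM2r ?exprn_ge0 //.
have := ler0n R k; rewrite -natr1; nra.
Qed.

Lemma Ccvg_ext u t l : u =1 t -> Ccvg u l -> Ccvg t l.
Proof. by move=> /funext ->. Qed.

(** Summing the quadratic bounds for monomials gives one for the whole series,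
    uniform near [z]; differentiability follows from it without a study of the
    differentiated series near [z]. *)
Lemma psum_quadratic t f z : subgeometric t ->
  (forall w, modulus w < 1 -> Ccvg (fun n => psum t n w) (f w)) ->
  modulus z < 1 -> exists B (rho : R) L, [/\ 0 <= B, modulus z < rho &
    forall w, modulus w <= rho ->
      modulus (f w - f z - L * (w - z)) <= B * modulus (w - z) ^+ 2].
Proof.
move=> st tf z1; pose rho := (1 + modulus z) / 2.
have z0 := modulus_ge0 z.
have rho0 : 0 < rho by rewrite /rho; lra.
have rho01 : 0 <= rho < 1 by apply/andP; rewrite /rho; split; lra.
have zrho : modulus z < rho by rewrite /rho; lra.
have sk := subgeometricM t _ st subgeometric_nat.
have skk := subgeometricM _ _ sk subgeometric_nat.
have modulus_nat k : modulus (k%:R : R[i]) = k%:R.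
  by rewrite -[k%:R](rmorph_nat (real_complex R)) modulus_real ger0_norm.
have rho_modulus : modulus (rho%:C) = rho by rewrite modulus_real gtr0_norm.
pose T k := t k * (k%:R * z ^+ k.-1).
(* the series of derivatives at the point z *)
have [L TL] : exists L, Ccvg (fun n => \sum_(k < n) T k) L.
  have [C [s [C0 s01 kC]]] := subgeometric_geometric _ _ sk rho01.
  apply: (geometric_Ccvg (C / rho) s) => //; first by rewrite divr_ge0 // ltW.
  move=> k; rewrite mulrAC ler_pdivlMr // mulrC.
  apply: le_trans (kC k (rho%:C) _); last by rewrite rho_modulus.
  rewrite /T !modulusM !modulusX modulus_nat rho_modulus.
  case: k => [|k]; first by rewrite !(mul0r, mulr0).
  rewrite [leLHS](_ : _ = modulus (t k.+1) * k.+1%:R * (rho * modulus z ^+ k)); last first.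
    by rewrite /=; ring.
  rewrite exprS ler_wpM2l ?mulr_ge0 ?modulus_ge0 // ler_wpM2l ?(ltW rho0) //.
  by rewrite lerXn2r ?nnegrE ?modulus_ge0 // ltW.
have [C [s [C0 s01 kkC]]] := subgeometric_geometric _ _ skk rho01.
have s1 : 0 < 1 - s by case/andP: s01 => _; rewrite subr_gt0.
pose B := C / (1 - s) / rho ^+ 2.
have B0 : 0 <= B by rewrite /B divr_ge0 ?sqr_ge0 // divr_ge0 // ltW.
exists B, rho, L; split => // w wrho.
have w1 : modulus w < 1 by apply: le_lt_trans wrho _; case/andP: rho01.
pose V n := psum t n w - psum t n z - (\sum_(k < n) T k) * (w - z).
apply: (Ccvg_le V).
  have c1 := CcvgZ (-1) _ _ (tf z z1); have c2 := CcvgZ (- (w - z)) _ _ TL.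
  have := CcvgD _ _ _ _ (CcvgD _ _ _ _ (tf w w1) c1) c2.
  by rewrite !mulN1r mulNr [(w - z) * L]mulrC; apply: Ccvg_ext => n; rewrite /V; ring.
apply: nearW => n.
pose E k := w ^+ k - z ^+ k - k%:R * z ^+ k.-1 * (w - z).
have -> : V n = \sum_(k < n) t k * E k.
  by rewrite /V /psum mulr_suml -!sumrB; apply: eq_bigr => k _; rewrite /T /E; ring.
apply: le_trans (modulus_sum n (fun k => t k * E k)) _.
have D0 := sqr_ge0 (modulus (w - z)).
apply: (@le_trans _ _ (\sum_(k < n) C * s ^+ k * (modulus (w - z) ^+ 2 / rho ^+ 2))).
  apply: ler_sum => k _; rewrite modulusM mulrA ler_pdivlMr ?exprn_gt0 //.
  have := exprn_quadratic rho z w k rho0 (ltW zrho) wrho; rewrite -/(E k).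
  move=> /(ler_wpM2l (modulus_ge0 (t k))) h.
  rewrite [leLHS](_ : _ = modulus (t k) * (rho ^+ 2 * modulus (E k))); last by ring.
  apply: (le_trans h).
  rewrite mulrA ler_wpM2r //.
  apply: le_trans (kkC k (rho%:C) _); last by rewrite rho_modulus.
  by rewrite !modulusM modulusX modulus_nat rho_modulus expr2 !mulrA.
rewrite -mulr_suml /B [leRHS](_ : _ = C / (1 - s) * (modulus (w - z) ^+ 2 / rho ^+ 2)).
  by rewrite ler_wpM2r ?sum_geometric_le // divr_ge0 ?sqr_ge0.
by rewrite mulrAC -!mulrA.
Qed.

Lemma psum_derivable t f z : subgeometric t ->
  (forall w, modulus w < 1 -> Ccvg (fun n => psum t n w) (f w)) ->
  modulus z < 1 -> derivable (f : (R[i])^o -> (R[i])^o) z 1.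
Proof.
move=> st tf z1; have [B [rho [L [B0 zrho quad]]]] := psum_quadratic t f z st tf z1.
apply/cvg_ex; exists L; apply/Ccvg_modulusP/cvgrPdist_lt => e e0.
have d0 : 0 < Num.min (rho - modulus z) (e / (B + 1)).
  by rewrite lt_min subr_gt0 zrho divr_gt0 // ltr_wpDl.
have small : \forall h \near (0 : (R[i])^o)^', modulus (h : R[i]) <
    Num.min (rho - modulus z) (e / (B + 1)).
  apply: cvg_within.
  have /Ccvg_modulusP/cvgrPdist_lt/(_ _ d0) : 
     ((fun w => w) : (R[i])^o -> (R[i])^o) @ (0 : (R[i])^o) --> (0 : (R[i])^o).
    exact: cvg_id.
  apply: filterS => h; rewrite sub0r normrN subr0.
  by rewrite ger0_norm ?modulus_ge0.
have nz : \forall h \near (0 : (R[i])^o)^', (h : R[i]) != 0.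
  exact: nbhs_dnbhs_neq.
apply: filterS2 small nz => h; rewrite lt_min => /andP[h1 h2] hn0.
rewrite sub0r normrN ger0_norm ?modulus_ge0 // /GRing.scale /= mulr1.
have hz : modulus (h + z) <= rho by apply: le_trans (modulusD _ _) _; lra.
have := quad _ hz; rewrite addrK => q.
have hm : 0 < modulus h by rewrite lt_neqAle eq_sym modulus_eq0 hn0 modulus_ge0.
have -> : h^-1 * (f (h + z) - f z) - L = h^-1 * (f (h + z) - f z - L * h).
  by rewrite [in RHS]mulrBr [L * h]mulrC mulKf.
rewrite modulusM modulusV mulrC ltr_pdivrMr //.
apply: le_lt_trans q _; rewrite expr2 mulrA ltr_pM2r //.
move: h2; rewrite ltr_pdivlMr; last by rewrite ltr_wpDl.
nra.
Qed.

End power_series.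

(** * The hypergeometric kernel *)

Section hypergeometric.
Context {R : realType} (alpha beta0 : R).
Hypotheses (ha : -1 < alpha) (hb : -1 < beta0).

Definition dcoef (k : nat) : R :=
  pochhammer (alpha + beta0 + 2) k / pochhammer (beta0 + 1) k.

Lemma pocha_gt0 k : 0 < pochhammer (alpha + beta0 + 2) k.
Proof. by have ha' := ha; have hb' := hb; apply: pochhammer_gt0; lra. Qed.

Lemma pochb_gt0 k : 0 < pochhammer (beta0 + 1) k.
Proof. by have hb' := hb; apply: pochhammer_gt0; lra. Qed.

Lemma dcoef_gt0 k : 0 < dcoef k.
Proof. by rewrite divr_gt0 ?pocha_gt0 ?pochb_gt0. Qed.

Lemma subgeometric_dcoef : subgeometric (fun k => (dcoef k)%:C : R[i]).
Proof.
have hb' := hb; have b0 : 0 < beta0 + 1 by lra.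
apply: (subgeometric_ratio dcoef (alpha + beta0 + 2) (beta0 + 1) b0).
  by move=> k; exact: ltW (dcoef_gt0 k).
move=> k; rewrite /dcoef !pochhammerS.
have p0 := pochb_gt0 k; have b1 : 0 < beta0 + 1 + k%:R by rewrite ltr_wpDr.
by field; rewrite !gt_eqF.
Qed.

(** Applied with [sqrt r] to the original sequence. *)
Lemma subgeometric_even (t : nat -> R[i]) : subgeometric t ->
  subgeometric (fun k => t k.*2).
Proof.
move=> st r /andP[r0 r1].
have q01 : 0 <= Num.sqrt r < 1.
  by rewrite sqrtr_ge0 -[X in _ < X]sqrtr1 ltr_sqrt.
have [C tC] := st _ q01; exists C => k.
have -> : r ^+ k = Num.sqrt r ^+ k.*2 by rewrite -mul2n exprM sqr_sqrtr.
exact: tC.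
Qed.

Lemma pochhammer_double (a : R) n :
  pochhammer a n.*2 = 4 ^+ n * (pochhammer (a / 2) n * pochhammer ((a + 1) / 2) n).
Proof.
elim: n => [|n IH]; first by rewrite /pochhammer !big_ord0 expr0 !mulr1.
rewrite doubleS !pochhammerS IH exprS -!natr1 -muln2 natrM.
by field.
Qed.

Lemma pochhammer_C (a : R) n : pochhammer (a%:C : R[i]) n = (pochhammer a n)%:C.
Proof.
rewrite /pochhammer rmorph_prod; apply: eq_bigr => i _.
by rewrite rmorphD rmorph_nat.
Qed.

Lemma pochhammer_1 n : pochhammer (1 : R[i]) n = n`!%:R.
Proof.
elim: n => [|n IH]; first by rewrite /pochhammer big_ord0.
by rewrite pochhammerS IH factS natrM mulrC -natr1 addrC.
Qed.

Definition Fcoef (k : nat) : R[i] := (dcoef k.*2)%:C.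

(** The factors [4 ^ n] of the two duplication formulas cancel, and the
    parameter 1 cancels the factorial. *)
Lemma F_termE (xi : R[i]) n : F_term alpha beta0 xi n = Fcoef n * xi ^+ n.
Proof.
have n0 : (n`!%:R : R[i]) != 0 by rewrite pnatr_eq0 -lt0n fact_gt0.
have b0 : pochhammer ((beta0 + 1) / 2) n != 0 :> R.
  by have hb' := hb; rewrite gt_eqF // pochhammer_gt0 //; lra.
have b1 : pochhammer ((beta0 + 2) / 2) n != 0 :> R.
  by have hb' := hb; rewrite gt_eqF // pochhammer_gt0 //; lra.
have -> : Fcoef n = (pochhammer ((alpha + beta0 + 2) / 2) n)%:C *
   (pochhammer ((alpha + beta0 + 3) / 2) n)%:C /
   ((pochhammer ((beta0 + 1) / 2) n)%:C * (pochhammer ((beta0 + 2) / 2) n)%:C).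
  rewrite -!rmorphM -fmorphV -rmorphM; congr (_%:C).
  rewrite /dcoef !pochhammer_double.
  have -> : alpha + beta0 + 2 + 1 = alpha + beta0 + 3 by ring.
  have -> : beta0 + 1 + 1 = beta0 + 2 by ring.
  field.
  by rewrite b0 b1 expf_neq0 // pnatr_eq0.
rewrite /F_term /hyp3F2_term pochhammer_1 !pochhammer_C; field.
by rewrite !fmorph_eq0 b0 b1 n0.
Qed.

Lemma subgeometric_Fcoef : subgeometric Fcoef.
Proof. exact: subgeometric_even subgeometric_dcoef. Qed.

Lemma F_seriesE (xi : R[i]) :
  series (F_term alpha beta0 xi) = (fun n => psum Fcoef n xi : (R[i])^o).
Proof.
apply/funext => n; rewrite /series /= big_mkord /psum.
by apply: eq_bigr => k _; rewrite F_termE.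
Qed.

Lemma F_series_cvg (xi : R[i]) : modulus xi < 1 ->
  cvgn (series (F_term alpha beta0 xi)).
Proof.
move=> xi1; have [l Fl] := psum_Ccvg Fcoef xi subgeometric_Fcoef xi1.
apply/cvg_ex; exists l; rewrite F_seriesE; exact/Ccvg_modulusP.
Qed.

Lemma F_fun_Ccvg (xi : R[i]) : modulus xi < 1 ->
  Ccvg (fun n => psum Fcoef n xi) (F_fun alpha beta0 xi).
Proof.
move=> xi1; have [l Fl] := psum_Ccvg Fcoef xi subgeometric_Fcoef xi1.
have Fl' : series (F_term alpha beta0 xi) n @[n --> \oo] --> (l : (R[i])^o).
  by rewrite F_seriesE; exact/Ccvg_modulusP.
suff -> : F_fun alpha beta0 xi = l by [].
exact: (cvg_lim (@norm_hausdorff _ _) Fl').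
Qed.

End hypergeometric.

(** * Sums of series of monomials *)

Section holomorphic_sums.
Context {R : realType}.

Lemma near_punctured_disk (z : R[i]) : punctured_disk R z ->
  \forall w \near (z : (R[i])^o), punctured_disk R w.
Proof.
move=> [z0 z1]; have zm : 0 < modulus z.
  by rewrite lt_neqAle eq_sym modulus_eq0 z0 modulus_ge0.
have d0 : 0 < Num.min (modulus z) (1 - modulus z) by rewrite lt_min zm subr_gt0.
have /Ccvg_modulusP/cvgrPdist_lt/(_ _ d0) : 
    ((fun w => w) : (R[i])^o -> (R[i])^o) @ (z : (R[i])^o) --> (z : (R[i])^o).
  exact: cvg_id.
apply: filterS => w; rewrite sub0r normrN ger0_norm ?modulus_ge0 // lt_min.
move=> /andP[h1 h2]; split.
  by apply/eqP => w0; move: h1; rewrite w0 sub0r modulusN ltxx.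
by have := modulusD (w - z) z; rewrite subrK; lra.
Qed.

Lemma holomorphic_eq (f g : R[i] -> R[i]) : eq_pdisk f g ->
  holomorphic_on (punctured_disk R) f -> holomorphic_on (punctured_disk R) g.
Proof.
move=> fg hf z Pz; apply: (near_eq_derivable _ (hf z Pz)).
by apply: filterS (near_punctured_disk z Pz) => w Pw; exact: fg.
Qed.

End holomorphic_sums.

Section e_series.
Context {R : realType} (alpha beta0 : R).
Hypotheses (ha : -1 < alpha) (hb : -1 < beta0).
Local Notation mup := (mu_shift alpha beta0).
Local Notation e p := (fun k => e_fun alpha beta0 p k.*2).
Local Notation S p := (partial_sum (e p)).

Lemma gamma_ge0 p n : 0 <= gamma_coef alpha beta0 p n.
Proof. exact: sqrtr_ge0. Qed.

Lemma gamma_sqr_dcoef p n : gamma_coef alpha beta0 p n ^+ 2 =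
  (dcoef alpha beta0 p)^-1 * dcoef alpha beta0 n.
Proof.
have pa := pocha_gt0 _ _ ha hb; have pb := pochb_gt0 _ hb.
rewrite sqr_sqrtr; first by rewrite /dcoef invf_div.
by rewrite !mulr_ge0 ?invr_ge0 ?(ltW (pa _)) ?(ltW (pb _)).
Qed.

(** [gamma <= 1 + gamma ^ 2], and [gamma ^ 2] is a multiple of [dcoef]. *)
Lemma subgeometric_gamma p :
  subgeometric (fun k => (gamma_coef alpha beta0 p k.*2)%:C : R[i]).
Proof.
apply: (subgeometric_even (fun k => (gamma_coef alpha beta0 p k)%:C)).
apply: (subgeometric_le _ (fun k => (1 : R[i]) +
    ((dcoef alpha beta0 p)^-1)%:C * (dcoef alpha beta0 k)%:C)).
  apply: subgeometricD.
    by apply: (subgeometric_bounded _ 1) => k; rewrite modulus1.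
  apply: subgeometricM; last exact: subgeometric_dcoef.
  exact: (subgeometric_bounded (fun=> ((dcoef alpha beta0 p)^-1)%:C) _ (fun=> lexx _)).
move=> k; rewrite -rmorphM -gamma_sqr_dcoef -(rmorph1 (real_complex R)) -rmorphD.
have g0 := gamma_ge0 p k; have g2 := sqr_ge0 (gamma_coef alpha beta0 p k).
rewrite !modulus_real !ger0_norm //; last by rewrite addr_ge0.
have := sqr_ge0 (gamma_coef alpha beta0 p k - 1); nra.
Qed.

(** The even monomials make a power series in [z ^ 2], up to a power of [z]. *)
Lemma partial_sum_e p (a : nat -> R[i]) n z : z != 0 ->
  S p a n z = z ^ (- p%:Z) *
    psum (fun k => a k * (gamma_coef alpha beta0 p k.*2)%:C) n (z ^+ 2).
Proof.
move=> z0; rewrite /partial_sum /psum mulr_sumr; apply: eq_bigr => k _.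
rewrite /e_fun expfzDr // -exprM mul2n -exprnP; ring.
Qed.

Lemma modulus_sqr_lt1 (z : R[i]) : modulus z < 1 -> modulus (z ^+ 2) < 1.
Proof. by move=> z1; rewrite modulusX expr_lt1 // modulus_ge0. Qed.

Lemma e_sum_exists p (a : nat -> R[i]) (C : R) : (forall k, modulus (a k) <= C) ->
  exists2 g : R[i] -> R[i], holomorphic_on (punctured_disk R) g &
    forall z, punctured_disk R z -> Ccvg (fun n => S p a n z) (g z).
Proof.
move=> aC; pose t k := a k * (gamma_coef alpha beta0 p k.*2)%:C.
have st : subgeometric t.
  by apply: subgeometricM; [exact: subgeometric_bounded aC|exact: subgeometric_gamma].
have /choice[h th] : forall z : R[i], exists l,
    modulus z < 1 -> Ccvg (fun n => psum t n z) l.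
  move=> z; have [z1|z1] := ltP (modulus z) 1; last by exists 0.
  by have [l tl] := psum_Ccvg t z st z1; exists l.
exists (fun z => z ^ (- p%:Z) * h (z ^+ 2)).
  apply: holomorphicM; first exact: holomorphic_exprz.
  move=> z [z0 z1]; apply/derivable1_diffP.
  apply: (@differentiable_comp _ _ _ _ (fun z : (R[i])^o => z ^+ 2 : (R[i])^o)
    (h : (R[i])^o -> (R[i])^o)).
    exact/derivable1_diffP/exprn_derivable.
  apply/derivable1_diffP; apply: (psum_derivable t) => //.
  exact: modulus_sqr_lt1.
move=> z [z0 z1]; apply: (Ccvg_ext (fun n => z ^ (- p%:Z) * psum t n (z ^+ 2))).
  by move=> n; rewrite partial_sum_e.
by apply: CcvgZ; apply: th; exact: modulus_sqr_lt1.
Qed.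

Lemma L2_e2 p k : L2 (mup p) (e p k).
Proof. exact: L2_e. Qed.

Lemma L2dot_e2 p j k : L2dot (mup p) (e p j) (e p k) = (j == k)%:R.
Proof.
rewrite L2dot_e //; congr (_%:R); congr nat_of_bool.
by rewrite -!muln2 eqn_pmul2r.
Qed.

Lemma normsq_partial_sum p (a : nat -> R[i]) n :
  normsq (mup p) (S p a n) = \sum_(k < n) modulus (a k) ^+ 2.
Proof.
have LS := L2_partial_sum (mup p) (e p) (L2_e2 p) a n.
have := pythagoras (mup p) (e p) (L2_e2 p) (L2dot_e2 p) _ a n LS.
have -> : (fun z => S p a n z - S p a n z) = (fun z => 0 * S p a n z).
  by apply/funext => z; rewrite subrr mul0r.
rewrite normsqZ // modulus0 expr0n /= mul0r.
have dotE (k : 'I_n) : L2dot (mup p) (S p a n) (e p k) = a k.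
  by rewrite (L2dot_partial_sum _ _ (L2_e2 p) (L2dot_e2 p)) ltn_ord.
have -> : \sum_(k < n) modulus (L2dot (mup p) (S p a n) (e p k)) ^+ 2 =
    \sum_(k < n) modulus (a k) ^+ 2 by apply: eq_bigr => k _; congr (modulus _ ^+ 2); exact: dotE.
rewrite [X in _ - _ + X]big1; last first.
  move=> k _; transitivity (modulus (a k - a k) ^+ 2).
    by congr (modulus (_ - _) ^+ 2); exact: dotE.
  by rewrite subrr modulus0 expr0n.
by rewrite addr0 => /esym/eqP; rewrite subr_eq0 => /eqP.
Qed.

End e_series.

(** * Expansions in the even monomials *)

Section expansion.
Context {R : realType} (alpha beta0 : R).
Hypotheses (ha : -1 < alpha) (hb : -1 < beta0).
Local Notation mup := (mu_shift alpha beta0).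
Local Notation e p := (fun k => e_fun alpha beta0 p k.*2).
Local Notation S p := (partial_sum (e p)).

(** Convergence is pointwise, which determines [f] on the punctured disk;
    convergence in norm follows from Fatou's lemma. *)
Definition expands p (f : R[i] -> R[i]) (a : nat -> R[i]) : Prop :=
  (exists M : R, forall n, \sum_(k < n) modulus (a k) ^+ 2 <= M) /\
  (forall z, punctured_disk R z -> Ccvg (fun n => S p a n z) (f z)).

Lemma sum_sqr_bounded (a : nat -> R[i]) (M : R) :
  (forall n, \sum_(k < n) modulus (a k) ^+ 2 <= M) ->
  forall k, modulus (a k) <= M + 1.
Proof.
move=> aM k; have := aM k.+1; rewrite big_ord_recr /= => H.
have s0 : 0 <= \sum_(i < k) modulus (a i) ^+ 2.
  by apply: sumr_ge0 => i _; exact: sqr_ge0.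
have := sqr_ge0 (modulus (a k) - 1); have := modulus_ge0 (a k); nra.
Qed.

Lemma expands_holomorphic p f a : expands p f a ->
  holomorphic_on (punctured_disk R) f.
Proof.
move=> [[M aM] fa].
have [g hg ga] := e_sum_exists alpha beta0 ha hb p a _ (sum_sqr_bounded a M aM).
apply: holomorphic_eq hg => z Pz.
exact: Ccvg_unique (ga z Pz) (fa z Pz).
Qed.

Lemma Cmeas_expands p f a : expands p f a -> Cmeas f.
Proof.
by move=> /expands_holomorphic hf; exact/Ccontinuous_Cmeas/holomorphic_Ccontinuous.
Qed.

Let L2S p a n : L2 (mup p) (S p a n).
Proof. exact/L2_partial_sum/L2_e2. Qed.

(** Fatou's lemma for [S m - S n] as [m] tends to infinity; the squared norm of
    this difference is the sum of the squares from [n] to [m]. *)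
Lemma L2sqnorm_tail p f a : expands p f a -> forall n (M : R),
  (forall m, \sum_(k < m) modulus (a k) ^+ 2 <= M) ->
  (L2sqnorm (mup p) (fun z => (f z - S p a n z)%R) <=
   (M - \sum_(k < n) modulus (a k) ^+ 2)%:E)%E.
Proof.
move=> fa n M aM; have mf := Cmeas_expands p f a fa.
have mB (g h : R[i] -> R[i]) : Cmeas g -> Cmeas h -> Cmeas (fun z => g z - h z).
  move=> mg mh; under eq_fun do rewrite -mulN1r.
  by apply: CmeasD => //; apply: CmeasM => //; exact: Cmeas_cst.
have mS m : Cmeas (S p a m) by have [] := L2S p a m.
apply: (L2_fatou (mup p) (mup_origin alpha beta0 p)
  (fun m z => S p a m z - S p a n z)).
- by move=> m; exact: mB.
- exact: mB.
- move=> z Pz; have -> : (fun m => modulus (S p a m z - S p a n z - (f z - S p a n z))) =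
    (fun m => modulus (S p a m z - f z)).
    by apply/funext => m; congr modulus; ring.
  exact: (fa.2 z Pz).
exists n => // m /= nm.
rewrite normsqE; last exact: L2B.
rewrite lee_fin (pythagoras (mup p) (e p) (L2_e2 _ _ ha hb p) (L2dot_e2 _ _ ha hb p)) //.
have dotE (k : 'I_n) : L2dot (mup p) (S p a m) (e p k) = a k.
  rewrite (L2dot_partial_sum _ _ (L2_e2 _ _ ha hb p) (L2dot_e2 _ _ ha hb p)).
  by rewrite (leq_trans (ltn_ord k)).
rewrite normsq_partial_sum //.
have -> : \sum_(k < n) modulus (L2dot (mup p) (S p a m) (e p k)) ^+ 2 =
    \sum_(k < n) modulus (a k) ^+ 2.
  by apply: eq_bigr => k _; congr (modulus _ ^+ 2); exact: dotE.
rewrite [X in _ - _ + X]big1 ?addr0 ?lerD2r //.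
move=> k _; transitivity (modulus (a k - a k) ^+ 2).
  by congr (modulus (_ - _) ^+ 2); exact: dotE.
by rewrite subrr modulus0 expr0n.
Qed.

Lemma expands_L2 p f a : expands p f a -> L2 (mup p) f.
Proof.
move=> fa; split; first exact: Cmeas_expands fa.
have [[M aM] _] := fa; have := L2sqnorm_tail p f a fa 0 M aM.
have -> : (fun z => f z - S p a 0 z) = f.
  by apply/funext => z; rewrite /partial_sum big_ord0 subr0.
by move=> h; apply: le_lt_trans h _; rewrite ltry.
Qed.

(** The limit of a bounded increasing sequence, in the form in which it is
    compared with norms. *)
Lemma sum_sqr_lim (a : nat -> R[i]) (M : R) :
  (forall n, \sum_(k < n) modulus (a k) ^+ 2 <= M) ->
  exists s : R, (forall n, \sum_(k < n) modulus (a k) ^+ 2 <= s) /\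
    forall eps, 0 < eps -> exists n, s - \sum_(k < n) modulus (a k) ^+ 2 < eps.
Proof.
move=> aM; pose A n := \sum_(k < n) modulus (a k) ^+ 2.
have hs : has_sup (range A).
  by split; [exists (A 0%N), 0%N|exists M => _ [n _ <-]; exact: aM].
exists (sup (range A)); split=> [n|eps e0].
  by apply: sup_upper_bound => //; exists n.
have [_ [n _ <-] An] := sup_adherent e0 hs.
by exists n; move: An; rewrite -/(A n); lra.
Qed.

Lemma normsqB_tail p f a : expands p f a -> exists s : R,
  [/\ forall n, \sum_(k < n) modulus (a k) ^+ 2 <= s,
      forall n, normsq (mup p) (fun z => f z - S p a n z) <=
        s - \sum_(k < n) modulus (a k) ^+ 2 &
      forall eps, 0 < eps -> exists n, s - \sum_(k < n) modulus (a k) ^+ 2 < eps].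
Proof.
move=> fa; have [[M aM] _] := fa; have [s [as_ lims]] := sum_sqr_lim a M aM.
exists s; split => // n.
by rewrite -lee_fin -normsqE ?L2sqnorm_tail //; apply: L2B => //; exact: expands_L2 fa.
Qed.

(** By Pythagoras, the distance from [f] to its [N]-th partial sum controls the
    error on each of the first [N] coefficients, and this distance tends
    to 0. *)
Lemma expands_dot p f a : expands p f a -> forall k, L2dot (mup p) f (e p k) = a k.
Proof.
move=> fa k; have Lf := expands_L2 p f a fa.
have [s [as_ tail lims]] := normsqB_tail p f a fa.
suff : modulus (L2dot (mup p) f (e p k) - a k) = 0.
  by move=> /eqP; rewrite modulus_eq0 subr_eq0 => /eqP.
apply/eqP/negPn/negP => ck0; pose c := modulus (L2dot (mup p) f (e p k) - a k) ^+ 2.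
have c0 : 0 < c by rewrite exprn_gt0 // lt_neqAle eq_sym ck0 modulus_ge0.
have [n sn] := lims c c0.
(* N must exceed k for the k-th error to occur in Pythagoras' theorem *)
have [N [kN sN]] : exists N, (k < N)%N /\ s - \sum_(k < N) modulus (a k) ^+ 2 < c.
  exists (maxn k.+1 n); split; first exact: leq_maxl.
  apply: le_lt_trans sn; rewrite lerB // -!(big_mkord xpredT (fun k => modulus (a k) ^+ 2)).
  rewrite (big_cat_nat (n := n) _ (leq_maxr k.+1 n)) //= lerDl.
  by apply: sumr_ge0 => i _; exact: sqr_ge0.
have := tail N.
have orth := (L2_e2 _ _ ha hb p, L2dot_e2 _ _ ha hb p).
rewrite (pythagoras _ _ orth.1 orth.2) //.
have := pythagoras _ _ orth.1 orth.2 f (fun k => L2dot (mup p) f (e p k)) N Lf.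
rewrite [X in _ - _ + X]big1; last by move=> i _; rewrite subrr modulus0 expr0n.
have := normsq_ge0 (mup p)
  (fun z => f z - S p (fun k => L2dot (mup p) f (e p k)) N z).
have : c <= \sum_(i < N) modulus (L2dot (mup p) f (e p i) - a i) ^+ 2.
  rewrite (bigD1 (Ordinal kN)) //= -/c lerDl.
  by apply: sumr_ge0 => i _; exact: sqr_ge0.
by move: sN; lra.
Qed.

(** [s] is characterized as the least upper bound of the sums of squares, hence
    depends on [a] alone and not on [p]. *)
Lemma expands_norm p f a : expands p f a -> forall s : R,
  (forall n, \sum_(k < n) modulus (a k) ^+ 2 <= s) ->
  (forall eps, 0 < eps -> exists n, s - \sum_(k < n) modulus (a k) ^+ 2 < eps) ->
  normsq (mup p) f = s.
Proof.
move=> fa s as_ lims; have Lf := expands_L2 p f a fa.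
have orth := (L2_e2 _ _ ha hb p, L2dot_e2 _ _ ha hb p).
have norm_tail n : normsq (mup p) (fun z => f z - S p a n z) =
    normsq (mup p) f - \sum_(k < n) modulus (a k) ^+ 2.
  rewrite (pythagoras _ _ orth.1 orth.2) //.
  under eq_bigr do rewrite (expands_dot p f a fa).
  rewrite [X in _ - _ + X]big1 ?addr0 // => i _.
  by rewrite (expands_dot p f a fa) subrr modulus0 expr0n.
apply/eqP; rewrite eq_le; apply/andP; split; last first.
  apply/ler_addgt0Pr => eps e0; have [n sn] := lims eps e0.
  by have := normsq_ge0 (mup p) (fun z => f z - S p a n z); rewrite norm_tail; lra.
have := L2sqnorm_tail p f a fa 0 s as_.
rewrite normsqE ?lee_fin; last exact: L2B.
by rewrite norm_tail !big_ord0 !subr0.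
Qed.

Lemma expands_E2 p f a : expands p f a -> E2 alpha beta0 p f.
Proof.
move=> fa; have Lf := expands_L2 p f a fa; split.
  by split; [exact: expands_holomorphic fa|case: Lf].
move=> eps e0; have [s [as_ tail lims]] := normsqB_tail p f a fa.
have [n sn] := lims (eps ^+ 2) (exprn_gt0 2 e0).
exists n, a.
change (L2sqnorm (mup p) (fun z => (f z - S p a n z)%R) < (eps ^+ 2)%:E)%E.
rewrite normsqE ?lte_fin; last exact: L2B.
exact: le_lt_trans (tail n) sn.
Qed.

(** Let [g] be the sum of the series of [f].  Some combination [S b n] is close
    to [f], hence [S a n] is, being closer; [g] is close to [S a n] by the tail
    bound.  So [f - g] has norm 0. *)
Lemma E2_expands p f : E2 alpha beta0 p f -> 
  expands p f (fun k => L2dot (mup p) f (e p k)).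
Proof.
move=> [[hf nf] dens]; set a := fun k => _.
have cf := holomorphic_Ccontinuous f hf.
have Lf : L2 (mup p) f by split => //; exact: Ccontinuous_Cmeas.
have orth := (L2_e2 _ _ ha hb p, L2dot_e2 _ _ ha hb p).
have norm_tail n : normsq (mup p) (fun z => f z - S p a n z) =
    normsq (mup p) f - \sum_(k < n) modulus (a k) ^+ 2.
  rewrite (pythagoras _ _ orth.1 orth.2) //.
  rewrite [X in _ - _ + X]big1 ?addr0 // => i _.
  by rewrite subrr modulus0 expr0n.
have bessel n : \sum_(k < n) modulus (a k) ^+ 2 <= normsq (mup p) f.
  by have := normsq_ge0 (mup p) (fun z => f z - S p a n z); rewrite norm_tail subr_ge0.
have [g hg ga] := e_sum_exists alpha beta0 ha hb p a _ (sum_sqr_bounded a _ bessel).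
have gexp : expands p g a by split => //; exists (normsq (mup p) f).
have Lg := expands_L2 p g a gexp.
split; first by exists (normsq (mup p) f).
suff fg : eq_pdisk (fun z => f z - g z) (fun=> 0).
  move=> z Pz; have -> : f z = g z by apply/eqP; rewrite -subr_eq0 fg.
  exact: ga.
apply: (L2sqnorm0_eq0 (mup p)).
- apply: holomorphic_Ccontinuous => z Pz; apply: derivableB; [exact: hf|exact: hg].
- by move=> U; exact: mup_open_gt0.
rewrite normsqE; last exact: L2B.
congr (_%:E); apply/eqP; rewrite eq_le normsq_ge0 andbT.
apply/ler_addgt0Pr => eps e0; rewrite add0r.
(* the squared norm of f - g is at most 2 (d + d) *)
pose d := eps / 4; have d0 : 0 < d by rewrite /d; lra.
have sd : 0 < Num.sqrt d by rewrite sqrtr_gt0.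
have [n [b]] := dens _ sd; rewrite sqr_sqrtr ?(ltW d0) //.
rewrite -[X in (X < _)%E]/(L2sqnorm (mup p) (fun z => f z - S p b n z)).
rewrite normsqE ?lte_fin; last exact: L2B.
rewrite (pythagoras _ _ orth.1 orth.2) // => h.
have h1 : normsq (mup p) (fun z => f z - S p a n z) < d.
  rewrite norm_tail; apply: le_lt_trans h; rewrite lerDl.
  by apply: sumr_ge0 => i _; exact: sqr_ge0.
have h2 : normsq (mup p) (fun z => g z - S p a n z) < d.
  rewrite -lte_fin -normsqE; last exact: L2B.
  apply: le_lt_trans (L2sqnorm_tail p g a gexp n _ bessel) _.
  by rewrite -norm_tail lte_fin.
have LfS : L2 (mup p) (fun z => f z - S p a n z) by exact: L2B.
have LgS : L2 (mup p) (fun z => (-1) * (g z - S p a n z)) by apply/L2Z/L2B.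
have := L2sqnormD_le (mup p) _ _ LfS.1 LgS.1.
have -> : (fun z => f z - S p a n z + (-1) * (g z - S p a n z)) =
    (fun z => f z - g z) by apply/funext => z; ring.
rewrite !normsqE //; last exact: L2B.
rewrite normsqZ; last exact: L2B.
rewrite modulusN modulus1 expr1n mul1r -!EFinM -EFinD lee_fin /d in h1 h2 *.
lra.
Qed.

End expansion.

(** * The transform of an expansion *)

Section complex_integrals.
Context {R : realType}.
Local Notation Re := complex.Re.
Local Notation Im := complex.Im.
Local Notation D := (disk2 R).

Lemma Cmeas_lim (F : nat -> R[i] -> R[i]) (f : R[i] -> R[i]) :
  (forall n, Cmeas (F n)) ->
  (forall z, modulus z < 1 -> Ccvg (fun n => F n z) (f z)) -> Cmeas f.
Proof.
move=> mF Ff; split.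
- apply: (measurable_fun_cvg (h := fun n u => Re (F n (cplx u)))).
    by move=> n; case: (mF n).
  by move=> u Du; exact: cvg_Re (Ff _ Du).
- apply: (measurable_fun_cvg (h := fun n u => Im (F n (cplx u)))).
    by move=> n; case: (mF n).
  by move=> u Du; exact: cvg_Im (Ff _ Du).
Qed.

Lemma Cmeas_id : Cmeas (fun z : R[i] => z).
Proof. by split; apply: measurable_funTS; [exact: measurable_fst|exact: measurable_snd]. Qed.

Lemma Cmeas_exp (f : R[i] -> R[i]) k : Cmeas f -> Cmeas (fun z => f z ^+ k).
Proof.
move=> mf; elim: k => [|k IH]; first exact: Cmeas_cst.
by under eq_fun do rewrite exprS; exact: CmeasM.
Qed.

Lemma Cmeas_psum t (f : R[i] -> R[i]) n : Cmeas f -> Cmeas (fun z => psum t n (f z)).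
Proof.
move=> mf; elim: n => [|n IH].
  by under eq_fun do rewrite /psum big_ord0; exact: Cmeas_cst.
under eq_fun do rewrite /psum big_ord_recr /=.
by apply: CmeasD => //; apply: CmeasM; [exact: Cmeas_cst|exact: Cmeas_exp].
Qed.

Variable m : {measure set (plane R) -> \bar R}.
Let mD : measurable D := @measurable_disk2 R.

(** The constant 2 comes from bounding real and imaginary parts separately. *)
Lemma modulus_Cintegral_le (F : R[i] -> R[i]) (G : plane R -> R) : Cmeas F ->
  m.-integrable D (EFin \o G) -> (forall u, D u -> modulus (F (cplx u)) <= G u) ->
  modulus (Cintegral m F) <= 2 * \int[m]_(u in D) G u.
Proof.
move=> mF iG FG; have [i1 i2] := Cintegrable_le m F G mF iG FG.
apply: le_trans (modulus_le_Re_Im _) _; rewrite mulr_natl mulr2n; apply: lerD.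
- apply: le_trans (le_normr_Rintegral mD i1) _; apply: le_Rintegral => //.
    exact: integrable_norm.
  by move=> u Du; rewrite (le_trans (abs_Re _)) // FG.
- apply: le_trans (le_normr_Rintegral mD i2) _; apply: le_Rintegral => //.
    exact: integrable_norm.
  by move=> u Du; rewrite (le_trans (abs_Im _)) // FG.
Qed.

Lemma Cintegrable0 : Cintegrable m (fun=> 0).
Proof. by split; exact: integrable0. Qed.

Lemma Cintegral_sum n (F : nat -> R[i] -> R[i]) :
  (forall k, Cintegrable m (F k)) ->
  Cintegrable m (fun z => \sum_(k < n) F k z) /\
  Cintegral m (fun z => \sum_(k < n) F k z) = \sum_(k < n) Cintegral m (F k).
Proof.
move=> iF; elim: n => [|n [IH1 IH2]].
  have -> : (fun z => \sum_(k < 0) F k z) = (fun=> 0).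
    by apply/funext => z; rewrite big_ord0.
  rewrite big_ord0; split; first exact: Cintegrable0.
  have H := CintegralZ m 0 _ Cintegrable0.
  transitivity (Cintegral m (fun=> 0 * 0)); last by rewrite H mul0r.
  by congr Cintegral; apply/funext => z; rewrite mul0r.
have -> : (fun z => \sum_(k < n.+1) F k z) = (fun z => \sum_(k < n) F k z + F n z).
  by apply/funext => z; rewrite big_ord_recr.
split; last by rewrite CintegralD // IH2 big_ord_recr.
case: IH1 (iF n) => [a1 a2] [b1 b2]; split.
- by under eq_fun do rewrite Re_add; exact: (integrableD mD a1 b1).
- by under eq_fun do rewrite Im_add; exact: (integrableD mD a2 b2).
Qed.

End complex_integrals.

Section transform.
Context {R : realType} (alpha beta0 : R).
Hypotheses (ha : -1 < alpha) (hb : -1 < beta0).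
Local Notation mup := (mu_shift alpha beta0).
Local Notation D := (disk2 R).
Local Notation e p := (fun k => e_fun alpha beta0 p k.*2).
Local Notation S p := (partial_sum (e p)).
Local Notation F := (F_fun alpha beta0).
Local Notation Fc := (@Fcoef R alpha beta0).
Local Notation gam := (gamma_coef alpha beta0).

Lemma c_coef_dcoef p q n : c_coef alpha beta0 p q * dcoef alpha beta0 n =
  gam q n * gam p n.
Proof.
have d0 k := dcoef_gt0 _ _ ha hb k.
have pa := pocha_gt0 _ _ ha hb; have pb := pochb_gt0 _ hb.
have g0 r : 0 <= gam r n by exact: gamma_ge0.
have c0 : 0 <= c_coef alpha beta0 p q by exact: sqrtr_ge0.
have cd0 : 0 <= c_coef alpha beta0 p q * dcoef alpha beta0 n.
  by apply: mulr_ge0 => //; exact: ltW.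
have gg0 : 0 <= gam q n * gam p n by exact: mulr_ge0.
apply: (pexpIrn (isT : (0 < 2)%N)); rewrite ?nnegrE //.
rewrite !exprMn !gamma_sqr_dcoef // sqr_sqrtr; last first.
  by rewrite divr_ge0 // mulr_ge0 // ltW.
by rewrite /dcoef; field; rewrite !gt_eqF.
Qed.

Variables (p q : nat) (f : R[i] -> R[i]) (a : nat -> R[i]) (z : R[i]).
Hypotheses (fa : expands alpha beta0 p f a) (Pz : punctured_disk R z).

(** The integrand is, up to the constant [z ^ - q], the product of the
    integrable function [P] and of the bounded function [F \o arg]. *)
Let arg w : R[i] := (Num.conj w * z) ^+ 2.
Let w0 w : R[i] := w ^ (- p%:Z).
Let P w : R[i] := f w * Num.conj (w0 w).

Let argX w : modulus (arg w) = (modulus w * modulus z) ^+ 2.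
Proof. by rewrite modulusX modulusM modulus_conj. Qed.

Let rho01 : 0 <= modulus z ^+ 2 < 1.
Proof. by rewrite sqr_ge0 /= expr_lt1 ?modulus_ge0 //; case: Pz. Qed.

Let arg_le w : modulus w < 1 -> modulus (arg w) <= modulus z ^+ 2.
Proof.
move=> w1; rewrite argX lerXn2r ?nnegrE ?mulr_ge0 ?modulus_ge0 //.
by rewrite ler_piMl ?modulus_ge0 // ltW.
Qed.

Let arg_lt1 w : modulus w < 1 -> modulus (arg w) < 1.
Proof. by move=> /arg_le h; apply: le_lt_trans h _; case/andP: rho01. Qed.

Let G_integrandE : G_integrand alpha beta0 p q f z =
  (fun w => (z ^+ q)^-1 * (P w * F (arg w))).
Proof.
apply/funext => w; rewrite /G_integrand /P /w0 -exprnN fmorphV rmorphXn /= invfM; ring.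
Qed.

Let mf : Cmeas f := Cmeas_expands _ _ ha hb p f a fa.
Let Lf : L2 (mup p) f := expands_L2 _ _ ha hb p f a fa.

(** [w ^ - p] is a multiple of [e_0^p]. *)
Let Lw0 : L2 (mup p) w0.
Proof.
have -> : w0 = (fun w => (gam p 0)^-1%:C * e_fun alpha beta0 p 0 w).
  apply/funext => w; rewrite /e_fun mulrA -rmorphM mulVf ?mul1r ?sub0r //.
  by rewrite gt_eqF // gamma_gt0.
exact/L2Z/L2_e.
Qed.

Let mP : Cmeas P.
Proof. by apply: CmeasM => //; apply: Cmeas_conj; case: Lw0. Qed.

Let marg : Cmeas arg.
Proof.
apply: Cmeas_exp; apply: CmeasM; last exact: Cmeas_cst.
exact/Cmeas_conj/Cmeas_id.
Qed.

Let mF : Cmeas (fun w => F (arg w)).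
Proof.
apply: (Cmeas_lim (fun n w => psum Fc n (arg w))).
  by move=> n; exact: Cmeas_psum.
by move=> w /arg_lt1; exact: F_fun_Ccvg.
Qed.

Let H (u : plane R) : R := modulus (f (cplx u)) ^+ 2 + modulus (w0 (cplx u)) ^+ 2.

Let iH : (mup p).-integrable D (EFin \o H).
Proof.
exact: (integrableD (@measurable_disk2 R) (integrable_modulus2 _ _ Lf)
  (integrable_modulus2 _ _ Lw0)).
Qed.

Let iHZ c : (mup p).-integrable D (EFin \o (fun u => c * H u)).
Proof. exact: (integrableZl (@measurable_disk2 R) c iH). Qed.

Let PH u : modulus (P (cplx u)) <= H u.
Proof.
apply: le_trans (modulus_mul_le _ _) _.
by rewrite /H modulus_conj.
Qed.

Let Cintegrable_P_mul (K : R[i] -> R[i]) (c : R) : Cmeas K ->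
  (forall w, modulus w < 1 -> modulus (K w) <= c) ->
  Cintegrable (mup p) (fun w => P w * K w).
Proof.
move=> mK Kc; apply: (Cintegrable_le _ _ (fun u => c * H u)) => //.
  exact: CmeasM.
move=> u Du; rewrite modulusM mulrC.
by apply: ler_pM; rewrite ?modulus_ge0 // Kc.
Qed.

Let F_bounded : exists c : R, forall w, modulus w < 1 -> modulus (F (arg w)) <= c.
Proof.
have [eps eps0 Feps] := psum_uniform Fc _ (subgeometric_Fcoef _ _ ha hb) rho01.
exists (eps 0%N) => w w1.
have := Feps 0%N (arg w) _ (arg_le w w1) (F_fun_Ccvg _ _ ha hb _ (arg_lt1 w w1)).
by rewrite /psum big_ord0 subr0.
Qed.

Let Cintegrable_P_F : Cintegrable (mup p) (fun w => P w * F (arg w)).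
Proof. by have [c Fb] := F_bounded; exact: (Cintegrable_P_mul _ c mF Fb). Qed.

Lemma G_integrand_integrable : Cintegrable (mup p) (G_integrand alpha beta0 p q f z).
Proof. by rewrite G_integrandE; exact: (CintegrableZ _ _ _ Cintegrable_P_F). Qed.

Let coef k : R[i] := Fc k * z ^+ k.*2 * (gam p k.*2)^-1%:C.

Let termE k w : punctured_disk R w ->
  P w * (Fc k * arg w ^+ k) = coef k * (f w * Num.conj (e p k w)).
Proof.
move=> [wn0 _]; rewrite /P /arg /coef /e_fun /w0 expfzDr // -exprnP.
rewrite !rmorphM rmorphXn /= -!exprM !mul2n exprMn.
have g0 := gamma_gt0 _ _ ha hb p k.*2.
have -> : Num.conj (gam p k.*2)%:C = (gam p k.*2)%:C by exact: conjc_real.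
transitivity (((gam p k.*2)^-1%:C * (gam p k.*2)%:C) * (f w * Num.conj (w ^ (- p%:Z)) *
  (Fc k * (Num.conj w ^+ k.*2 * z ^+ k.*2)))); last by ring.
by rewrite -rmorphM mulVf ?mul1r // gt_eqF.
Qed.

(** For a partial sum of the kernel, the integral is a finite combination of
    the coefficients of [f]. *)
Let truncated n : Cintegral (mup p) (fun w => P w * psum Fc n (arg w)) =
  \sum_(k < n) coef k * a k.
Proof.
have iE k : Cintegrable (mup p) (fun w => f w * Num.conj (e p k w)).
  by apply: Cintegrable_mul => //; apply: L2_conj; exact: L2_e.
rewrite (Cintegral_eq _ (mup_origin _ _ p) _
    (fun w => \sum_(k < n) coef k * (f w * Num.conj (e p k w)))); last 2 first.
- by apply: CmeasM => //; exact: Cmeas_psum.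
- by move=> w Pw; rewrite /psum mulr_sumr; apply: eq_bigr => k _; exact: termE.
have [_ ->] := Cintegral_sum (mup p) n
  (fun k w => coef k * (f w * Num.conj (e p k w))) (fun k => CintegrableZ _ _ _ (iE k)).
apply: eq_bigr => k _; rewrite CintegralZ //; congr (_ * _).
exact: (expands_dot _ _ ha hb p f a fa).
Qed.

(** The kernel is approximated uniformly, and [P] is integrable. *)
Let G_limit : Ccvg (fun n => \sum_(k < n) coef k * a k)
  (Cintegral (mup p) (fun w => P w * F (arg w))).
Proof.
have [eps eps0 Feps] := psum_uniform Fc _ (subgeometric_Fcoef _ _ ha hb) rho01.
have Fb w : modulus w < 1 -> forall n, modulus (psum Fc n (arg w) - F (arg w)) <= eps n.
  move=> w1 n; rewrite modulusB.
  exact: (Feps n _ _ (arg_le w w1) (F_fun_Ccvg _ _ ha hb _ (arg_lt1 w w1))).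
apply: (squeeze0 _ (fun n => 2 * (eps n * \int[mup p]_(u in D) H u))); last first.
  rewrite -[X in _ --> X](mulr0 2); apply: cvgM; first exact: cvg_cst.
  by rewrite -[X in _ --> X](mul0r (\int[mup p]_(u in D) H u)); apply: cvgM => //; exact: cvg_cst.
move=> n; rewrite modulus_ge0 /= -truncated.
have mK : Cmeas (fun w => psum Fc n (arg w) - F (arg w)).
  under eq_fun do rewrite -mulN1r.
  by apply: CmeasD; [exact: Cmeas_psum|apply: CmeasM => //; exact: Cmeas_cst].
have iD := Cintegrable_P_mul _ _ mK (fun w w1 => Fb w w1 n).
have -> : Cintegral (mup p) (fun w => P w * psum Fc n (arg w)) =
    Cintegral (mup p) (fun w => P w * (psum Fc n (arg w) - F (arg w))) +
    Cintegral (mup p) (fun w => P w * F (arg w)).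
  rewrite -CintegralD //; congr Cintegral; apply/funext => w.
  by rewrite -mulrDr subrK.
rewrite addrK -RintegralZl //; last exact: measurable_disk2.
apply: modulus_Cintegral_le => //; first exact: CmeasM.
move=> u Du; rewrite modulusM mulrC.
by apply: ler_pM; rewrite ?modulus_ge0 // Fb.
Qed.

(** [c_coef p q * dcoef (2 k) / gamma p (2 k)] is [gamma q (2 k)], which makes
    the [k]-th term [a k * e_(2 k)^q z]. *)
Lemma G_Ccvg : Ccvg (fun n => S q a n z) (G alpha beta0 p q f z).
Proof.
rewrite /G G_integrandE.
rewrite (CintegralZ _ _ _ Cintegrable_P_F).
have := CcvgZ (c_coef alpha beta0 p q)%:C _ _ (CcvgZ (z ^+ q)^-1 _ _ G_limit).
apply: Ccvg_ext => n; rewrite /partial_sum !mulr_sumr; apply: eq_bigr => k _.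
have [zn0 _] := Pz.
have g0 := gamma_gt0 _ _ ha hb p k.*2.
rewrite /coef /e_fun /Fcoef expfzDr // -exprnP -exprnN.
have -> : (gam q k.*2)%:C = (c_coef alpha beta0 p q)%:C *
    (dcoef alpha beta0 k.*2)%:C * (gam p k.*2)^-1%:C.
  by rewrite -!rmorphM c_coef_dcoef mulfK // gt_eqF.
ring.
Qed.

End transform.

(** * Isometry and inverse *)

Section isometry.
Context {R : realType} (alpha beta0 : R).
Hypotheses (ha : -1 < alpha) (hb : -1 < beta0).
Local Notation mup := (mu_shift alpha beta0).
Local Notation expn := (expands alpha beta0).
Local Notation GT := (G alpha beta0).

Lemma G_expands p q f a : expn p f a -> expn q (GT p q f) a.
Proof. by move=> fa; split=> [|z Pz]; [case: fa|exact: G_Ccvg]. Qed.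

Lemma expands_unique p f g a : expn p f a -> expn p g a -> eq_pdisk f g.
Proof. by move=> [_ fa] [_ ga] z Pz; exact: Ccvg_unique (fa z Pz) (ga z Pz). Qed.

Lemma expands_linear p c d f g a b : expn p f a -> expn p g b ->
  expn p (fun z => c * f z + d * g z) (fun k => c * a k + d * b k).
Proof.
move=> [[M aM] fa] [[N bN] gb]; split.
  exists (2 * modulus c ^+ 2 * M + 2 * modulus d ^+ 2 * N) => n.
  apply: (@le_trans _ _ (\sum_(k < n) (2 * modulus c ^+ 2 * modulus (a k) ^+ 2 +
      2 * modulus d ^+ 2 * modulus (b k) ^+ 2))).
    apply: ler_sum => k _; apply: le_trans (modulus_sqrD _ _) _.
    by rewrite !modulusM !exprMn !mulrA.
  have coef_ge0 (x : R) : 0 <= 2 * x ^+ 2 by rewrite mulr_ge0 ?sqr_ge0.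
  rewrite big_split /= -!mulr_sumr.
  by apply: lerD; apply: ler_wpM2l; [exact: coef_ge0|exact: aM|exact: coef_ge0|exact: bN].
move=> z Pz; have := CcvgD _ _ _ _ (CcvgZ c _ _ (fa z Pz)) (CcvgZ d _ _ (gb z Pz)).
apply: Ccvg_ext => n; rewrite /partial_sum !mulr_sumr -big_split /=.
by apply: eq_bigr => k _; rewrite mulrDl !mulrA.
Qed.

Lemma expands_same_norm p q f g a : expn p f a -> expn q g a ->
  normsq (mup p) f = normsq (mup q) g.
Proof.
move=> fa ga; have [[M aM] _] := fa; have [s [as_ lims]] := sum_sqr_lim a M aM.
by rewrite (expands_norm _ _ ha hb p f a fa s) // (expands_norm _ _ ha hb q g a ga s).
Qed.

(** By polarization: the real part of the inner product is determined by the
    norms of sums, and the imaginary part is the real part for [i * g]. *)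
Lemma expands_same_dot p q f g f' g' a b : expn p f a -> expn p g b ->
  expn q f' a -> expn q g' b ->
  L2dot (mup q) f' g' = L2dot (mup p) f g.
Proof.
move=> fa gb fa' gb'.
have Re_dot h h' d : expn p h d -> expn q h' d ->
    complex.Re (L2dot (mup q) f' h') = complex.Re (L2dot (mup p) f h).
  move=> hd hd'.
  have Lf := expands_L2 _ _ ha hb p f a fa; have Lh := expands_L2 _ _ ha hb p h d hd.
  have Lf' := expands_L2 _ _ ha hb q f' a fa'; have Lh' := expands_L2 _ _ ha hb q h' d hd'.
  have := expands_same_norm p q _ _ _ (expands_linear p 1 1 _ _ _ _ fa hd)
    (expands_linear q 1 1 _ _ _ _ fa' hd').
  have one (u v : R[i] -> R[i]) : (fun z => 1 * u z + 1 * v z) = (fun z => u z + v z).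
    by apply/funext => z; rewrite !mul1r.
  rewrite (one f h) (one f' h') (normsqD _ _ _ Lf Lh) (normsqD _ _ _ Lf' Lh').
  rewrite (expands_same_norm p q _ _ _ fa fa') (expands_same_norm p q _ _ _ hd hd').
  have two_neq0 : (2 : R) != 0 by rewrite pnatr_eq0.
  by move=> /addIr /addrI /(mulfI two_neq0) /esym.
apply: complex_eq; first exact: Re_dot gb gb'.
have ImE (m : {measure set (plane R) -> \bar R}) (u v : R[i] -> R[i]) :
    L2 m u -> L2 m v ->
    complex.Im (L2dot m u v) = complex.Re (L2dot m u (fun z => 'i%C * v z + 0 * v z)).
  move=> Lu Lv.
  have -> : (fun z => 'i%C * v z + 0 * v z) = (fun z => 'i%C * v z).
    by apply/funext => z; rewrite mul0r addr0.
  rewrite L2dotZr // Re_mul /=; ring.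
have Iq := ImE _ f' g' (expands_L2 _ _ ha hb q f' a fa') (expands_L2 _ _ ha hb q g' b gb').
have Ip := ImE _ f g (expands_L2 _ _ ha hb p f a fa) (expands_L2 _ _ ha hb p g b gb).
rewrite [LHS]Iq [RHS]Ip; exact: Re_dot (expands_linear p 'i%C 0 _ _ _ _ gb gb)
  (expands_linear q 'i%C 0 _ _ _ _ gb' gb').
Qed.

Lemma Ginv_G p q : Ginv alpha beta0 p q = GT q p.
Proof.
apply/funext => f; apply/funext => w; rewrite /Ginv /G; congr (_%:C * _).
by rewrite /c_coef (mulrC (pochhammer _ p)) (mulrC (pochhammer (alpha + beta0 + 2) p)).
Qed.

Lemma E2_G p q f : E2 alpha beta0 p f -> E2 alpha beta0 q (GT p q f).
Proof.
move=> /(E2_expands _ _ ha hb) fa.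
exact: (expands_E2 _ _ ha hb _ _ _ (G_expands p q f _ fa)).
Qed.

Lemma G_G p q f : E2 alpha beta0 p f -> eq_pdisk (GT q p (GT p q f)) f.
Proof.
move=> /(E2_expands _ _ ha hb) fa.
exact: expands_unique (G_expands q p _ _ (G_expands p q f _ fa)) fa.
Qed.

Lemma G_isometry_onto p q :
  isometry_onto (mup p) (mup q) (E2 alpha beta0 p) (E2 alpha beta0 q) (GT p q).
Proof.
split.
- by move=> f; exact: E2_G.
- move=> c d f g /(E2_expands _ _ ha hb) fa /(E2_expands _ _ ha hb) gb.
  apply: (expands_unique q _ _ _ (G_expands p q _ _ (expands_linear p c d _ _ _ _ fa gb))).
  exact: expands_linear (G_expands p q f _ fa) (G_expands p q g _ gb).
- move=> f /(E2_expands _ _ ha hb) fa; have ga := G_expands p q f _ fa.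
  rewrite (normsqE _ _ (expands_L2 _ _ ha hb p f _ fa)).
  by rewrite (normsqE _ _ (expands_L2 _ _ ha hb q _ _ ga)) (expands_same_norm p q _ _ _ fa ga).
- move=> f g /(E2_expands _ _ ha hb) fa /(E2_expands _ _ ha hb) gb.
  exact: expands_same_dot fa gb (G_expands p q f _ fa) (G_expands p q g _ gb).
- by move=> g Yg; exists (GT q p g); [exact: E2_G|exact: G_G].
Qed.

End isometry.

Theorem theorem4 (R : realType) (alpha beta0 : R)
    (halpha : -1 < alpha) (hbeta0 : -1 < beta0 /\ beta0 <= 0) (p q : nat) :
  (* the series and the integrals defining G and its inverse converge *)
  [/\ (forall xi : R[i], modulus xi < 1 ->
         cvgn (series (F_term alpha beta0 xi))),
      (forall f, E2 alpha beta0 p f -> forall z, punctured_disk R z ->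
         Cintegrable (mu_shift alpha beta0 p)
           (G_integrand alpha beta0 p q f z)),
      (forall f, E2 alpha beta0 q f -> forall w, punctured_disk R w ->
         Cintegrable (mu_shift alpha beta0 q)
           (Ginv_integrand alpha beta0 p q f w)),
      isometry_onto (mu_shift alpha beta0 p) (mu_shift alpha beta0 q)
        (E2 alpha beta0 p) (E2 alpha beta0 q) (G alpha beta0 p q)
    & inverse_map (E2 alpha beta0 p) (E2 alpha beta0 q)
        (G alpha beta0 p q) (Ginv alpha beta0 p q)].
Proof.
have [hb _] := hbeta0.
split.
- by move=> xi; exact: F_series_cvg.
- move=> f /(E2_expands _ _ halpha hb) fa z Pz.
  exact: (G_integrand_integrable _ _ halpha hb p q f _ z fa Pz).
- move=> f /(E2_expands _ _ halpha hb) fa w Pw.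
  exact: (G_integrand_integrable _ _ halpha hb q p f _ w fa Pw).
- exact: G_isometry_onto.
- rewrite Ginv_G; split.
  + by move=> g; exact: E2_G.
  + by move=> f; exact: G_G.
  + by move=> g; exact: G_G.
Qed.
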